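(* Let $(\Omega,\mathcal H,\mathbb E)$ be a sub-linear expectation space with $\mathbb E$ countably sub-additive. Let $l$ be a function slowly varying at infinity, and let $\{a_i,-\infty<i<\infty\}$ be a sequence of real numbers with $\sum_{i=-\infty}^{\infty}|a_i|<\infty$. Let $p\ge 1$ and $r\ge\max\{2,p\}$, and let $\{g(n);n\ge1\}$ and $\{f(n);n\ge 1\}$ be two sequences of positive constants such that (with all $O(\cdot)$ as $k\to\infty$): (C1) $f(n)\uparrow\infty$ and $\frac{n}{f^p(n)}\to 0$ as $n\to\infty$; (C2) $\sum_{m=1}^{k}\log\left(\frac{f(m+1)}{f(m)}\right)\sum_{n=1}^{m}\frac{n g(n) l(n)}{f(n)}=O\left(f^{p-1}(k)l(k)\right)$; (C3) $\sum_{m=k}^{\infty}\left[f^{1-r}(m)-f^{1-r}(m+1)\right]\sum_{n=1}^{m}\frac{n g(n) l(n)}{f(n)}=O\left(f^{p-r}(k)l(k)\right)$; (C4) $\sum_{m=1}^{k}\left[f(m+1)-f(m)\right]\sum_{n=1}^{m}\frac{n g(n) l(n)}{f(n)}=O\left(f^{p}(k)l(k)\right)$; (C5) $\sum_{m=1}^{\infty}\left[f^{1-r}(m)-f^{1-r}(m+1)\right]f^{t}(m+1)\sum_{n=1}^{m}\frac{n^{r/2} g(n) l(n)}{f(n)}<\infty$, where $t=\max\{0,2-p\}\,r/2$; (C6) $\sum_{m=1}^{\infty}\left[f(m+1)-f(m)\right]f^{t'}(m+1)\sum_{n=1}^{m}\frac{n^{r/2} g(n) l(n)}{f(n)}<\infty$,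 where $t'=-\min\{2,p\}\,r/2$. Let $\{Y_i,-\infty<i<\infty\}\subset\mathcal H$ be a sequence of negatively dependent random variables, identically distributed as a random variable $Y\in\mathcal H$, with $\mathbb E(Y)=\mathbb E(-Y)=0$ and $$C_{\mathbb V}\left(|Y|^p\left(1\vee l(f^{-1}(|Y|))\right)\right)<\infty,$$ where $f^{-1}$ is the inverse function of $f$. Let $X_n=\sum_{i=-\infty}^{\infty}a_iY_{i+n}$, $n\ge1$, be the moving average process generated by $\{Y_i\}$. Then for all $\varepsilon>0$, $$\sum_{n=1}^{\infty}\frac{g(n)l(n)}{f(n)}\,C_{\mathbb V}\left\{\left(\max_{1\le k\le n}\left|\sum_{j=1}^{k}X_j\right|-\varepsilon f(n)\right)^{+}\right\}<\infty.$$
   Context: Notation: $f^s(n)=(f(n))^s$, $a^+=\max\{a,0\}$, $a\vee b=\max\{a,b\}$, and $I_A$ is the indicator of $A$. Sub-linear expectation space. $(\Omega,\mathcal F)$ is a measurable space. $C_{l,Lip}(\mathbb R^n)$ is the linear space of functions $\varphi:\mathbb R^n\to\mathbb R$ satisfying $|\varphi(\mathbf x)-\varphi(\mathbf y)|\le C(1+|\mathbf x|^m+|\mathbf y|^m)|\mathbf x-\mathbf y|$ for all $\mathbf x,\mathbf y\in\mathbb R^n$, for some $C>0$, $m\in\mathbb N$ depending on $\varphi$. $\mathcal H$ is a set of random variables on $(\Omega,\mathcal F)$ such that $X_1,\dots,X_n\in\mathcal H$ implies $\varphi(X_1,\dots,X_n)\in\mathcal H$ for each $\varphi\in C_{l,Lip}(\mathbb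 R^n)$. A sub-linear expectation is a functional $\mathbb E:\mathcal H\to[-\infty,\infty]$ such that for all $X,Y\in\mathcal H$: (a) $X\ge Y$ implies $\mathbb E[X]\ge\mathbb E[Y]$; (b) $\mathbb E[c]=c$ for $c\in\mathbb R$; (c) $\mathbb E[\lambda X]=\lambda\mathbb E[X]$ for $\lambda\ge0$; (d) $\mathbb E[X+Y]\le\mathbb E[X]+\mathbb E[Y]$ whenever $\mathbb E[X]+\mathbb E[Y]$ is not of the form $\infty-\infty$ or $-\infty+\infty$. $\mathbb E$ is countably sub-additive if $\mathbb E(X)\le\sum_{n=1}^\infty\mathbb E(X_n)$ whenever $X\le\sum_{n=1}^\infty X_n$ with $X,X_n\in\mathcal H$, $X\ge0$, $X_n\ge0$. Capacity and Choquet integral. For $A\in\mathcal F$, $\mathbb V(A)=\inf\{\mathbb E[\xi]: I_A\le\xi,\ \xi\in\mathcal H\}$. For a random variable $X$, $C_{\mathbb V}(X)=\int_0^\infty\mathbb V(X>x)\,dx+\int_{-\infty}^0(\mathbb V(X>x)-1)\,dx$. Negative dependence. For random vectors $\mathbf X=(X_1,\dots,X_m)$ and $\mathbf Y=(Y_1,\dots,Y_n)$ with components in $\mathcal H$, $\mathbf Y$ is negatively dependent to $\mathbf X$ if for all $\psi_1\in C_{l,Lip}(\mathbb R^m)$, $\psi_2\in C_{l,Lip}(\mathbb R^n)$ one has $\mathbb E[\psi_1(\mathbf X)\psi_2(\mathbf Y)]\le\mathbb E[\psi_1(\mathbf X)]\,\mathbb E[\psi_2(\mathbf Y)]$ whenever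 $\psi_1(\mathbf X)\ge0$, $\mathbb E[\psi_2(\mathbf Y)]\ge0$, $\mathbb E[\psi_1(\mathbf X)\psi_2(\mathbf Y)]<\infty$, $\mathbb E[|\psi_1(\mathbf X)|]<\infty$, $\mathbb E[|\psi_2(\mathbf Y)|]<\infty$, and either $\psi_1,\psi_2$ are both coordinatewise nondecreasing or both coordinatewise nonincreasing. A sequence $\{X_n\}_{n\ge1}$ is negatively dependent if $X_{n+1}$ is negatively dependent to $(X_1,\dots,X_n)$ for each $n\ge1$; a doubly infinite sequence $\{Y_i,-\infty<i<\infty\}$ is negatively dependent if $Y_{n+1}$ is negatively dependent to $(Y_m,\dots,Y_n)$ for all integers $m\le n$. Identical distribution. $X_1,X_2\in\mathcal H$ are identically distributed if $\mathbb E[\psi(X_1)]=\mathbb E[\psi(X_2)]$ for every $\psi\in C_{l,Lip}(\mathbb R)$ whenever the sub-linear expectations are finite; ''$\{Y_i\}$ identically distributed as $Y$'' means that each $Y_i$ and $Y$ are identically distributed. Slow variation. A real function $l$, positive and measurable on $[0,\infty)$, is slowly varying at infinity if $\lim_{x\to\infty} l(\lambda x)/l(x)=1$ for each $\lambda>0$. Inverse of $f$. For $f^{-1}$ to make sense, the sequence $f(n)$ is regarded as the values at the positive integers of a continuous, strictly increasing bijection $f:[0,\infty)\to[0,\infty)$, and $f^{-1}$ is its inverse.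
   Formalization: The formal theorem additionally assumes that each moving average variable X_n (n ≥ 1) belongs to the space H; without this the claim fails, e.g. when H consists only of functions of finitely many of the Y_i. *)

(* Defs.v *)
From HB Require Import structures.
From mathcomp Require Import all_boot all_order all_algebra.
From mathcomp Require Import all_classical all_reals all_analysis.

Set Implicit Arguments.
Unset Strict Implicit.
Unset Printing Implicit Defensive.

Import Order.TTheory GRing.Theory Num.Theory.
Import numFieldNormedType.Exports.

Local Open Scope classical_set_scope.
Local Open Scope ring_scope.

(* The class C_{l,Lip}.  On 'rV[R]_n the library norm is the sup norm; the
   class does not depend on the choice of norm, since norms on R^n are
   equivalent and C is arbitrary. *)
Definition Cl_lip (R : realType) (V : normedZmodType R) (phi : V -> R) : Prop :=
  exists (C : R) (m : nat), 0 < C /\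
    forall x y : V,
      `|phi x - phi y| <= C * (1 + `|x| ^+ m + `|y| ^+ m) * `|x - y|.

Definition rvec (R : realType) (T : Type) (n : nat) (X : 'I_n -> T -> R)
  (w : T) : 'rV[R]_n := \row_i X i w.

Definition coord_nondecreasing (R : realType) (n : nat)
    (psi : 'rV[R]_n -> R) : Prop :=
  forall x y : 'rV[R]_n, (forall i, x ord0 i <= y ord0 i) -> psi x <= psi y.

Definition coord_nonincreasing (R : realType) (n : nat)
    (psi : 'rV[R]_n -> R) : Prop :=
  forall x y : 'rV[R]_n, (forall i, x ord0 i <= y ord0 i) -> psi y <= psi x.

(* H is a set of random variables.  The functional is represented by a total
   function E on T -> R, but only its values on H are ever used. *)
Record sublinear_space (d : measure_display) (T : measurableType d)
    (R : realType) (H : set (T -> R)) (E : (T -> R) -> \bar R) : Prop := {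
  sl_meas : forall X, H X -> measurable_fun [set: T] X ;
  sl_cst : forall c : R, H (fun=> c) ;
  sl_comp : forall (n : nat) (X : 'I_n -> T -> R) (phi : 'rV[R]_n -> R),
    (0 < n)%N -> (forall i, H (X i)) -> Cl_lip phi ->
    H (fun w => phi (rvec X w)) ;
  sl_mono : forall X Y, H X -> H Y -> (forall w, Y w <= X w) ->
    (E Y <= E X)%E ;
  sl_const : forall c : R, E (fun=> c) = c%:E ;
  sl_homo : forall (lambda : R) X, 0 <= lambda -> H X ->
    E (fun w => lambda * X w) = (lambda%:E * E X)%E ;
  sl_subadd : forall X Y, H X -> H Y -> (E X +? E Y)%E ->
    (E (fun w => (X w + Y w)%R) <= E X + E Y)%E }.

Definition countably_subadditive (T : Type) (R : realType)
    (H : set (T -> R)) (E : (T -> R) -> \bar R) : Prop :=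
  forall (X : T -> R) (Xs : nat -> T -> R),
    H X -> (forall n, H (Xs n)) ->
    (forall w, 0 <= X w) -> (forall n w, 0 <= Xs n w) ->
    (forall w, ((X w)%:E <= \sum_(0 <= n <oo) (Xs n w)%:E)%E) ->
    (E X <= \sum_(0 <= n <oo) E (Xs n))%E.

Definition capacity (T : Type) (R : realType) (H : set (T -> R))
    (E : (T -> R) -> \bar R) (A : set T) : \bar R :=
  ereal_inf [set E xi | xi in
    [set xi : T -> R | H xi /\ forall w, \1_A w <= xi w]].

Definition choquet (T : Type) (R : realType) (V : set T -> \bar R)
    (X : T -> R) : \bar R :=
  (\int[lebesgue_measure]_(x in `[0%R, +oo[) V [set w | (x < X w)%R] +
   \int[lebesgue_measure]_(x in `]-oo, 0%R]) (V [set w | (x < X w)%R] - 1))%E.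

Definition neg_dep_to (T : Type) (R : realType) (E : (T -> R) -> \bar R)
    (m n : nat) (X : 'I_m -> T -> R) (Y : 'I_n -> T -> R) : Prop :=
  forall (psi1 : 'rV[R]_m -> R) (psi2 : 'rV[R]_n -> R),
    Cl_lip psi1 -> Cl_lip psi2 ->
    (coord_nondecreasing psi1 /\ coord_nondecreasing psi2) \/
    (coord_nonincreasing psi1 /\ coord_nonincreasing psi2) ->
    (forall w, 0 <= psi1 (rvec X w)) ->
    (0 <= E (fun w => psi2 (rvec Y w)))%E ->
    (E (fun w => (psi1 (rvec X w) * psi2 (rvec Y w))%R) < +oo)%E ->
    (E (fun w => `|psi1 (rvec X w)|%R) < +oo)%E ->
    (E (fun w => `|psi2 (rvec Y w)|%R) < +oo)%E ->
    (E (fun w => (psi1 (rvec X w) * psi2 (rvec Y w))%R) <=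
     E (fun w => psi1 (rvec X w)) * E (fun w => psi2 (rvec Y w)))%E.

(* Y_{n+1} against (Y_m, ..., Y_n) for all integers m <= n, with n = m + k. *)
Definition neg_dep_seq (T : Type) (R : realType) (E : (T -> R) -> \bar R)
    (Y : int -> T -> R) : Prop :=
  forall (m : int) (k : nat),
    neg_dep_to E (fun i : 'I_k.+1 => Y (m + i%:Z))
                 (fun _ : 'I_1 => Y (m + k%:Z + 1)).

Definition ident_distr (T : Type) (R : realType) (E : (T -> R) -> \bar R)
    (X1 X2 : T -> R) : Prop :=
  forall psi : R -> R, Cl_lip psi ->
    E (fun w => psi (X1 w)) \is a fin_num ->
    E (fun w => psi (X2 w)) \is a fin_num ->
    E (fun w => psi (X1 w)) = E (fun w => psi (X2 w)).

Definition slowly_varying (R : realType) (l : R -> R) : Prop :=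
  [/\ measurable_fun (`[0, +oo[ : set R) l,
      forall x, 0 <= x -> 0 < l x &
      forall lambda : R, 0 < lambda ->
        l (lambda * x) / l x @[x --> +oo] --> (1 : R)].

(* F is a continuous strictly increasing bijection of [0, oo) whose values at
   the positive integers are the f n. *)
Definition interpolates (R : realType) (F : R -> R) (f : nat -> R) : Prop :=
  [/\ {within `[0, +oo[, continuous F},
      {in `[0, +oo[ &, {homo F : x y / x < y}},
      set_bij `[0, +oo[ `[0, +oo[ F &
      forall n, (0 < n)%N -> F n%:R = f n].

Definition inv_on_nonneg (R : realType) (F : R -> R) : R -> R :=
  'pinv_(fun=> 0) `[0, +oo[ F.

(* X_n = \sum_(i in Z) a_i Y_(i+n), as the limit of the sums over
   -N <= i <= N (with k = i + N).  limn is total: at a point w where these sums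
   diverge its value is a default one. *)
Definition moving_average (T : Type) (R : realType) (a : int -> R)
    (Y : int -> T -> R) (n : nat) (w : T) : R :=
  limn (fun N : nat =>
    \sum_(k < N.*2.+1) a (k%:Z - N%:Z) * Y (k%:Z - N%:Z + n%:Z) w).

(* \sum_(n <= m) n^s g(n) l(n) / f(n); only s = 1 and s = r / 2 occur. *)
Definition wsum (R : realType) (f g : nat -> R) (l : R -> R) (s : R)
    (m : nat) : R :=
  \sum_(1 <= n < m.+1) n%:R `^ s * g n * l n%:R / f n.

Definition condC1 (R : realType) (p : R) (f : nat -> R) : Prop :=
  [/\ forall m n, (0 < m)%N -> (m <= n)%N -> f m <= f n,
      f n @[n --> \oo] --> +oo &
      n%:R / f n `^ p @[n --> \oo] --> (0 : R)].

Definition condC2 (R : realType) (p : R) (f g : nat -> R) (l : R -> R) : Prop :=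
  (fun k : nat => \sum_(1 <= m < k.+1) ln (f m.+1 / f m) * wsum f g l 1 m : R)
  =O_\oo (fun k => f k `^ (p - 1) * l k%:R).

Definition termC3 (R : realType) (r : R) (f g : nat -> R) (l : R -> R)
    (m : nat) : \bar R :=
  ((f m `^ (1 - r) - f m.+1 `^ (1 - r)) * wsum f g l 1 m)%:E.

Definition condC3 (R : realType) (p r : R) (f g : nat -> R) (l : R -> R) : Prop :=
  (\sum_(1 <= m <oo) termC3 r f g l m < +oo)%E /\
  (fun k : nat => fine (\sum_(k <= m <oo) termC3 r f g l m)%E : R)
  =O_\oo (fun k => f k `^ (p - r) * l k%:R).

Definition condC4 (R : realType) (p : R) (f g : nat -> R) (l : R -> R) : Prop :=
  (fun k : nat => \sum_(1 <= m < k.+1) (f m.+1 - f m) * wsum f g l 1 m : R)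
  =O_\oo (fun k => f k `^ p * l k%:R).

Definition condC5 (R : realType) (p r : R) (f g : nat -> R) (l : R -> R) : Prop :=
  let t := Num.max 0 (2 - p) * r / 2 in
  (\sum_(1 <= m <oo)
     ((f m `^ (1 - r) - f m.+1 `^ (1 - r)) * f m.+1 `^ t
      * wsum f g l (r / 2) m)%:E < +oo)%E.

Definition condC6 (R : realType) (p r : R) (f g : nat -> R) (l : R -> R) : Prop :=
  let t' := - (Num.min 2 p) * r / 2 in
  (\sum_(1 <= m <oo)
     ((f m.+1 - f m) * f m.+1 `^ t' * wsum f g l (r / 2) m)%:E < +oo)%E.

(* Main.v *)
Require Import Defs.
From HB Require Import structures.
From mathcomp Require Import all_boot all_order all_algebra.
From mathcomp Require Import all_classical all_reals all_analysis.
From mathcomp Require Import measurable_realfun.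
From mathcomp Require Import ring lra.
Import Order.TTheory GRing.Theory Num.Theory.
Import numFieldNormedType.Exports.
Local Open Scope classical_set_scope.
Local Open Scope ring_scope.
Set Implicit Arguments.
Unset Strict Implicit.

(** Why the series converges. Write M_n for max_(1 <= k <= n) |X_1 + ... + X_k|
    and V for the capacity. A maximal inequality of Rosenthal type for
    windows of n consecutive variables Y_i bounds V (M_n > x) by two terms, and
    the growth conditions on f, g and l make the weighted sums of both finite.

    Rosenthal's inequality ([walk_moment]). Sub-linear expectations come with
    no conditional expectation, and negative dependence controls only products
    psi1 (past) * psi2 (next) of two functions monotone in the same direction.
    Instead of the maximal partial sums one follows the reflected walk
    W_(k+1) = max (0, W_k + x_k): it is a nondecreasing function of the steps,
    and the walks of x and of - x together dominate every partial sum
    ([abs_partial_sum_le_walks]). Expand W_(k+1)^q around W_k. The first-order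
    term q W^(q-1) x is a product of nondecreasing functions, but the
    second-order term W^(q-2) x^2 is not. It becomes one after completing the
    square, since x^2 + 2 L x is nondecreasing on x >= - L, and the linear term
    so spent is taken from the first-order one in such a way that both
    coefficients remain nonnegative and nondecreasing ([slope_curvature],
    [reflected_step]). The steps are therefore bounded below by - L, in addition
    to being truncated at a level s ([bclip]).

    Moving averages ([capacity_tail_le_cost], [moving_average_tail]). M_n is at
    most the sum of |a_i| times the maximal partial sum of the window of n
    variables that starts at i + 1. This is a pathwise inequality, trivial
    where that sum is infinite ([norm_sum_limn_le]), so countable sub-additivity turns
    it into a bound for V (M_n > s) by the expected costs of the windows.

    Layers ([E_le_layer_sum], [layered_tail]). The expectation of an unbounded
    function of |Y| has no integral representation. Fix levels z_0, z_1, ...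
    and put v_j = V (|Y| > z_(j-1)), v_0 = 1. Countable sub-additivity gives
    E [Phi (|Y|)] <= sum_j Phi (2 z_j) v_j for nondecreasing Phi >= 0. Applied to
    the truncated moments that enter Rosenthal's inequality, it yields
      V (M_n > x) <= C (n sum_j min (2 z_j / x, (2 z_j / x)^r) v_j
                        + (n C0 x^(- min (2, p)))^(r/2)).

    Summation. The Choquet integral of (M_n - eps f(n))^+ is cut at the values
    eps f(m), m >= n, and the sums over n and m are exchanged. The second term
    of the tail bound leaves the series of [condC5]. The first leaves, for each
    j, the kernel series
      K (z) = sum_m (sum_(n <= m) n g(n) l(n) / f(n))
                min (z ln (f(m+1) / f(m)), z^r (f(m)^(1-r) - f(m+1)^(1-r)))
    at z = 2 z_j. If f(k) <= z < f(k+1), the terms with m <= k are bounded by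
    [condC2] and the others by [condC3]. The bounds are multiples of z^p l(k) and
    z^p l(k+1), which are comparable to z^p l(f^-1(z)) because l is slowly
    varying ([slowly_varying_comparable]): hence
    K (z) <= C (1 + z^p max (1, l (f^-1(z)))) ([kernel_sum_le]). The levels are
    chosen such that |Y| > z_j forces |Y|^p max (1, l (f^-1(|Y|))) > 2^j while
    K (2 z_j) <= C 2^j ([exists_levels]). What remains is sum_j 2^j v_j, which
    the moment hypothesis makes finite. *)

(** * One step of a reflected walk *)

Section PowerInequalities.
Variable R : realType.
Implicit Types t x : R.

Lemma mixed_power_le k t x : 0 <= t -> 0 <= x ->
  t * x ^+ k.+2 <= t ^+ k.+1 * x ^+ 2 + x ^+ k.+3 /\
  t ^+ k * x ^+ 3 <= t ^+ k.+1 * x ^+ 2 + x ^+ k.+3.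
Proof.
move=> t0 x0; have [xt|tx] := leP x t.
  have h : 0 <= x ^+ k.+3 by apply: exprn_ge0.
  split.
    apply: ler_wpDr => //; rewrite -addn2 exprD mulrA [t ^+ k.+1]exprS.
    apply: ler_wpM2r; first exact: exprn_ge0.
    by apply: ler_wpM2l => //; apply: lerXn2r; rewrite ?nnegrE.
  apply: ler_wpDr => //; rewrite [t ^+ k.+1]exprSr -mulrA; apply: ler_wpM2l; first exact: exprn_ge0.
  by rewrite [x ^+ 3]exprS; apply: ler_wpM2r => //; apply: exprn_ge0.
have {}tx := ltW tx; have h : 0 <= t ^+ k.+1 * x ^+ 2.
  by apply: mulr_ge0; apply: exprn_ge0.
split; apply: ler_wpDl => //.
  by rewrite [leRHS]exprS; apply: ler_wpM2r => //; apply: exprn_ge0.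
rewrite -[k.+3]addn3 exprD; apply: ler_wpM2r; first exact: exprn_ge0.
by apply: lerXn2r; rewrite ?nnegrE.
Qed.

(** By induction on k: multiplying the remainder of order k by t + x gives
    that of order k+1, up to mixed terms absorbed by [mixed_power_le]. *)
Lemma taylor_power k : exists2 c : R, 1 <= c & forall t x, 0 <= t ->
  `|(t + x) ^+ k.+2 - t ^+ k.+2 - k.+2%:R * t ^+ k.+1 * x| <=
  c * (t ^+ k * x ^+ 2 + `|x| ^+ k.+2).
Proof.
elim: k => [|k [c c1 IH]].
  exists 1 => // t x t0.
  rewrite (_ : (t + x) ^+ 2 - _ - _ = x ^+ 2); last by ring.
  by rewrite expr0 !mul1r ger0_norm ?sqr_ge0// lerDl exprn_ge0.
exists (3 * c + k.+2%:R); first by have : (0:R) <= k.+2%:R by []; lra.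
move=> t x t0.
have -> : (t + x) ^+ k.+3 - t ^+ k.+3 - k.+3%:R * t ^+ k.+2 * x =
  (t + x) * ((t + x) ^+ k.+2 - t ^+ k.+2 - k.+2%:R * t ^+ k.+1 * x)
  + k.+2%:R * (t ^+ k.+1 * x ^+ 2).
  have -> : k.+3%:R = k.+2%:R + 1 :> R by rewrite -natr1.
  by rewrite !exprS; ring.
have := IH t x t0; set r := (X in `|X|); set y := `|x| => hr.
have y0 : 0 <= y by exact: normr_ge0.
have xy : x ^+ 2 = y ^+ 2 by rewrite /y real_normK ?num_real.
rewrite xy in hr *.
apply: (le_trans (ler_normD _ _)); rewrite normrM.
have [h1 h2] := mixed_power_le k t0 y0.
have p1 : 0 <= t ^+ k.+1 * y ^+ 2 by apply: mulr_ge0; apply: exprn_ge0.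
have p2 : 0 <= y ^+ k.+3 by apply: exprn_ge0.
set P := t ^+ k.+1 * y ^+ 2 in h1 h2 p1 *; set Q := y ^+ k.+3 in h1 h2 p2 *.
have -> : `|k.+2%:R * P| = k.+2%:R * P by rewrite ger0_norm// mulr_ge0.
have tx : `|t + x| <= t + y by rewrite (le_trans (ler_normD _ _))// ger0_norm.
have : `|t + x| * `|r| <= (t + y) * (c * (t ^+ k * y ^+ 2 + y ^+ k.+2)).
  by apply: ler_pM.
have -> : (t + y) * (c * (t ^+ k * y ^+ 2 + y ^+ k.+2)) =
   c * (P + t ^+ k * y ^+ 3 + t * y ^+ k.+2 + Q) by rewrite /P /Q !exprS; ring.
have h3 : c * (P + t ^+ k * y ^+ 3 + t * y ^+ k.+2 + Q) <= c * (3 * (P + Q)).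
  by apply: ler_wpM2l; lra.
have h4 : 0 <= k.+2%:R * Q by rewrite mulr_ge0.
nra.
Qed.

(** Reflection at 0 can be ignored for an even power, which is why only even
    moments of reflected walks are estimated. *)
Lemma pow_max0_le k (y : R) : ~~ odd k -> Num.max 0 y ^+ k.+2 <= y ^+ k.+2.
Proof.
move=> ek; have [h|h] := leP 0 y => //.
by rewrite expr0n /=; apply: exprn_even_ge0; rewrite /= negbK.
Qed.

(** Coefficients of x and, up to a constant, of (x + L)^2 - L^2 in the
    expansion of max (0, t + x)^(k+2), for D proportional to L. The natural second-order
    coefficient t^k is lowered by min (t, D)^k, a quantity at most of order
    L^k, which goes into the error term; without this the slope would not be
    nonnegative for small t. *)
Definition slope k (D t : R) := k.+2%:R * (t ^+ k * Num.max 0 (t - D) + Num.min t D ^+ k.+1).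
Definition curvature k (D t : R) := t ^+ k - Num.min t D ^+ k.

(** Completing the square in the second-order term costs a linear term with
    coefficient proportional to L times the curvature, and this identity takes
    it from the first-order term. *)
Lemma slope_curvature k (D t : R) :
  k.+2%:R * t ^+ k.+1 = slope k D t + k.+2%:R * D * curvature k D t.
Proof.
rewrite /slope /curvature; have [tD|Dt] := leP t D.
  have -> : Num.max 0 (t - D) = 0 by apply/max_idPl; rewrite subr_le0.
  by rewrite !exprS; ring.
have -> : Num.max 0 (t - D) = t - D by apply/max_idPr; rewrite subr_ge0 ltW.
by rewrite !exprS; ring.
Qed.

Lemma slope_ge0 k (D t : R) : 0 <= D -> 0 <= t -> 0 <= slope k D t.
Proof.
move=> D0 t0; rewrite /slope mulr_ge0// addr_ge0 ?mulr_ge0 ?exprn_ge0//.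
  by rewrite le_max lexx.
by rewrite le_min t0.
Qed.

Lemma slope_homo k (D t u : R) : 0 <= D -> 0 <= t -> t <= u -> slope k D t <= slope k D u.
Proof.
move=> D0 t0 tu; have u0 := le_trans t0 tu.
rewrite /slope ler_wpM2l// lerD// ?ler_pM ?exprn_ge0 ?lerXn2r ?nnegrE ?le_min ?t0 ?u0//=.
- by rewrite le_max lexx.
- by rewrite ge_max !le_max lexx /= lerB ?orbT.
- by rewrite !ge_min tu lexx orbT.
Qed.

Lemma curvature_ge0 k (D t : R) : 0 <= D -> 0 <= t -> 0 <= curvature k D t.
Proof.
move=> D0 t0; rewrite /curvature subr_ge0 lerXn2r ?nnegrE// ?le_min ?t0//.
by rewrite ge_min lexx.
Qed.

Lemma curvature_homo k (D t u : R) : 0 <= D -> 0 <= t -> t <= u ->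
  curvature k D t <= curvature k D u.
Proof.
move=> D0 t0 tu; rewrite /curvature; have [tD|Dt] := leP t D.
  by rewrite subrr; apply: (curvature_ge0 k D0 (le_trans t0 tu)).
have uD := lt_le_trans Dt tu.
have -> : Num.min u D = D by apply/min_idPr/ltW.
by rewrite lerB// lerXn2r ?nnegrE// (le_trans t0).
Qed.

Lemma slope_le k (D t : R) : 0 <= D -> 0 <= t -> slope k D t <= k.+2%:R * t ^+ k.+1.
Proof.
move=> D0 t0; rewrite (slope_curvature k D) lerDl !mulr_ge0//.
exact: curvature_ge0.
Qed.

Lemma curvature_le k (D t : R) : 0 <= D -> 0 <= t -> curvature k D t <= t ^+ k.
Proof. by move=> D0 t0; rewrite gerBl exprn_ge0// le_min t0. Qed.

(** Taylor's formula rearranged so that the coefficients of x and of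
    (x + L)^2 - L^2 are nonnegative nondecreasing functions of the position t,
    while both of these are nondecreasing in a step x >= - L. *)
Lemma reflected_step k : ~~ odd k -> exists c C : R, [/\ 0 <= c, 0 <= C &
  forall L t x, 0 <= L -> 0 <= t ->
  let D := c * 2 / k.+2%:R * L in
  Num.max 0 (t + x) ^+ k.+2 <= t ^+ k.+2 + slope k D t * x
    + curvature k D t * (c * ((x + L) ^+ 2 - L ^+ 2))
    + C * (L ^+ k * x ^+ 2 + `|x| ^+ k.+2)].
Proof.
move=> ek; have [c c1 tay] := taylor_power k.
have c0 : 0 <= c by lra.
set K := c * 2 / k.+2%:R.
have K0 : 0 <= K by rewrite /K !mulr_ge0.
exists c, (c * (K ^+ k + 1)); split => //; first by rewrite mulr_ge0// addr_ge0// exprn_ge0.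
move=> L t x L0 t0 /=; rewrite -/K; set D := K * L.
have D0 : 0 <= D by rewrite mulr_ge0.
apply: (le_trans (pow_max0_le _ ek)).
have := tay t x t0; rewrite ler_norml => /andP[_].
rewrite (slope_curvature k D t) => h.
have eD : k.+2%:R * D = 2 * c * L.
  by rewrite /D /K; field.
rewrite eD in h.
have m0 : 0 <= Num.min t D by rewrite le_min t0.
have et : t ^+ k = curvature k D t + Num.min t D ^+ k by rewrite /curvature subrK.
have mD : Num.min t D ^+ k <= K ^+ k * L ^+ k.
  by rewrite -exprMn lerXn2r ?nnegrE ?ge_min ?lexx ?orbT.
have x2 : 0 <= x ^+ 2 by exact: sqr_ge0.
have h2 : c * (Num.min t D ^+ k * x ^+ 2) <= c * ((K ^+ k * L ^+ k) * x ^+ 2).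
  by rewrite ler_wpM2l// ler_wpM2r.
have h3 : 0 <= c * (L ^+ k * x ^+ 2) by do !apply: mulr_ge0 => //; apply: exprn_ge0.
have h4 : 0 <= c * (K ^+ k * `|x| ^+ k.+2) by do !apply: mulr_ge0 => //; apply: exprn_ge0.
rewrite et in h.
have -> : c * ((x + L) ^+ 2 - L ^+ 2) = 2 * c * L * x + c * x ^+ 2 by ring.
nra.
Qed.

End PowerInequalities.

(** * Reflected walks and truncated steps *)

Section Walks.
Variable R : realType.
Implicit Types (x y : nat -> R) (n k : nat).

(** The Lindley recursion: the largest sum of a final segment of x_0, ..., x_(k-1). *)
Fixpoint walk x k : R := if k is k'.+1 then Num.max 0 (walk x k' + x k') else 0.

Lemma walk_ge0 x k : 0 <= walk x k.
Proof. by case: k => [|k] //=; rewrite le_max lexx. Qed.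

Lemma walk_homo x y n : (forall i, (i < n)%N -> x i <= y i) -> walk x n <= walk y n.
Proof.
elim: n => //= n IH xy; rewrite ge_max !le_max lexx /= lerD ?orbT//.
  by apply: IH => i /ltnW /xy.
exact: xy.
Qed.

Lemma walk_eq x y n : (forall i, (i < n)%N -> x i = y i) -> walk x n = walk y n.
Proof.
by move=> h; apply/eqP; rewrite eq_le !walk_homo// => i /h ->.
Qed.

Lemma partial_sum_gap_le_walk x n k : (k <= n)%N ->
  \sum_(0 <= j < n) x j - \sum_(0 <= j < k) x j <= walk x n.
Proof.
elim: n k => [|n IH] k; first by rewrite leqn0 => /eqP ->; rewrite subrr.
rewrite leq_eqVlt => /orP[/eqP ->|]; first by rewrite subrr walk_ge0.
rewrite ltnS => /IH h; rewrite big_nat_recr//= addrAC le_max.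
by rewrite (lerD h (lexx _)) orbT.
Qed.

(** A partial sum is a difference of two sums of final segments; the walk of x
    bounds such sums from above and the walk of - x bounds their opposites. *)
Lemma abs_partial_sum_le_walks x n k : (k <= n)%N ->
  `|\sum_(0 <= j < k) x j| <= walk x n + walk (fun j => - x j) n.
Proof.
move=> kn.
have h1 := partial_sum_gap_le_walk x (leq0n n).
have h2 := partial_sum_gap_le_walk x kn.
have h3 := partial_sum_gap_le_walk (fun j => - x j) (leq0n n).
have h4 := partial_sum_gap_le_walk (fun j => - x j) kn.
rewrite !sumrN !big_nil in h1 h3 h4.
move: h1 h2 h3 h4; set A := \sum_(0 <= j < n) _; set B := \sum_(0 <= j < k) _ => *.
by rewrite ler_norml; apply/andP; split; lra.
Qed.

End Walks.

Section Clipping.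
Variable R : realType.
Implicit Types (c y L : R).

Definition clip c y : R := Num.max (- c) (Num.min y c).

Lemma clip_homo c : {homo clip c : y z / y <= z}.
Proof.
move=> y z yz; rewrite /clip ge_max !le_max lexx /= le_min !ge_min yz lexx /=.
by rewrite !orbT.
Qed.

Lemma clipN c y : 0 <= c -> clip c (- y) = - clip c y.
Proof.
rewrite /clip => c0; have [yc|cy] := leP y c.
  have -> : Num.max (- c) (Num.min (- y) c) = Num.min c (- y).
    by rewrite minC; apply/max_idPr; rewrite le_min; apply/andP; split; lra.
  by rewrite oppr_max opprK.
have -> : Num.min (- y) c = - y by apply/min_idPl; lra.
have -> : Num.max (- c) (- y) = - c by apply/max_idPl; lra.
by congr (- _); apply/esym/max_idPr; lra.
Qed.

Lemma norm_clip c y : 0 <= c -> `|clip c y| = Num.min `|y| c.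
Proof.
rewrite /clip => c0; case: (lerP 0 y) => y0.
  rewrite (ger0_norm y0); have [yc|cy] := leP y c.
    have -> : Num.max (- c) y = y by apply/max_idPr; lra.
    by rewrite ger0_norm.
  by rewrite (_ : Num.max _ _ = c) ?ger0_norm//; apply/max_idPr; lra.
rewrite (ltr0_norm y0).
have -> : Num.min y c = y by apply/min_idPl; lra.
have [yc|cy] := leP (- y) c.
  by rewrite (_ : Num.max _ _ = y) ?ltr0_norm//; apply/max_idPr; lra.
by rewrite (_ : Num.max _ _ = - c) ?normrN ?ger0_norm//; apply/max_idPl; lra.
Qed.

Lemma clip_dist c y : 0 <= c -> `|y - clip c y| = Num.max (`|y| - c) 0.
Proof.
rewrite /clip => c0; case: (lerP 0 y) => y0.
  rewrite (ger0_norm y0); have [yc|cy] := leP y c.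
    have -> : Num.max (- c) y = y by apply/max_idPr; lra.
    rewrite subrr normr0; apply/esym/max_idPr; lra.
  have -> : Num.max (- c) c = c by apply/max_idPr; lra.
  by rewrite ger0_norm ?subr_ge0 ?ltW//; apply/esym/max_idPl; lra.
rewrite (ltr0_norm y0).
have -> : Num.min y c = y by apply/min_idPl; lra.
have [yc|cy] := leP (- c) y.
  by rewrite subrr normr0; apply/esym/max_idPr; lra.
rewrite ler0_norm; last by lra.
by rewrite opprB addrC; apply/esym/max_idPl; lra.
Qed.

Lemma max_const_lip c y z : `|Num.max c y - Num.max c z| <= `|y - z|.
Proof.
wlog yz : y z / y <= z.
  move=> h; have [/h//|/ltW/h] := leP y z.
  by rewrite (distrC (Num.max c z)) (distrC z).
rewrite (distrC y) (distrC (Num.max c y)) !ger0_norm ?subr_ge0//; last first.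
  by rewrite ge_max !le_max lexx yz orbT.
have [cz|zc] := leP c z; first by rewrite lerB// le_max lexx orbT.
have -> : Num.max c y = c by apply/max_idPl; lra.
by rewrite subrr subr_ge0.
Qed.

Lemma min_const_lip c y z : `|Num.min c y - Num.min c z| <= `|y - z|.
Proof.
rewrite -[Num.min c y]opprK -[Num.min c z]opprK !oppr_min -opprD normrN.
by rewrite (le_trans (max_const_lip _ _ _))// -opprD normrN.
Qed.

Lemma clip_lip c y z : `|clip c y - clip c z| <= `|y - z|.
Proof.
rewrite /clip (le_trans (max_const_lip _ _ _))//.
by rewrite ![Num.min _ c]minC min_const_lip.
Qed.

(** Raising steps below - L makes (x + L)^2 nondecreasing in the step. It can
    only increase the walk, and [bclip_le_sqr] bounds the positive drift that
    it creates. *)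
Definition bclip L c y : R := Num.max (- L) (clip c y).

Lemma bclip_homo L c : {homo bclip L c : y z / y <= z}.
Proof.
move=> y z yz; rewrite /bclip; have := clip_homo c yz.
move: (clip c y) (clip c z) => {yz}y {}z yz.
by rewrite ge_max !le_max lexx yz /= orbT.
Qed.

Lemma clip_le_bclip L c y : clip c y <= bclip L c y.
Proof. by rewrite /bclip le_max lexx orbT. Qed.

Lemma bclip_ge L c y : - L <= bclip L c y.
Proof. by rewrite /bclip le_max lexx. Qed.

Lemma norm_bclip L c y : 0 <= L -> `|bclip L c y| <= `|clip c y|.
Proof.
rewrite /bclip => L0; have [h|h] := leP (- L) (clip c y) => //.
rewrite normrN (ger0_norm L0) ltr0_norm; lra.
Qed.

Lemma bclip_le_sqr L c y : 0 < L -> bclip L c y <= clip c y + L^-1 * clip c y ^+ 2.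
Proof.
rewrite /bclip => L0; set z := clip c y.
have i0 : 0 < L^-1 by rewrite invr_gt0.
have [h|h] := leP (- L) z; first by rewrite lerDl mulr_ge0// ?sqr_ge0// ltW.
rewrite -(ler_pM2l L0) mulrDr mulrA mulfV ?gt_eqF// mul1r.
nra.
Qed.

Lemma bclip_lip L c y z : `|bclip L c y - bclip L c z| <= `|y - z|.
Proof.
by apply: le_trans (clip_lip c y z); exact: max_const_lip.
Qed.

End Clipping.

(** * Bounded Lipschitz functions and sub-linear expectations *)

Section BoundedLipschitz.
Variables (R : realType).

(** Unlike locally Lipschitz functions of polynomial growth, these give finite
    expectations, as required both by negative dependence and by equality in
    distribution. *)
Definition bounded_lip (V : normedZmodType R) (f : V -> R) : Prop :=
  exists B K : R, [/\ 0 <= B, 0 <= K, (forall x, `|f x| <= B) &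
    forall x y, `|f x - f y| <= K * `|x - y|].

Variable V : normedZmodType R.
Implicit Types f g : V -> R.

Lemma lip_Cl_lip f (K : R) : (forall x y, `|f x - f y| <= K * `|x - y|) -> Cl_lip f.
Proof.
move=> h; exists (`|K| + 1), 0%N; split; first by rewrite ltr_wpDl.
move=> x y; apply: (le_trans (h x y)); apply: ler_wpM2r => //.
by rewrite !expr0; have := ler_norm K; have := normr_ge0 K; lra.
Qed.

Lemma bounded_lip_Cl_lip f : bounded_lip f -> Cl_lip f.
Proof. by move=> [B [K [_ _ _]]]; exact: lip_Cl_lip. Qed.

Lemma bounded_lip_cst (c : R) : bounded_lip (fun _ : V => c).
Proof. by exists `|c|, 0; split => // x y; rewrite subrr normr0 mul0r. Qed.

Lemma bounded_lipD f g : bounded_lip f -> bounded_lip g -> bounded_lip (fun x => f x + g x).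
Proof.
move=> [B [K [B0 K0 fB fK]]] [B' [K' [B'0 K'0 gB gK]]].
exists (B + B'), (K + K'); split; rewrite ?addr_ge0// => x.
  by rewrite (le_trans (ler_normD _ _)) ?lerD.
move=> y; rewrite (_ : _ - _ = (f x - f y) + (g x - g y)); last by ring.
by rewrite (le_trans (ler_normD _ _))// mulrDl lerD.
Qed.

Lemma bounded_lipM f g : bounded_lip f -> bounded_lip g -> bounded_lip (fun x => f x * g x).
Proof.
move=> [B [K [B0 K0 fB fK]]] [B' [K' [B'0 K'0 gB gK]]].
exists (B * B'), (B * K' + K * B'); split; rewrite ?addr_ge0 ?mulr_ge0// => x.
  by rewrite normrM ler_pM.
move=> y; rewrite (_ : _ - _ = f x * (g x - g y) + (f x - f y) * g y); last by ring.
rewrite (le_trans (ler_normD _ _))// !normrM mulrDl lerD//.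
  by rewrite -mulrA ler_pM.
by rewrite mulrAC ler_pM.
Qed.

Lemma bounded_lipX f n : bounded_lip f -> bounded_lip (fun x => f x ^+ n).
Proof.
move=> bf; elim: n => [|n IH]; first exact: (bounded_lip_cst 1).
by under eq_fun do rewrite exprS; apply: bounded_lipM.
Qed.

Lemma max_lip (a b a' b' : R) :
  `|Num.max a b - Num.max a' b'| <= `|a - a'| + `|b - b'|.
Proof.
rewrite -(subrKA (Num.max a b')) (le_trans (ler_normD _ _))// addrC lerD//.
  by rewrite ![Num.max _ b']maxC max_const_lip.
exact: max_const_lip.
Qed.

Lemma bounded_lip_max f g : bounded_lip f -> bounded_lip g ->
  bounded_lip (fun x => Num.max (f x) (g x)).
Proof.
move=> [B [K [B0 K0 fB fK]]] [B' [K' [B'0 K'0 gB gK]]].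
exists (B + B'), (K + K'); split; rewrite ?addr_ge0// => x.
  by have := fB x; have := gB x; case: (leP (f x)) => _ *; lra.
by move=> y; rewrite (le_trans (max_lip _ _ _ _))// mulrDl lerD.
Qed.

Lemma bounded_lipN f : bounded_lip f -> bounded_lip (fun x => - f x).
Proof.
move=> bf; under eq_fun do rewrite -mulN1r.
exact/bounded_lipM/bf/bounded_lip_cst.
Qed.

Lemma bounded_lip_min f g : bounded_lip f -> bounded_lip g ->
  bounded_lip (fun x => Num.min (f x) (g x)).
Proof.
move=> bf bg; under eq_fun do rewrite -[Num.min _ _]opprK oppr_min.
by apply/bounded_lipN/bounded_lip_max; apply: bounded_lipN.
Qed.

Lemma bounded_lip_comp (W : normedZmodType R) (h : W -> V) f (K : R) :
  (forall x y, `|h x - h y| <= K * `|x - y|) -> bounded_lip f ->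
  bounded_lip (fun x => f (h x)).
Proof.
move=> hK [B [L [B0 L0 fB fL]]]; exists B, (L * `|K|); split; rewrite ?mulr_ge0//.
move=> x y; apply: (le_trans (fL _ _)); rewrite -mulrA ler_wpM2l//.
by apply: (le_trans (hK _ _)); rewrite ler_wpM2r// ler_norm.
Qed.

End BoundedLipschitz.

Lemma coord_lip (R : realType) n (v w : 'rV[R]_n) i :
  `|v ord0 i - w ord0 i| <= `|v - w|.
Proof.
have -> : v ord0 i - w ord0 i = (v - w) ord0 i by rewrite !mxE.
rewrite [leRHS]mx_normrE.
exact: (le_bigmax 0 (fun ij : 'I_1 * 'I_n => `|(v - w) ij.1 ij.2|) (ord0, i)).
Qed.

Lemma bounded_lip_bclip (R : realType) (L c s : R) : 0 <= L -> 0 <= c ->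
  bounded_lip (fun y : R => bclip L c (s * y)).
Proof.
move=> L0 c0; exists c, `|s|; split => // [x|x y].
  by rewrite (le_trans (norm_bclip c _ L0))// norm_clip// ge_min lexx orbT.
by rewrite (le_trans (bclip_lip L c _ _))// -mulrBr normrM.
Qed.

Section SublinearCalculus.
Context {d : measure_display} {T : measurableType d} {R : realType}.
Context {H : set (T -> R)} {E : (T -> R) -> \bar R}.
Hypothesis hE : sublinear_space H E.
Implicit Types X Y Z : T -> R.

Lemma H_cst (c : R) : H (fun _ => c).
Proof. exact: (sl_cst hE). Qed.

Lemma H_vec n (Z : 'I_n.+1 -> T -> R) (phi : 'rV[R]_n.+1 -> R) :
  (forall i, H (Z i)) -> bounded_lip phi -> H (fun w => phi (rvec Z w)).
Proof.
by move=> HZ bphi; apply: (sl_comp hE) => //; apply: bounded_lip_Cl_lip.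
Qed.

Lemma H_lip2 X Y (phi : R -> R -> R) (K : R) : 0 <= K ->
  (forall a b a' b', `|phi a b - phi a' b'| <= K * (`|a - a'| + `|b - b'|)) ->
  H X -> H Y -> H (fun w => phi (X w) (Y w)).
Proof.
move=> K0 phiK HX HY.
pose Z (i : 'I_2) := if i == ord0 then X else Y.
pose psi (v : 'rV[R]_2) := phi (v ord0 ord0) (v ord0 (lift ord0 ord0)).
have -> : (fun w => phi (X w) (Y w)) = (fun w => psi (rvec Z w)).
  by apply/funext => w; rewrite /psi !mxE.
apply: (sl_comp hE) => //; first by move=> i; rewrite /Z; case: ifP.
apply: (@lip_Cl_lip _ _ _ (2 * K)) => v w; apply: (le_trans (phiK _ _ _ _)).
by rewrite -mulrA mulrCA ler_wpM2l// mulr_natl mulr2n lerD// coord_lip.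
Qed.

Lemma H_lip X (phi : R -> R) (K : R) : 0 <= K ->
  (forall a b, `|phi a - phi b| <= K * `|a - b|) -> H X -> H (fun w => phi (X w)).
Proof.
move=> K0 phiK HX; apply: (@H_lip2 X X (fun a _ => phi a) K) => // a b a' b'.
by apply: (le_trans (phiK _ _)); rewrite ler_wpM2l// lerDl.
Qed.

Lemma H_add X Y : H X -> H Y -> H (fun w => X w + Y w).
Proof.
apply: (@H_lip2 X Y +%R 1) => // a b a' b'; rewrite mul1r.
by rewrite opprD addrACA ler_normD.
Qed.

Lemma H_scale (c : R) X : H X -> H (fun w => c * X w).
Proof.
by apply: (@H_lip X ( *%R c) `|c|) => // a b; rewrite -mulrBr normrM.
Qed.

Lemma H_norm X : H X -> H (fun w => `|X w|).
Proof.
by apply: (@H_lip X Num.norm 1) => // a b; rewrite mul1r ler_dist_dist.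
Qed.

Lemma H_max X Y : H X -> H Y -> H (fun w => Num.max (X w) (Y w)).
Proof.
apply: (@H_lip2 X Y Num.max 1) => // a b a' b'; rewrite mul1r.
exact: max_lip.
Qed.

Lemma H_sum n (X : nat -> T -> R) : (forall i, H (X i)) ->
  H (fun w => \sum_(0 <= i < n) X i w).
Proof.
move=> HX; elim: n => [|n IH].
  by under eq_fun do rewrite big_nil; exact: H_cst.
by under eq_fun do rewrite big_nat_recr//=; apply: H_add.
Qed.

Lemma H_bigmax (I : Type) (s : seq I) (X : I -> T -> R) : (forall i, H (X i)) ->
  H (fun w => \big[Num.max/0]_(i <- s) X i w).
Proof.
move=> HX; elim: s => [|i s IH].
  by under eq_fun do rewrite big_nil; exact: H_cst.
by under eq_fun do rewrite big_cons; apply: H_max.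
Qed.

Lemma E_ge0 X : H X -> (forall w, 0 <= X w) -> (0 <= E X)%E.
Proof.
move=> HX X0; apply: (@le_trans _ _ (E (fun=> 0))); first by rewrite (sl_const hE).
by apply: (sl_mono hE) => //; exact: H_cst.
Qed.

(** Bounded elements of the domain form an algebra on which the expectation
    is finite, so that sub-additivity holds there unconditionally. *)
Definition bounded_rv X : Prop := H X /\ exists B : R, forall w, `|X w| <= B.

Lemma bounded_rv_H X : bounded_rv X -> H X. Proof. by case. Qed.

Lemma E_fin_num X : bounded_rv X -> E X \is a fin_num.
Proof.
move=> [HX [B XB]]; rewrite fin_real//; apply/andP; split.
  apply: (@lt_le_trans _ _ (- B)%:E); first by rewrite ltNyr.
  rewrite -(sl_const hE (- B)); apply: (sl_mono hE) => //; first exact: H_cst.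
  by move=> w; have := XB w; rewrite ler_norml => /andP[].
apply: (@le_lt_trans _ _ B%:E); last by rewrite ltry.
rewrite -(sl_const hE B); apply: (sl_mono hE) => //; first exact: H_cst.
by move=> w; have := XB w; rewrite ler_norml => /andP[].
Qed.

Lemma E_lty X : bounded_rv X -> (E X < +oo)%E.
Proof. by move/E_fin_num; rewrite ltey_eq => ->. Qed.

Lemma E_add X Y : bounded_rv X -> H Y -> (E (fun w => X w + Y w)%R <= E X + E Y)%E.
Proof.
move=> bX HY; apply: (sl_subadd hE) => //; first exact: bounded_rv_H.
exact/fin_num_adde_defr/E_fin_num.
Qed.

Lemma bounded_rv_cst (c : R) : bounded_rv (fun _ => c).
Proof. by split; [exact: H_cst | exists `|c|]. Qed.

Lemma bounded_rvD X Y : bounded_rv X -> bounded_rv Y -> bounded_rv (fun w => X w + Y w).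
Proof.
move=> [HX [B XB]] [HY [B' YB]]; split; first exact: H_add.
by exists (B + B') => w; rewrite (le_trans (ler_normD _ _))// lerD.
Qed.

(** Multiplication is not Lipschitz, but it is on a bounded square: the factors
    are replaced by their truncations, which do not change them. *)
Lemma bounded_rvM X Y : bounded_rv X -> bounded_rv Y -> bounded_rv (fun w => X w * Y w).
Proof.
move=> [HX [B XB]] [HY [B' YB]]; split; last first.
  by exists (B * B') => w; rewrite normrM ler_pM.
pose c := `|B| + `|B'|.
have c0 : 0 <= c by rewrite addr_ge0.
have id_clip Z w : `|Z w| <= c -> clip c (Z w) = Z w.
  rewrite ler_norml /clip => /andP[h1 h2].
  by rewrite (_ : Num.min (Z w) c = Z w) ?(elimT max_idPr)//; apply/min_idPl.
have -> : (fun w => X w * Y w) = (fun w => clip c (X w) * clip c (Y w)).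
  apply/funext => w; rewrite !id_clip// /c.
    by rewrite (le_trans (YB w))// (le_trans (ler_norm _))// lerDr.
  by rewrite (le_trans (XB w))// (le_trans (ler_norm _))// lerDl.
have clip_bd a : `|clip c a| <= c by rewrite norm_clip// ge_min lexx orbT.
apply: (@H_lip2 X Y (fun a b => clip c a * clip c b) c) => // a b a' b'.
rewrite (_ : _ - _ = clip c a * (clip c b - clip c b') + (clip c a - clip c a') * clip c b'); last by ring.
rewrite (le_trans (ler_normD _ _))// !normrM mulrDr addrC lerD//.
  by rewrite mulrC ler_pM// clip_lip.
by rewrite ler_pM// clip_lip.
Qed.

Lemma bounded_rvZ (c : R) X : bounded_rv X -> bounded_rv (fun w => c * X w).
Proof. by move=> bX; apply: bounded_rvM => //; exact: bounded_rv_cst. Qed.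

Lemma bounded_rvX X n : bounded_rv X -> bounded_rv (fun w => X w ^+ n).
Proof.
move=> bX; elim: n => [|n IH]; first exact: (bounded_rv_cst 1).
by under eq_fun do rewrite exprS; apply: bounded_rvM.
Qed.

Lemma bounded_rv_norm X : bounded_rv X -> bounded_rv (fun w => `|X w|).
Proof.
move=> [HX [B XB]]; split; first exact: H_norm.
by exists B => w; rewrite normr_id.
Qed.

Lemma bounded_rv_max X Y : bounded_rv X -> bounded_rv Y -> bounded_rv (fun w => Num.max (X w) (Y w)).
Proof.
move=> [HX [B XB]] [HY [B' YB]]; split; first exact: H_max.
exists (B + B') => w; have := XB w; have := YB w.
by have := normr_ge0 (X w); have := normr_ge0 (Y w); case: (leP (X w)) => _ *; lra.
Qed.

Lemma bounded_rv_lip X (phi : R -> R) : bounded_lip phi -> H X -> bounded_rv (fun w => phi (X w)).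
Proof.
move=> [B [K [B0 K0 phiB phiK]]] HX; split; last by exists B => w.
exact: (H_lip K0 phiK HX).
Qed.

Lemma bounded_rv_vec n (Z : 'I_n.+1 -> T -> R) (phi : 'rV[R]_n.+1 -> R) :
  (forall i, H (Z i)) -> bounded_lip phi -> bounded_rv (fun w => phi (rvec Z w)).
Proof.
move=> HZ bphi; split; first exact: H_vec.
by have [B [K [_ _ phiB _]]] := bphi; exists B => w.
Qed.

(** Sub-additivity is used twice, for the shift and for its inverse. This is
    what allows a step to be centred. *)
Lemma E_shift X (c : R) : bounded_rv X -> E (fun w => X w + c) = (E X + c%:E)%E.
Proof.
move=> bX; apply/eqP; rewrite eq_le; apply/andP; split.
  by rewrite -(sl_const hE c); apply: E_add => //; exact: H_cst.
rewrite -leeBrDr//.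
have -> : E X = E (fun w => (X w + c) + - c) by congr E; apply/funext => w; rewrite addrK.
rewrite -EFinN -(sl_const hE (- c)); apply: E_add; last exact: H_cst.
by apply: bounded_rvD => //; exact: bounded_rv_cst.
Qed.

End SublinearCalculus.

(** * Moments of reflected walks under negative dependence *)

Lemma young_powers (R : realType) k (L t : R) : 0 <= L -> 0 <= t ->
  L * t ^+ k.+1 <= t ^+ k.+2 + L ^+ k.+2 /\ L ^+ 2 * t ^+ k <= t ^+ k.+2 + L ^+ k.+2.
Proof.
move=> L0 t0; have pt : 0 <= t ^+ k.+2 by exact: exprn_ge0.
have pL : 0 <= L ^+ k.+2 by exact: exprn_ge0.
have [tL|/ltW Lt] := leP t L.
  split; apply: ler_wpDl => //.
    by rewrite [leRHS]exprS ler_wpM2l// lerXn2r.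
  by rewrite -[k.+2]add2n exprD ler_wpM2l ?exprn_ge0// lerXn2r.
split; apply: ler_wpDr => //.
  by rewrite [leRHS]exprS ler_wpM2r// exprn_ge0.
by rewrite -[k.+2]add2n exprD ler_wpM2r ?exprn_ge0// lerXn2r.
Qed.

Section WalkMoments.
Context {d : measure_display} {T : measurableType d} {R : realType}.
Context {H : set (T -> R)} {E : (T -> R) -> \bar R}.
Hypothesis hE : sublinear_space H E.
Variable Y : int -> T -> R.
Hypothesis hY : forall i, H (Y i).
Hypothesis hYnd : neg_dep_seq E Y.
Variables (m : int) (L c s : R).
Hypotheses (L0 : 0 < L) (c0 : 0 <= c) (s1 : s = 1 \/ s = -1).

Local Notation step j := (fun w => bclip L c (s * Y (m + j%:Z) w)).
Local Notation pos k := (fun w => walk (fun j => bclip L c (s * Y (m + j%:Z) w)) k).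

Local Notation brv := (bounded_rv (H := H)).

(** The walk as a function on row vectors, the form in which negative
    dependence takes the past. *)
Definition vwalk k (v : 'rV[R]_k.+1) (n : nat) : R :=
  walk (fun j => bclip L c (s * v ord0 (inord j))) n.

Lemma bounded_lip_vwalk k n : bounded_lip (fun v : 'rV[R]_k.+1 => vwalk v n).
Proof.
elim: n => [|n IH]; first exact: bounded_lip_cst.
rewrite /vwalk /=; apply: bounded_lip_max; first exact: bounded_lip_cst.
apply: bounded_lipD => //.
apply: (@bounded_lip_comp _ _ _ (fun v : 'rV[R]_k.+1 => v ord0 (inord n))
  (fun y => bclip L c (s * y)) 1); first by move=> x y; rewrite mul1r coord_lip.
exact/bounded_lip_bclip/c0/ltW.
Qed.

Lemma vwalk_rvec k w :
  vwalk (rvec (fun i : 'I_k.+1 => Y (m + i%:Z)) w) k.+1 = pos k.+1 w.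
Proof. by apply: walk_eq => i ik; rewrite mxE inordK. Qed.

Lemma bounded_rv_step j : brv (step j).
Proof.
exact: (bounded_rv_lip hE (bounded_lip_bclip s (ltW L0) c0) (hY _)).
Qed.

Lemma bounded_rv_pos n : brv (pos n).
Proof.
elim: n => [|n IH] /=; first exact: (bounded_rv_cst hE).
apply: (bounded_rv_max hE); first exact: (bounded_rv_cst hE).
apply: (bounded_rvD hE) => //; exact: bounded_rv_step.
Qed.

(** The only use of negative dependence. When s = -1 both factors are
    nonincreasing in the variables Y, the second case of its definition. For
    n = 0 the walk is at 0 and the first factor is a constant. *)
Lemma walk_step_uncorrelated (P Q : R -> R) n :
  (forall V : normedZmodType R, forall f : V -> R, bounded_lip f -> bounded_lip (fun v => P (f v))) ->
  (forall t, 0 <= t -> 0 <= P t) ->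
  (forall t u, 0 <= t -> t <= u -> P t <= P u) ->
  (forall f : R -> R, bounded_lip f -> bounded_lip (fun v => Q (f v))) ->
  (forall x y, - L <= x -> x <= y -> Q x <= Q y) ->
  E (fun w => Q (step n w)) = 0%E ->
  (E (fun w => (P (pos n w) * Q (step n w))%R) <= 0)%E.
Proof.
move=> Plip P0 Ph Qlip Qh EQ.
have bQ : bounded_lip (fun y : R => Q (bclip L c (s * y))).
  exact/Qlip/bounded_lip_bclip/c0/ltW.
have HQ j : brv (fun w => Q (step j w)) by exact: (bounded_rv_lip hE bQ (hY _)).
case: n EQ => [|k] EQ.
  by rewrite /= (sl_homo hE) ?EQ ?mule0// ?P0//; exact: bounded_rv_H.
pose psi1 (v : 'rV[R]_k.+1) := P (vwalk v k.+1).
pose psi2 (v : 'rV[R]_1) := Q (bclip L c (s * v ord0 ord0)).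
have b1 : bounded_lip psi1 by exact/Plip/bounded_lip_vwalk.
have b2 : bounded_lip psi2.
  apply: (@bounded_lip_comp _ _ _ (fun v : 'rV[R]_1 => v ord0 ord0) _ 1 _ bQ).
  by move=> x y; rewrite mul1r coord_lip.
have e1 w : psi1 (rvec (fun i : 'I_k.+1 => Y (m + i%:Z)) w) = P (pos k.+1 w).
  by rewrite /psi1 vwalk_rvec.
have e2 w : psi2 (rvec (fun _ : 'I_1 => Y (m + k%:Z + 1)) w) = Q (step k.+1 w).
  by rewrite /psi2 mxE -addn1 PoszD addrA.
have br1 : brv (fun w => P (pos k.+1 w)).
  by under eq_fun do rewrite -e1; apply: (bounded_rv_vec hE).
have bQn := HQ k.+1.
pose X1 (i : 'I_k.+1) := Y (m + i%:Z); pose X2 (_ : 'I_1) := Y (m + k%:Z + 1).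
have F1 : (fun w => psi1 (rvec X1 w)) = (fun w => P (pos k.+1 w)) by exact/funext/e1.
have F2 : (fun w => psi2 (rvec X2 w)) = (fun w => Q (step k.+1 w)) by exact/funext/e2.
have F12 : (fun w => psi1 (rvec X1 w) * psi2 (rvec X2 w)) =
  (fun w => P (pos k.+1 w) * Q (step k.+1 w)) by apply/funext => w; rewrite e1 e2.
have G1 : (fun w => `|psi1 (rvec X1 w)|) = (fun w => `|P (pos k.+1 w)|).
  by apply/funext => w; rewrite e1.
have G2 : (fun w => `|psi2 (rvec X2 w)|) = (fun w => `|Q (step k.+1 w)|).
  by apply/funext => w; rewrite e2.
have := @hYnd m k _ _ (bounded_lip_Cl_lip b1) (bounded_lip_Cl_lip b2).
rewrite -/X1 -/X2 F1 F2 F12 G1 G2 EQ mule0; apply => //.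
- have x0 : - L <= 0 by rewrite oppr_le0 ltW.
  case: s1 => es; [left|right]; split => v v' vv'.
  + apply: Ph; first exact: walk_ge0.
    by apply: walk_homo => i _; apply: bclip_homo; rewrite es !mul1r.
  + by apply: Qh; [exact: bclip_ge | apply: bclip_homo; rewrite es !mul1r].
  + apply: Ph; first exact: walk_ge0.
    by apply: walk_homo => i _; apply: bclip_homo; rewrite es !mulN1r lerN2.
  + by apply: Qh; [exact: bclip_ge | apply: bclip_homo; rewrite es !mulN1r lerN2].
- by move=> w; rewrite e1; apply/P0/walk_ge0.
- exact: (E_lty hE (bounded_rvM hE br1 bQn)).
- exact: (E_lty hE (bounded_rv_norm hE br1)).
- exact: (E_lty hE (bounded_rv_norm hE bQn)).
Qed.

Lemma bounded_lip_slope (V : normedZmodType R) (f : V -> R) k (D : R) :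
  bounded_lip f -> bounded_lip (fun v => slope k D (f v)).
Proof.
move=> bf; rewrite /slope; have cst := @bounded_lip_cst R V.
apply/bounded_lipM/bounded_lipD => //.
  apply: bounded_lipM; first exact: bounded_lipX.
  by apply: bounded_lip_max => //; apply: bounded_lipD.
by apply: bounded_lipX; apply: bounded_lip_min.
Qed.

Lemma bounded_lip_curvature (V : normedZmodType R) (f : V -> R) k (D : R) :
  bounded_lip f -> bounded_lip (fun v => curvature k D (f v)).
Proof.
move=> bf; rewrite /curvature; apply: bounded_lipD; first exact: bounded_lipX.
apply/bounded_lipN/bounded_lipX/bounded_lip_min => //; exact: bounded_lip_cst.
Qed.

(** After centring the step and its completed square, the two monotone products
    have nonpositive expectation ([walk_step_uncorrelated]). The centring terms
    are mixed powers of the position and L, separated by [young_powers], so that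
    the whole increment is of order 1/N. *)
Lemma walk_moment_step k (cc C0 : R) n N : (0 < N)%N -> 0 <= cc -> 0 <= C0 ->
  (forall L t x, 0 <= L -> 0 <= t ->
    let D := cc * 2 / k.+2%:R * L in
    Num.max 0 (t + x) ^+ k.+2 <= t ^+ k.+2 + slope k D t * x
      + curvature k D t * (cc * ((x + L) ^+ 2 - L ^+ 2))
      + C0 * (L ^+ k * x ^+ 2 + `|x| ^+ k.+2)) ->
  (E (step n) <= (2 * L / N%:R)%:E)%E ->
  (E (fun w => step n w ^+ 2)%R <= (L ^+ 2 / N%:R)%:E)%E ->
  (E (fun w => `|step n w| ^+ k.+2)%R <= (L ^+ k.+2 / N%:R)%:E)%E ->
  forall A, A = 2 * k.+2%:R + 5 * cc + 2 * C0 ->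
  (E (fun w => pos n.+1 w ^+ k.+2)%R <=
   E (fun w => pos n w ^+ k.+2)%R + (A / N%:R)%:E * (E (fun w => pos n w ^+ k.+2)%R + (L ^+ k.+2)%:E))%E.
Proof.
move=> N0 cc0 C00 ineq m1 m2 mq A EA.
have L0' := ltW L0.
have iN0 : 0 <= N%:R^-1 :> R by rewrite invr_ge0.
set D := cc * 2 / k.+2%:R * L.
have D0 : 0 <= D by rewrite /D !mulr_ge0.
have bs := bounded_rv_step n; have bp := bounded_rv_pos n.
have bcst c' := bounded_rv_cst hE c'.
pose Q2 (x : R) := cc * ((x + L) ^+ 2 - L ^+ 2).
have bQ2 : brv (fun w => Q2 (step n w)).
  apply: (bounded_rvZ hE); apply: (bounded_rvD hE) => //.
  exact/(bounded_rvX hE)/(bounded_rvD hE).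
have [e1 Ee1] : exists e1 : R, E (step n) = e1%:E.
  by exists (fine (E (step n))); rewrite fineK// (E_fin_num hE bs).
have [e2 Ee2] : exists e2 : R, E (fun w => Q2 (step n w)) = e2%:E.
  by exists (fine (E (fun w => Q2 (step n w)))); rewrite fineK// (E_fin_num hE bQ2).
have e1le : e1 <= 2 * L / N%:R by rewrite -lee_fin -Ee1.
have e2le : e2 <= 5 * cc * (L ^+ 2 / N%:R).
  rewrite -lee_fin -Ee2.
  have -> : (fun w => Q2 (step n w)) = (fun w => cc * (step n w ^+ 2 + 2 * L * step n w)).
    by apply/funext => w; rewrite /Q2; ring.
  have b2 := bounded_rvX hE 2 bs; have b1 := bounded_rvZ hE (2 * L) bs.
  rewrite (sl_homo hE cc0); last exact: (bounded_rv_H (bounded_rvD hE b2 b1)).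
  rewrite (_ : 5 * cc * _ = cc * (5 * (L ^+ 2 / N%:R))); last by ring.
  rewrite EFinM; apply: lee_wpmul2l; first by rewrite lee_fin.
  apply: (le_trans (E_add hE b2 (bounded_rv_H b1))).
  rewrite (sl_homo hE); [|by rewrite mulr_ge0|exact: bounded_rv_H].
  rewrite (_ : 5 * _ = L ^+ 2 / N%:R + 2 * L * (2 * L / N%:R)); last by ring.
  rewrite EFinD (EFinM (2 * L)); apply: leeD => //.
  by apply: lee_wpmul2l => //; rewrite lee_fin mulr_ge0.
have b1 : brv (fun w => slope k D (pos n w) * (step n w - e1)).
  apply: (bounded_rvM hE); last by apply: (bounded_rvD hE).
  rewrite /slope; apply: (bounded_rvZ hE); apply: (bounded_rvD hE).
    apply: (bounded_rvM hE); first exact: (bounded_rvX hE).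
    by apply: (bounded_rv_max hE) => //; apply: (bounded_rvD hE).
  apply: (bounded_rvX hE); under eq_fun do rewrite -[Num.min _ _]opprK oppr_min -mulN1r.
  apply: (bounded_rvZ hE); apply: (bounded_rv_max hE) => //.
  by under eq_fun do rewrite -mulN1r; apply: (bounded_rvZ hE).
have b2 : brv (fun w => curvature k D (pos n w) * (Q2 (step n w) - e2)).
  apply: (bounded_rvM hE); last by apply: (bounded_rvD hE).
  rewrite /curvature; apply: (bounded_rvD hE); first exact: (bounded_rvX hE).
  under eq_fun do rewrite -mulN1r; apply: (bounded_rvZ hE).
  apply: (bounded_rvX hE); under eq_fun do rewrite -[Num.min _ _]opprK oppr_min -mulN1r.
  apply: (bounded_rvZ hE); apply: (bounded_rv_max hE) => //.
  by under eq_fun do rewrite -mulN1r; apply: (bounded_rvZ hE).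
have u1 : (E (fun w => (slope k D (pos n w) * (step n w - e1))%R) <= 0)%E.
  apply: (walk_step_uncorrelated (P := slope k D) (Q := fun x => x - e1)) => //.
  - by move=> V f; exact: bounded_lip_slope.
  - by move=> t; apply: slope_ge0.
  - by move=> t u; apply: slope_homo.
  - by move=> f bf; apply: bounded_lipD => //; exact: bounded_lip_cst.
  - by move=> x y _ xy; rewrite lerB.
  - by rewrite (E_shift hE)// Ee1 -EFinD subrr.
have u2 : (E (fun w => (curvature k D (pos n w) * (Q2 (step n w) - e2))%R) <= 0)%E.
  apply: (walk_step_uncorrelated (P := curvature k D) (Q := fun x => Q2 x - e2)) => //.
  - by move=> V f; exact: bounded_lip_curvature.
  - by move=> t; apply: curvature_ge0.
  - by move=> t u; apply: curvature_homo.
  - move=> f bf; have cst := @bounded_lip_cst R R; rewrite /Q2; apply: bounded_lipD => //.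
    apply: bounded_lipM => //; apply: bounded_lipD => //; apply: bounded_lipX.
    exact: bounded_lipD.
  - move=> x y Lx xy; rewrite /Q2 lerB// ler_wpM2l// lerB// lerXn2r// ?nnegrE; lra.
  - by rewrite (E_shift hE)// Ee2 -EFinD subrr.
pose A1 := 2 * k.+2%:R + 5 * cc.
have A10 : 0 <= A1 by rewrite addr_ge0 ?mulr_ge0.
have bpq := bounded_rvX hE k.+2 bp.
have b3 := bounded_rvZ hE (A1 / N%:R) (bounded_rvD hE bpq (bcst (L ^+ k.+2))).
have b4 : brv (fun w => C0 * (L ^+ k * step n w ^+ 2 + `|step n w| ^+ k.+2)).
  apply: (bounded_rvZ hE); apply: (bounded_rvD hE).
    exact/(bounded_rvZ hE)/(bounded_rvX hE).
  exact/(bounded_rvX hE)/(bounded_rv_norm hE).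
apply: (@le_trans _ _ (E (fun w => pos n w ^+ k.+2
   + (slope k D (pos n w) * (step n w - e1)
   + (curvature k D (pos n w) * (Q2 (step n w) - e2)
   + (A1 / N%:R * (pos n w ^+ k.+2 + L ^+ k.+2)
   + C0 * (L ^+ k * step n w ^+ 2 + `|step n w| ^+ k.+2)))))%R)).
  apply: (sl_mono hE); first by do ! apply: (H_add hE); apply: bounded_rv_H.
    exact: (bounded_rv_H (bounded_rvX hE _ (bounded_rv_pos n.+1))).
  move=> w /=; have p0 : 0 <= pos n w by exact: walk_ge0.
  apply: (le_trans (ineq L _ (step n w) L0' p0)); rewrite -/D -/(Q2 (step n w)).
  have [y1 y2] := young_powers k L0' p0.
  have s0 := slope_ge0 k D0 p0; have sle := slope_le k D0 p0.
  have v0 := curvature_ge0 k D0 p0; have vle := curvature_le k D0 p0.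
  move: (pos n w) (step n w) p0 s0 sle v0 vle y1 y2 => t x p0 s0 sle v0 vle y1 y2.
  set S := t ^+ k.+2 + L ^+ k.+2 in y1 y2 *.
  have h1 : slope k D t * e1 <= 2 * k.+2%:R * (S / N%:R).
    apply: (@le_trans _ _ (k.+2%:R * t ^+ k.+1 * (2 * L / N%:R))).
      apply: (@le_trans _ _ (slope k D t * (2 * L / N%:R))); first by rewrite ler_wpM2l.
      by rewrite ler_wpM2r// !mulr_ge0.
    rewrite (_ : _ * _ = 2 * k.+2%:R * (L * t ^+ k.+1 / N%:R)); last by ring.
    by rewrite ler_wpM2l// ler_wpM2r.
  have h2 : curvature k D t * e2 <= 5 * cc * (S / N%:R).
    apply: (@le_trans _ _ (t ^+ k * (5 * cc * (L ^+ 2 / N%:R)))).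
      apply: (@le_trans _ _ (curvature k D t * (5 * cc * (L ^+ 2 / N%:R)))); first by rewrite ler_wpM2l.
      by rewrite ler_wpM2r// !mulr_ge0// sqr_ge0.
    rewrite (_ : _ * _ = 5 * cc * (L ^+ 2 * t ^+ k / N%:R)); last by ring.
    by rewrite ler_wpM2l ?mulr_ge0// ler_wpM2r.
  rewrite (_ : A1 / N%:R * S = 2 * k.+2%:R * (S / N%:R) + 5 * cc * (S / N%:R)); last first.
    by rewrite /A1; ring.
  by rewrite !mulrBr; lra.
have H4 := bounded_rv_H b4.
have H3 := H_add hE (bounded_rv_H b3) H4.
have H2 := H_add hE (bounded_rv_H b2) H3.
have H1 := H_add hE (bounded_rv_H b1) H2.
apply: (le_trans (E_add hE bpq H1)); rewrite leeD2l//.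
apply: (le_trans (E_add hE b1 H2)).
apply: (@le_trans _ _ (0 + (0 + (E (fun w => A1 / N%:R * (pos n w ^+ k.+2 + L ^+ k.+2))%R +
   E (fun w => C0 * (L ^+ k * step n w ^+ 2 + `|step n w| ^+ k.+2))%R)))%E).
  apply: leeD => //; apply: (le_trans (E_add hE b2 H3)); apply: leeD => //.
  exact: (E_add hE b3 H4).
rewrite !add0e (sl_homo hE); [|by rewrite mulr_ge0|]; last first.
  exact: (bounded_rv_H (bounded_rvD hE bpq (bcst _))).
rewrite (E_shift hE)//.
have [e Ee] : exists e : R, E (fun w => pos n w ^+ k.+2) = e%:E.
  by exists (fine (E (fun w => pos n w ^+ k.+2))); rewrite fineK// (E_fin_num hE bpq).
have e0 : 0 <= e.
  rewrite -lee_fin -Ee; apply: (E_ge0 hE); first exact: bounded_rv_H.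
  by move=> w; apply/exprn_ge0/walk_ge0.
have q4 : (E (fun w => (C0 * (L ^+ k * step n w ^+ 2 + `|step n w| ^+ k.+2))%R)
   <= (C0 * (2 * (L ^+ k.+2 / N%:R)))%:E)%E.
  have b5 := bounded_rvX hE 2 bs; have b6 := bounded_rvX hE k.+2 (bounded_rv_norm hE bs).
  have b7 := bounded_rvZ hE (L ^+ k) b5.
  rewrite (sl_homo hE) //; last exact: (bounded_rv_H (bounded_rvD hE b7 b6)).
  rewrite EFinM; apply: lee_wpmul2l; first by rewrite lee_fin.
  apply: (le_trans (E_add hE b7 (bounded_rv_H b6))).
  rewrite (sl_homo hE) ?exprn_ge0//; last exact: bounded_rv_H.
  rewrite (_ : 2 * _ = L ^+ k * (L ^+ 2 / N%:R) + L ^+ k.+2 / N%:R); last by rewrite !exprS; ring.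
  rewrite EFinD (EFinM (L ^+ k)); apply: leeD => //.
  by apply: lee_wpmul2l => //; rewrite lee_fin exprn_ge0.
rewrite Ee; apply: (le_trans (leeD (lexx _) q4)); rewrite -(EFinD e) -!EFinM -EFinD lee_fin.
have pL : 0 <= L ^+ k.+2 / N%:R by rewrite mulr_ge0// exprn_ge0.
have peN : 0 <= C0 * (e / N%:R) by rewrite !mulr_ge0.
rewrite EA -/A1; set q := L ^+ k.+2 in pL *.
rewrite (_ : (A1 + 2 * C0) / N%:R * (e + q) = A1 / N%:R * (e + q) + C0 * (2 * (q / N%:R)) + 2 * (C0 * (e / N%:R))); last by ring.
by rewrite lerDl mulr_ge0.
Qed.

End WalkMoments.

(** Rosenthal's inequality in normalized form: L is a scale on which the first,
    second and q-th moments of N steps add up to at most a constant, with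
    q = k+2. The recursion of [walk_moment_step] multiplies by 1 + A/N at each of
    the N steps. *)
Lemma walk_moment (R : realType) k : ~~ odd k -> exists2 C : R, 0 <= C &
  forall (d : measure_display) (T : measurableType d) (H : set (T -> R))
    (E : (T -> R) -> \bar R) (Y : int -> T -> R) (m : int) (L c s : R) (N : nat),
  sublinear_space H E -> (forall i, H (Y i)) -> neg_dep_seq E Y ->
  0 < L -> 0 <= c -> s = 1 \/ s = -1 -> (0 < N)%N ->
  (forall j : nat, (E (fun w => bclip L c (s * Y (m + j%:Z) w))%R <= (2 * L / N%:R)%:E)%E) ->
  (forall j : nat, (E (fun w => bclip L c (s * Y (m + j%:Z) w) ^+ 2)%R <= (L ^+ 2 / N%:R)%:E)%E) ->
  (forall j : nat, (E (fun w => `|bclip L c (s * Y (m + j%:Z) w)| ^+ k.+2)%R <= (L ^+ k.+2 / N%:R)%:E)%E) ->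
  (E (fun w => walk (fun j => bclip L c (s * Y (m + j%:Z) w)) N ^+ k.+2)%R <= (C * L ^+ k.+2)%:E)%E.
Proof.
move=> ek; have [cc [C0 [cc0 C00 ineq]]] := @reflected_step R k ek.
pose A := 2 * k.+2%:R + 5 * cc + 2 * C0.
have A0 : 0 <= A by rewrite /A !addr_ge0 ?mulr_ge0.
exists (expR A); first exact: expR_ge0.
move=> d T H E Y m L c s N hE hY hYnd L0 c0 s1 N0 m1 m2 mq.
set l := L ^+ k.+2; have l0 : 0 <= l by rewrite exprn_ge0// ltW.
pose X n w := walk (fun j => bclip L c (s * Y (m + j%:Z) w)) n.
have bX n : bounded_rv (H := H) (fun w => X n w ^+ k.+2).
  exact: (bounded_rvX hE _ (bounded_rv_pos hE hY m s L0 c0 n)).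
pose a n := fine (E (fun w => X n w ^+ k.+2)).
have Ea n : E (fun w => X n w ^+ k.+2) = (a n)%:E by rewrite fineK// (E_fin_num hE (bX n)).
have step n : a n.+1 + l <= (1 + A / N%:R) * (a n + l).
  have := walk_moment_step hE hY hYnd L0 c0 s1 N0 cc0 C00 ineq (m1 n) (m2 n) (mq n) erefl.
  rewrite (Ea n.+1) (Ea n) -(EFinD (a n) (L ^+ k.+2)) -EFinM -EFinD lee_fin -/A -/l.
  have -> : (1 + A / N%:R) * (a n + l) = a n + l + A / N%:R * (a n + l) by ring.
  lra.
have AN : 0 <= 1 + A / N%:R by rewrite addr_ge0// mulr_ge0// invr_ge0.
have bound n : a n + l <= (1 + A / N%:R) ^+ n * l.
  elim: n => [|n IH].
    rewrite mul1r -lee_fin EFinD -Ea /X /=.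
    by rewrite expr0n /= (sl_const hE) add0e.
  by rewrite (le_trans (step n))// exprS -mulrA ler_wpM2l.
rewrite (Ea N) lee_fin.
have : (1 + A / N%:R) ^+ N <= expR A.
  rewrite [leRHS](_ : _ = expR (A / N%:R) ^+ N); last first.
    by rewrite -expRM_natl; congr expR; field; rewrite pnatr_eq0 -lt0n.
  by rewrite lerXn2r ?nnegrE ?expR_ge0// expR_ge1Dx.
move=> h; have := bound N; have : (1 + A / N%:R) ^+ N * l <= expR A * l by rewrite ler_wpM2r.
lra.
Qed.

(** * Capacity and expectations by layers *)

Lemma series_ge_term (R : realType) (u : nat -> \bar R) n :
  (forall k, 0 <= u k)%E -> (u n <= \sum_(0 <= k <oo) u k)%E.
Proof.
move=> u0; apply: (@le_trans _ _ (\sum_(0 <= k < n.+1) u k)%E).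
  by rewrite big_nat_recr//= leeDr// sume_ge0.
by apply: nneseries_lim_ge => k _ _.
Qed.

Section Capacity.
Context {d : measure_display} {T : measurableType d} {R : realType}.
Context {H : set (T -> R)} {E : (T -> R) -> \bar R}.
Hypothesis hE : sublinear_space H E.
Implicit Types (A B : set T) (X : T -> R).

Lemma capacity_le A X : H X -> (forall w, \1_A w <= X w) -> (capacity H E A <= E X)%E.
Proof. by move=> HX AX; apply: ereal_inf_lbound; exists X. Qed.

Lemma E_le_capacity A X : H X -> (forall w, X w <= \1_A w) -> (E X <= capacity H E A)%E.
Proof.
move=> HX XA; apply: le_ereal_inf_tmp => _ [xi [Hxi Axi] <-].
by apply: (sl_mono hE) => // w; apply: (le_trans (XA w)).
Qed.

Lemma capacity_ge0 A : (0 <= capacity H E A)%E.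
Proof.
apply: le_ereal_inf_tmp => _ [xi [Hxi Axi] <-]; apply: (E_ge0 hE) => // w.
by apply: le_trans (Axi w); rewrite indicE ler0n.
Qed.

Lemma capacity_le1 A : (capacity H E A <= 1)%E.
Proof.
apply: (@le_trans _ _ (E (fun=> 1))); last by rewrite (sl_const hE).
apply: capacity_le; first exact: (H_cst hE).
by move=> w; rewrite indicE lern1 leq_b1.
Qed.

Lemma capacity_homo A B : A `<=` B -> (capacity H E A <= capacity H E B)%E.
Proof.
move=> AB; apply: le_ereal_inf_tmp => _ [xi [Hxi Bxi] <-]; apply: capacity_le => // w.
apply: le_trans (Bxi w); rewrite !indicE ler_nat.
case: (boolP (w \in A)) => // /set_mem /AB wB.
by rewrite mem_set.
Qed.

Lemma capacityT : capacity H E setT = 1%E.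
Proof.
apply/eqP; rewrite eq_le capacity_le1/=.
apply: le_ereal_inf_tmp => _ [xi [Hxi Axi] <-].
rewrite -[1%E](sl_const hE 1); apply: (sl_mono hE) => //; first exact: (H_cst hE).
by move=> w; apply: le_trans (Axi w); rewrite indicE in_setT.
Qed.

End Capacity.

Section Layers.
Variable R : realType.

(** Lipschitz cut-off that increases from 0 at a to 1 at 2a. *)
Definition ramp (a x : R) : R := Num.min 1 (Num.max 0 (x / a - 1)).

Lemma ramp_ge0 a x : 0 <= ramp a x.
Proof. by rewrite /ramp le_min ler01 le_max lexx. Qed.

Lemma ramp_le1 a x : ramp a x <= 1.
Proof. by rewrite /ramp ge_min lexx. Qed.

Lemma ramp_eq1 a x : 0 < a -> 2 * a <= x -> ramp a x = 1.
Proof.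
move=> a0 ax; apply/min_idPl; rewrite le_max; apply/orP; right.
by rewrite lerBrDr ler_pdivlMr.
Qed.

Lemma ramp_eq0 a x : 0 < a -> x <= a -> ramp a x = 0.
Proof.
move=> a0 xa; rewrite /ramp (_ : Num.max _ _ = 0) ?(elimT min_idPr)//.
by apply/max_idPl; rewrite subr_le0 ler_pdivrMr// mul1r.
Qed.

Lemma bounded_lip_ramp a : 0 < a -> bounded_lip (fun x : R => ramp a `|x|).
Proof.
move=> a0; exists 1, a^-1; split; rewrite ?invr_ge0 ?ltW//.
  by move=> x; rewrite ger0_norm ?ramp_ge0// ramp_le1.
move=> x y; rewrite (le_trans (min_const_lip _ _ _))// (le_trans (max_const_lip _ _ _))//.
rewrite opprB addrA subrK -mulrBl normrM mulrC (ger0_norm (x := a^-1)) ?invr_ge0 ?(ltW a0)//.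
by rewrite ler_wpM2l ?invr_ge0 ?(ltW a0)// ler_dist_dist.
Qed.

Context {d : measure_display} {T : measurableType d}.
Context {H : set (T -> R)} {E : (T -> R) -> \bar R}.
Hypothesis hE : sublinear_space H E.
Hypothesis hEc : countably_subadditive H E.
Variables (Y0 : T -> R) (z : nat -> R).
Hypotheses (hY0 : H Y0) (z0 : forall j, 0 < z j) (zoo : forall x, exists j, x <= 2 * z j).

(** The index is shifted by one: layer n consists of the points with
    2 z_(n-1) < |Y0| <= 2 z_n. The cut-off at z_(n-1) is 1 there, which explains
    the factor 2 in [layer_sum]. *)
Definition layer_weight (n : nat) : \bar R :=
  if n is j.+1 then capacity H E [set w | z j < `|Y0 w|] else 1%E.

Lemma layer_weight_ge0 n : (0 <= layer_weight n)%E.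
Proof. by case: n => [|n] /=; [exact: lee01 | exact: (capacity_ge0 hE)]. Qed.

Definition layer_sum (Phi : R -> R) : \bar R :=
  (\sum_(0 <= n <oo) (Phi (2 * z n)%R)%:E * layer_weight n)%E.

(** Each point belongs to the first layer n with |Z| <= 2 z_n, where Phi is at
    most Phi (2 z_n); countable sub-additivity sums over the layers. Only the
    cut-offs are transferred from Z to Y0, because equality in distribution says
    nothing about expectations that may be infinite. *)
Lemma E_le_layer_sum (Z : T -> R) (Phi : R -> R) :
  H Z -> ident_distr E Z Y0 ->
  (forall x, 0 <= x -> 0 <= Phi x) -> (forall x y, 0 <= x -> x <= y -> Phi x <= Phi y) ->
  H (fun w => Phi `|Z w|) -> (E (fun w => Phi `|Z w|%R) <= layer_sum Phi)%E.
Proof.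
move=> HZ ZY Phi0 Phih HP.
have P2z n : 0 <= Phi (2 * z n) by rewrite Phi0// mulr_ge0// ltW.
pose Xs n w := if n is j.+1 then Phi (2 * z n) * ramp (z j) `|Z w| else Phi (2 * z n).
have Hr X j : H X -> bounded_rv (H := H) (fun w => ramp (z j) `|X w|).
  by move=> HX; exact: (bounded_rv_lip hE (bounded_lip_ramp (z0 j)) HX).
have HXs n : H (Xs n).
  case: n => [|j]; first exact: (H_cst hE).
  exact/(H_scale hE)/(bounded_rv_H (Hr Z j HZ)).
have Xs0 n w : 0 <= Xs n w.
  by case: n => [|j] //=; rewrite mulr_ge0// ramp_ge0.
apply: (le_trans (hEc HP HXs _ Xs0 _)).
- by move=> w; apply: Phi0.
- move=> w; have [j ltj] := zoo `|Z w|.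
  have ex : exists j, `|Z w| <= 2 * z j by exists j.
  have hn := ex_minnP ex; case: hn => n Zn nmin.
  apply: (@le_trans _ _ (Xs n w)%:E); last first.
    by apply: (series_ge_term (u := fun n => (Xs n w)%:E)) => k; rewrite lee_fin.
  rewrite lee_fin /Xs; case: n Zn nmin => [|n] Zn nmin; first exact: Phih.
  rewrite ramp_eq1 ?mulr1 ?Phih// leNgt; apply/negP => /ltW /nmin.
  by rewrite ltnn.
- apply: lee_nneseries => [n _ _|[|j] _]; first exact: (E_ge0 hE).
    by rewrite /Xs (sl_const hE) /= mule1.
  rewrite /Xs (sl_homo hE) //; last exact: (bounded_rv_H (Hr Z j HZ)).
  apply: lee_wpmul2l; first by rewrite lee_fin.
  rewrite (ZY (fun x => ramp (z j) `|x|)).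
  + apply: (E_le_capacity hE); first exact: (bounded_rv_H (Hr Y0 j hY0)).
    move=> w; rewrite indicE; have [/= zY|Yz] := boolP (w \in _).
      exact: ramp_le1.
    rewrite ramp_eq0// leNgt; apply/negP => h; move/negP: Yz; apply.
    exact/mem_set.
  + exact/bounded_lip_Cl_lip/bounded_lip_ramp.
  + exact: (E_fin_num hE (Hr Z j HZ)).
  + exact: (E_fin_num hE (Hr Y0 j hY0)).
Qed.

End Layers.

(** * Windows of consecutive variables *)

Section Windows.
Context {d : measure_display} {T : measurableType d} {R : realType}.
Context {H : set (T -> R)} {E : (T -> R) -> \bar R}.
Hypothesis hE : sublinear_space H E.
Variables (Y : int -> T -> R) (Y0 : T -> R).
Hypotheses (hY : forall i, H (Y i)) (hY0 : H Y0).
Hypothesis hYid : forall i, ident_distr E (Y i) Y0.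
Hypotheses (hmean : E Y0 = 0%E) (hmeanN : E (fun w => - Y0 w) = 0%E).

Definition excess (s y : R) : R := Num.max (`|y| - s) 0.

Lemma excess_ge0 s y : 0 <= excess s y.
Proof. by rewrite /excess le_max lexx orbT. Qed.

Lemma H_excess s (Z : T -> R) : H Z -> H (fun w => excess s (Z w)).
Proof.
move=> HZ; apply: (H_max hE); last exact: (H_cst hE).
by apply: (H_add hE); [exact: (H_norm hE) | exact: (H_cst hE)].
Qed.

Definition window_walk (L s sg : R) (m : int) (n : nat) (w : T) : R :=
  walk (fun j => bclip L s (sg * Y (m + j%:Z) w)) n.

Definition window_excess (s : R) (m : int) (n : nat) (w : T) : R :=
  \sum_(0 <= j < n) excess s (Y (m + j%:Z) w).

(** Truncation at s splits every variable into a clipped part, handled by the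
    walks, and an excess, whose sum is bounded term by term. *)
Lemma window_sum_le L s m n k w : 0 <= s -> (k <= n)%N ->
  `|\sum_(0 <= j < k) Y (m + j%:Z) w| <=
  window_walk L s 1 m n w + window_walk L s (-1) m n w + window_excess s m n w.
Proof.
move=> s0 kn.
have -> : \sum_(0 <= j < k) Y (m + j%:Z) w =
  \sum_(0 <= j < k) clip s (Y (m + j%:Z) w)
  + \sum_(0 <= j < k) (Y (m + j%:Z) w - clip s (Y (m + j%:Z) w)).
  by rewrite -big_split/=; apply: eq_bigr => j _; rewrite addrC subrK.
apply: (le_trans (ler_normD _ _)); apply: lerD.
  apply: (le_trans (abs_partial_sum_le_walks _ kn)); apply: lerD.
    by apply: walk_homo => i _; rewrite mul1r clip_le_bclip.
  by apply: walk_homo => i _; rewrite -clipN// mulN1r clip_le_bclip.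
apply: (le_trans (ler_norm_sum _ _ _)).
rewrite /window_excess (big_cat_nat (leq0n k) kn)/= -[leLHS]addr0 lerD//.
  by apply: ler_sum => j _; rewrite clip_dist.
by apply: sumr_ge0 => j _; exact: excess_ge0.
Qed.

Lemma E_sum_le n (X : nat -> T -> R) (b : R) :
  (forall j, H (X j)) -> (forall j w, 0 <= X j w) ->
  (forall j, (E (X j) <= b%:E)%E) ->
  (E (fun w => (\sum_(0 <= j < n) X j w)%R) <= (n%:R * b)%:E)%E.
Proof.
move=> HX X0 Xb; elim: n => [|n IH].
  by under eq_fun do rewrite big_nil; rewrite (sl_const hE) mul0r.
under eq_fun do rewrite big_nat_recr//=.
have Hs := H_sum hE n HX.
apply: (@le_trans _ _ (E (fun w => (\sum_(0 <= j < n) X j w)%R) + E (X n))%E).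
  apply: (sl_subadd hE) => //; apply: ge0_adde_def; rewrite inE; apply: (E_ge0 hE) => //.
  by move=> w; apply: sumr_ge0.
by rewrite -natr1 mulrDl mul1r EFinD leeD.
Qed.

(** Here s is the truncation level, s * lam the scale L of Rosenthal's
    inequality, q = k+2; be bounds the normalized excess and q-th moment, and ga
    the normalized second moment of the whole window. *)
Section Moments.
Variables (s lam be ga : R) (n k : nat).
Hypotheses (s0 : 0 < s) (lam0 : 0 < lam) (n0 : (0 < n)%N).
Hypothesis excess_le : forall i, (E (fun w => excess s (Y i w)) <= (s * be)%:E)%E.
Hypothesis excess0_le : (E (fun w => excess s (Y0 w)) <= (s * be)%:E)%E.
Hypothesis power_le : forall i, (E (fun w => (Num.min `|Y i w| s ^+ k.+2)%R) <= (s ^+ k.+2 * be)%:E)%E.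
Hypothesis square_le : forall i, (E (fun w => (Num.min `|Y i w| s ^+ 2)%R) <= (s ^+ 2 * ga / n%:R)%:E)%E.
Hypotheses (be_lam : n%:R * be <= lam) (be_lamq : n%:R * be <= lam ^+ k.+2).
Hypothesis ga_lam : ga <= lam ^+ 2.

Let L := s * lam.
Let L0 : 0 < L. Proof. by rewrite mulr_gt0. Qed.
Let nR : 0 < n%:R :> R. Proof. by rewrite ltr0n. Qed.

Lemma window_excess_E m : (E (window_excess s m n) <= (n%:R * (s * be))%:E)%E.
Proof.
by apply: E_sum_le => // [j|j w]; [exact: H_excess | exact: excess_ge0].
Qed.

Lemma bounded_rv_clip (sg : R) Z : H Z -> bounded_rv (H := H) (fun w => clip s (sg * Z w)).
Proof.
apply: (bounded_rv_lip hE (phi := fun y => clip s (sg * y))).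
exists s, `|sg|; split => //; first exact: ltW.
  by move=> x; rewrite (norm_clip _ (ltW s0)) ge_min lexx orbT.
by move=> x y; rewrite (le_trans (clip_lip _ _ _))// -mulrBr normrM.
Qed.

(** The mean is zero, so the clipped variable has mean at most that of the
    excess. The comparison is made for Y0 and transferred through the clipped
    variable, which is bounded. *)
Lemma E_clip_le sg i : sg = 1 \/ sg = -1 -> (E (fun w => clip s (sg * Y i w)) <= (s * be)%:E)%E.
Proof.
move=> sg1; have bl : bounded_lip (fun y : R => clip s (sg * y)).
  exists s, `|sg|; split => //; first exact: ltW.
    by move=> x; rewrite (norm_clip _ (ltW s0)) ge_min lexx orbT.
  by move=> x y; rewrite (le_trans (clip_lip _ _ _))// -mulrBr normrM.
rewrite (hYid (i := i) (bounded_lip_Cl_lip bl)); first last.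
- exact: (E_fin_num hE (bounded_rv_clip _ hY0)).
- exact: (E_fin_num hE (bounded_rv_clip _ (hY i))).
have Hsg := H_scale hE sg hY0.
have He := H_excess s hY0.
have Esg : E (fun w => sg * Y0 w) = 0%E.
  by case: sg1 => ->; [under eq_fun do rewrite mul1r | under eq_fun do rewrite mulN1r].
apply: (@le_trans _ _ (E (fun w => (sg * Y0 w + excess s (Y0 w))%R))).
  apply: (sl_mono hE); [exact: (H_add hE) | exact/bounded_rv_H/bounded_rv_clip |].
  move=> w; have : excess s (sg * Y0 w) = excess s (Y0 w).
    by rewrite /excess; case: sg1 => ->; rewrite ?mul1r ?mulN1r ?normrN.
  move=> <-; rewrite /excess -(clip_dist _ (ltW s0)).
  by have := ler_norm (clip s (sg * Y0 w) - sg * Y0 w); rewrite distrC; lra.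
apply: (@le_trans _ _ (E (fun w => (sg * Y0 w)%R) + E (fun w => excess s (Y0 w)))%E).
  by apply: (sl_subadd hE) => //; rewrite Esg; apply: fin_num_adde_defr.
by rewrite Esg add0e.
Qed.

(** The three moment conditions of Rosenthal's inequality. The first collects
    the truncation bias ([E_clip_le]) and the drift caused by the lower level
    - L ([bclip_le_sqr]), each at most L / n. *)
Lemma bclip_moments sg m (j : nat) : sg = 1 \/ sg = -1 ->
  [/\ (E (fun w => bclip L s (sg * Y (m + j%:Z) w))%R <= (2 * L / n%:R)%:E)%E,
      (E (fun w => bclip L s (sg * Y (m + j%:Z) w) ^+ 2)%R <= (L ^+ 2 / n%:R)%:E)%E &
      (E (fun w => `|bclip L s (sg * Y (m + j%:Z) w)| ^+ k.+2)%R <= (L ^+ k.+2 / n%:R)%:E)%E].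
Proof.
move=> sg1; have s0' := ltW s0; have L0' := ltW L0.
have nsg (y : R) : `|sg * y| = `|y|.
  by case: sg1 => ->; rewrite ?mul1r ?mulN1r ?normrN.
have bb : bounded_rv (H := H) (fun w => bclip L s (sg * Y (m + j%:Z) w)).
  exact: (bounded_rv_step hE hY m sg L0 s0' j).
have bm e : bounded_rv (H := H) (fun w => Num.min `|Y (m + j%:Z) w| s ^+ e).
  apply: (bounded_rvX hE); rewrite (_ : (fun w => _) = (fun w => `|clip s (1 * Y (m + j%:Z) w)|)).
    exact/(bounded_rv_norm hE)/bounded_rv_clip.
  by apply/funext => w; rewrite mul1r norm_clip.
have m2 : (E (fun w => (Num.min `|Y (m + j%:Z) w| s ^+ 2)%R) <= (L ^+ 2 / n%:R)%:E)%E.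
  apply: (le_trans (square_le _)); rewrite lee_fin /L exprMn.
  by rewrite ler_wpM2r ?invr_ge0 ?(ltW nR)// ler_wpM2l// sqr_ge0.
have bclip_min (y : R) : `|bclip L s (sg * y)| <= Num.min `|y| s.
  by rewrite (le_trans (norm_bclip s _ L0'))// norm_clip// nsg.
split.
- have b1 := bounded_rv_clip sg (hY (m + j%:Z)).
  have b2 := bounded_rvX hE 2 b1; have b3 := bounded_rvZ hE L^-1 b2.
  apply: (@le_trans _ _ (E (fun w => (clip s (sg * Y (m + j%:Z) w)
      + L^-1 * clip s (sg * Y (m + j%:Z) w) ^+ 2)%R))).
    apply: (sl_mono hE); [exact: (bounded_rv_H (bounded_rvD hE b1 b3)) | exact: (bounded_rv_H bb) |].
    by move=> w; exact: bclip_le_sqr.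
  apply: (le_trans (E_add hE b1 (bounded_rv_H b3))).
  rewrite (_ : 2 * L / _ = L / n%:R + L^-1 * (L ^+ 2 / n%:R)); last first.
    have fld (a b : R) : a != 0 -> b != 0 -> 2 * a / b = a / b + a^-1 * (a ^+ 2 / b).
      by move=> a0 b0; field; rewrite a0 b0.
    by apply: fld; rewrite gt_eqF.
  rewrite EFinD; apply: leeD.
    apply: (le_trans (E_clip_le _ sg1)); rewrite lee_fin /L -mulrA ler_wpM2l//.
    by rewrite ler_pdivlMr// mulrC.
  rewrite (sl_homo hE) ?invr_ge0//; last exact: bounded_rv_H.
  rewrite (EFinM L^-1); apply: lee_wpmul2l; first by rewrite lee_fin invr_ge0.
  apply: le_trans m2; rewrite le_eqVlt; apply/orP; left; apply/eqP; congr E.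
  by apply/funext => w; rewrite -norm_clip// -[Y _ w]mul1r -real_normK ?num_real// !norm_clip// nsg mul1r.
- apply: le_trans m2; apply: (sl_mono hE); [exact: (bounded_rv_H (bm 2%N)) | exact: (bounded_rv_H (bounded_rvX hE 2 bb)) |].
  move=> w; rewrite -real_normK ?num_real// lerXn2r ?nnegrE//.
  by rewrite le_min normr_ge0.
- apply: (le_trans _ (le_trans (power_le (m + j%:Z)) _)).
    apply: (sl_mono hE); [exact: (bounded_rv_H (bm k.+2)) | exact: (bounded_rv_H (bounded_rvX hE k.+2 (bounded_rv_norm hE bb))) |].
    by move=> w; rewrite lerXn2r ?nnegrE// le_min normr_ge0.
  rewrite lee_fin (_ : L ^+ k.+2 / n%:R = s ^+ k.+2 * (lam ^+ k.+2 / n%:R)); last first.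
    by rewrite /L exprMn mulrA.
  by rewrite ler_wpM2l ?exprn_ge0// ler_pdivlMr// mulrC.
Qed.

End Moments.
End Windows.

(** * Maximal partial sums of the moving average *)

Section SymmetricSums.
Variable R : realType.

(** Symmetric partial sums as partial sums of an ordinary series, plus one
    unpaired term at N. *)
Lemma symmetric_sumE (V : nmodType) (F : int -> V) N :
  \sum_(t < N.*2.+1) F (t%:Z - N%:Z) =
  \sum_(0 <= k < N) (F (Posz k) + F (Negz k)) + F (Posz N).
Proof.
elim: N => [|N IH]; first by rewrite big_ord1 big_nil add0r subrr.
rewrite doubleS big_ord_recl big_ord_recr /= big_nat_recr//=.
have -> : F (0%:Z - N.+1%:Z) = F (Negz N) by rewrite sub0r NegzE.
have shift (i : nat) : (bump 0 i)%:Z - N.+1%:Z = i%:Z - N%:Z.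
  by rewrite /bump leq0n add1n !intS; ring.
under eq_bigr => i _ do rewrite shift.
rewrite IH shift (_ : (N.*2.+1)%:Z - N%:Z = N.+1%:Z); last first.
  by rewrite -addnn !intS PoszD; ring.
by rewrite addrA; congr (_ + _); rewrite addrC -addrA.
Qed.

(** If the right-hand side is finite, then all the two-sided series converge
    absolutely, because |y_(i+j)| <= 2 M_i. Otherwise there is nothing to
    prove, whatever the value of the limits: no exceptional set has to be
    discarded. *)
Lemma norm_sum_limn_le (a y M : int -> R) (n k : nat) :
  (forall i j, (j <= n)%N -> `|\sum_(1 <= l < j.+1) y (i + l%:Z)| <= M i) ->
  (k <= n)%N ->
  (`|\sum_(1 <= j < k.+1) limn (fun N : nat =>
       \sum_(t < N.*2.+1) a (t%:Z - N%:Z) * y (t%:Z - N%:Z + j%:Z))|%:E <=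
   \sum_(0 <= i <oo) (`|a (Posz i)| * M (Posz i) + `|a (Negz i)| * M (Negz i))%:E)%E.
Proof.
move=> yM kn.
have M0 i : 0 <= M i by apply: le_trans (yM i 0%N (leq0n _)).
pose b i := `|a i| * M i; have b0 i : 0 <= b i by rewrite mulr_ge0.
pose g i := b (Posz i) + b (Negz i); have g0 i : 0 <= g i by rewrite addr_ge0.
pose S := (\sum_(0 <= i <oo) (g i)%:E)%E; rewrite [leRHS](_ : _ = S)//.
have S0 : (0 <= S)%E by apply: nneseries_ge0 => i _ _; rewrite lee_fin.
have [Soo|Sfin] := eqVneq S +oo%E; first by rewrite Soo leey.
have {Sfin} Sfin : S \is a fin_num by rewrite ge0_fin_numE// ltey.
pose rho := fine S; have Srho : S = rho%:E by rewrite fineK.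
rewrite Srho lee_fin.
have part N : \sum_(0 <= i < N) g i <= rho.
  rewrite -lee_fin -Srho -sumEFin; apply: nneseries_lim_ge => i _ _.
  by rewrite lee_fin.
have cg : cvgn (series g).
  apply: nondecreasing_is_cvgn; last by exists rho => _ [N _ <-]; exact: part.
  by apply/nondecreasing_seqP => N; rewrite seriesSr/= lerDl.
have yle i j : (1 <= j <= n)%N -> `|y (i + j%:Z)| <= 2 * M i.
  case: j => // j /andP[_ jn].
  have h1 := yM i j.+1 jn; have h2 := yM i j (ltnW jn).
  rewrite big_nat_recr//= in h1.
  move: h1 h2; set A := \sum_(1 <= l < _) _; set z := y _ => h1 h2.
  rewrite (_ : z = (A + z) - A); last by ring.
  rewrite (le_trans (ler_normB _ _))//; lra.
pose s j N := \sum_(t < N.*2.+1) a (t%:Z - N%:Z) * y (t%:Z - N%:Z + j%:Z).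
have cvgs j : (1 <= j <= n)%N -> cvgn (s j).
  move=> jn; pose tau i := a i * y (i + j%:Z).
  have taub i : `|tau i| <= 2 * b i.
    by rewrite normrM /b mulrCA ler_wpM2l// yle.
  have c2 : cvgn (series (fun i => 2 * g i)).
    by rewrite (_ : series _ = 2 *: series g); [exact: is_cvgZr | exact: seriesZ].
  have cser (f : nat -> R) : (forall i, `|f i| <= 2 * g i) -> cvgn (series f).
    move=> fg; apply: normed_cvg; apply: (series_le_cvg _ _ _ c2) => i //=.
    by rewrite mulr_ge0.
  have -> : s j = series (fun k => tau (Posz k) + tau (Negz k)) \+ (fun N => tau (Posz N)).
    by apply/funext => N; rewrite /s (symmetric_sumE (fun i => a i * y (i + j%:Z))).
  apply: is_cvgD.
    apply: cser => i; rewrite /g mulrDr (le_trans (ler_normD _ _))//.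
    by rewrite lerD.
  apply/cvg_ex; exists 0; apply: cvg_series_cvg_0.
  apply: cser => i; rewrite (le_trans (taub _))// ler_wpM2l// lerDl//.
have lims : forall k', (k' <= n)%N ->
    (fun N => \sum_(1 <= j < k'.+1) s j N) @ \oo --> \sum_(1 <= j < k'.+1) limn (s j).
  elim=> [|k' IH] k'n.
    by under eq_fun do rewrite big_geq//; rewrite big_geq//; exact: cvg_cst.
  under eq_fun do rewrite big_nat_recr//=.
  rewrite big_nat_recr//=; apply: cvgD; first exact/IH/ltnW.
  exact: cvgs.
have lim := cvg_norm (lims k kn).
apply: (ler_cvg_to (lim _) (cvg_cst rho)); apply: nearW => N /=.
rewrite /s exchange_big/=.
apply: (le_trans _ (part N.+1)).
apply: (le_trans (ler_norm_sum _ _ _)).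
apply: (@le_trans _ _ (\sum_(t < N.*2.+1) b (t%:Z - N%:Z))).
  apply: ler_sum => t _; rewrite -mulr_sumr normrM /b ler_wpM2l//.
  exact: yM.
by rewrite (symmetric_sumE b) big_nat_recr//= lerD// /g lerDl.
Qed.

End SymmetricSums.

Section MovingAverageTail.
Context {d : measure_display} {T : measurableType d} {R : realType}.
Context {H : set (T -> R)} {E : (T -> R) -> \bar R}.
Hypotheses (hE : sublinear_space H E) (hEc : countably_subadditive H E).
Variables (Y : int -> T -> R) (Y0 : T -> R) (a : int -> R) (A : R).
Hypotheses (hY : forall i, H (Y i)) (hY0 : H Y0).
Hypotheses (hYnd : neg_dep_seq E Y) (hYid : forall i, ident_distr E (Y i) Y0).
Hypotheses (hmean : E Y0 = 0%E) (hmeanN : E (fun w => - Y0 w) = 0%E).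
Hypothesis (hX : forall n, (0 < n)%N -> H (moving_average a Y n)).
Hypotheses (A1 : 1 <= A)
  (aA : forall N, \sum_(0 <= i < N) (`|a (Posz i)| + `|a (Negz i)|) <= A).

Definition max_partial_sum (n : nat) (w : T) : R :=
  \big[Num.max/0]_(1 <= k < n.+1) `|\sum_(1 <= j < k.+1) moving_average a Y j w|.

Lemma max_partial_sum_ge0 n w : 0 <= max_partial_sum n w.
Proof. exact: bigmax_ge_id. Qed.

Lemma H_max_partial_sum n : H (max_partial_sum n).
Proof.
apply: (H_bigmax hE) => k; apply: (H_norm hE).
rewrite (_ : (fun w => _) = (fun w => \sum_(0 <= j < k) moving_average a Y j.+1 w)).
  by apply: (H_sum hE) => j; apply: hX.
by apply/funext => w; rewrite big_add1.
Qed.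

Lemma max_partial_sum_le n (M : int -> R) w :
  (forall i j, (j <= n)%N -> `|\sum_(1 <= l < j.+1) Y (i + l%:Z) w| <= M i) ->
  ((max_partial_sum n w)%:E <=
   \sum_(0 <= i <oo) (`|a (Posz i)| * M (Posz i) + `|a (Negz i)| * M (Negz i))%:E)%E.
Proof.
move=> YM; have M0 i : 0 <= M i by apply: le_trans (YM i 0%N (leq0n _)).
set S := (X in (_ <= X)%E).
have S0 : (0 <= S)%E.
  by apply: nneseries_ge0 => i _ _; rewrite lee_fin addr_ge0// mulr_ge0.
have [Soo|Sfin] := eqVneq S +oo%E; first by rewrite Soo leey.
have ES : S = (fine S)%:E by rewrite fineK// ge0_fin_numE// ltey.
rewrite ES lee_fin /max_partial_sum big_seq_cond.
apply: bigmax_le; first by rewrite -lee_fin -ES.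
move=> k; rewrite andbT mem_index_iota ltnS => /andP[_ kn].
rewrite -lee_fin -ES; exact: (norm_sum_limn_le a (y := fun i => Y i w) YM kn).
Qed.

(** Chebyshev's idea before expectations are taken: below eta nothing is paid,
    above it a higher power dominates. *)
Lemma linear_le_power (eta t : R) q : 0 < eta -> 0 <= t ->
  t <= eta + (eta ^+ q)^-1 * t ^+ q.+1.
Proof.
move=> e0 t0; have pe : 0 < eta ^+ q by rewrite exprn_gt0.
have [te|et] := leP t eta.
  by rewrite ler_wpDr// mulr_ge0 ?invr_ge0 ?exprn_ge0// ltW.
apply: ler_wpDl; first exact: ltW.
rewrite exprSr mulrA ler_peMl//.
by rewrite mulrC ler_pdivlMr// mul1r lerXn2r ?nnegrE ?(ltW e0) ?(ltW et).
Qed.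

Section Level.
Variables (s eta : R) (k n : nat).
Hypotheses (s0 : 0 < s) (eta0 : 0 < eta) (etaE : eta = s / (8 * A)).

(** A bound for what the maximal partial sum of a window exceeds 2 eta. *)
Definition window_cost (L : R) (m : int) (w : T) : R :=
  (eta ^+ k.+1)^-1 * (window_walk Y L s 1 m n w ^+ k.+2 + window_walk Y L s (-1) m n w ^+ k.+2)
  + window_excess Y s m n w.

Lemma window_cost_ge0 L m w : 0 <= window_cost L m w.
Proof.
have e0 := ltW eta0; rewrite /window_cost addr_ge0//.
  by rewrite mulr_ge0 ?invr_ge0 ?exprn_ge0// addr_ge0// exprn_ge0// walk_ge0.
by rewrite sumr_ge0// => j _; exact: excess_ge0.
Qed.

Lemma bounded_rv_window_walk L sg m : 0 < L -> bounded_rv (H := H) (window_walk Y L s sg m n).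
Proof. by move=> L0; exact: (bounded_rv_pos hE hY m sg L0 (ltW s0) n). Qed.

Lemma H_window_excess m : H (window_excess Y s m n).
Proof. by apply: (H_sum hE n (X := fun j w => excess s (Y (m + j%:Z) w))) => j; exact: (H_excess hE s (hY _)). Qed.

Lemma H_window_cost L m : 0 < L -> H (window_cost L m).
Proof.
move=> L0; apply: (H_add hE); last exact: H_window_excess.
apply/(H_scale hE)/(H_add hE); apply: bounded_rv_H; apply: (bounded_rvX hE);
  exact: bounded_rv_window_walk.
Qed.

Lemma window_sum_le_cost L i j w : (j <= n)%N ->
  `|\sum_(1 <= l < j.+1) Y (i + l%:Z) w| <= 2 * eta + window_cost L (i + 1) w.
Proof.
move=> jn; rewrite big_add1 /=.
under eq_bigr => l _ do rewrite (_ : i + l.+1%:Z = i + 1 + l%:Z) ?intS ?addrA//.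
apply: (le_trans (window_sum_le Y L (i + 1) w (ltW s0) jn)).
have h1 := linear_le_power k.+1 eta0 (walk_ge0 (fun j => bclip L s (1 * Y (i + 1 + j%:Z) w)) n).
have h2 := linear_le_power k.+1 eta0 (walk_ge0 (fun j => bclip L s (-1 * Y (i + 1 + j%:Z) w)) n).
rewrite /window_cost mulrDr; rewrite -!/(window_walk _ _ _ _ _ _ _) in h1 h2 *.
by move: h1 h2; rewrite /window_walk; lra.
Qed.

(** With eta = s / (8 A) the free parts 2 eta |a_i| add up to at most s / 4. So
    where the maximal partial sum exceeds s / 2, the weighted costs add up to at
    least s / 4; a Lipschitz cut-off between s / 2 and s and countable
    sub-additivity conclude. *)
Lemma capacity_tail_le_cost L (u : R) : 0 < L -> 0 <= u ->
  (forall m, (E (window_cost L m) <= u%:E)%E) ->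
  (capacity H E [set w | s < max_partial_sum n w]%R <= (4 / s * A * u)%:E)%E.
Proof.
move=> L0 u0 Eu.
have is0 : 0 <= 4 / s by rewrite divr_ge0// ltW.
have s0' := s0; have s20 : 0 < s / 2 by lra.
have A0 : 0 < A := lt_le_trans ltr01 A1.
pose al i := `|a (Posz i)| + `|a (Negz i)|.
pose Xs i w := 4 / s * (`|a (Posz i)| * window_cost L (Posz i + 1) w
   + `|a (Negz i)| * window_cost L (Negz i + 1) w).
have Xs0 i w : 0 <= Xs i w.
  by rewrite mulr_ge0// addr_ge0// mulr_ge0// window_cost_ge0.
have HXs i : H (Xs i).
  by apply/(H_scale hE)/(H_add hE); apply/(H_scale hE)/H_window_cost.
pose X w := ramp (s / 2) `|max_partial_sum n w|.
have HX : H X.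
  exact: (bounded_rv_H (bounded_rv_lip hE (bounded_lip_ramp s20) (H_max_partial_sum n))).
have m0 := max_partial_sum_ge0 n.
apply: (@le_trans _ _ (E X)).
  apply: capacity_le => // w; rewrite indicE; have [/set_mem/= sw|_] := boolP (w \in _).
    by rewrite /X ramp_eq1// ger0_norm//; lra.
  exact: ramp_ge0.
apply: (@le_trans _ _ (\sum_(0 <= i <oo) E (Xs i))%E).
  apply: hEc => // [w|w]; first exact: ramp_ge0.
  have [Mle|sM] := leP (max_partial_sum n w) (s / 2).
    rewrite /X ramp_eq0 ?ger0_norm//; apply: nneseries_ge0 => i _ _.
    by rewrite lee_fin.
  apply: (@le_trans _ _ 1%E); first by rewrite lee_fin ramp_le1.
  have := max_partial_sum_le (M := fun i => 2 * eta + window_cost L (i + 1) w)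
    (fun i j jn => window_sum_le_cost L i w jn).
  have split_cost i : `|a (Posz i)| * (2 * eta + window_cost L (Posz i + 1) w)
      + `|a (Negz i)| * (2 * eta + window_cost L (Negz i + 1) w)
      = 2 * eta * al i + s / 4 * Xs i w.
    by rewrite /al /Xs; field; rewrite gt_eqF.
  under eq_eseriesr => i _ do rewrite split_cost.
  move=> h; rewrite leNgt; apply/negP => lt1.
  have ser N : \sum_(0 <= i < N) Xs i w <= 1.
    rewrite -lee_fin -sumEFin; apply: (le_trans _ (ltW lt1)).
    by apply: nneseries_lim_ge => i _ _; rewrite lee_fin.
  have fin : (\sum_(0 <= i <oo) (Xs i w)%:E)%E \is a fin_num.
    rewrite ge0_fin_numE ?(lt_trans lt1) ?ltry//.
    by apply: nneseries_ge0 => i _ _; rewrite lee_fin.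
  move: h; rewrite [leRHS](_ : _ = (\sum_(0 <= i <oo) ((2 * eta)%:E * (al i)%:E) +
     \sum_(0 <= i <oo) ((s / 4)%:E * (Xs i w)%:E))%E); last first.
    have p1 i : (0 <= (2 * eta)%:E * (al i)%:E)%E.
      by rewrite -EFinM lee_fin mulr_ge0// ?addr_ge0// mulr_ge0// ltW.
    have p2 i : (0 <= (s / 4)%:E * (Xs i w)%:E)%E.
      by rewrite -EFinM lee_fin mulr_ge0// divr_ge0// ltW.
    rewrite -nneseriesD; last by [].
      by apply: eq_eseriesr => i _; rewrite EFinD !EFinM.
    by [].
  rewrite !nneseriesZl//; [|by move=> i _; rewrite lee_fin|by move=> i _; rewrite lee_fin addr_ge0].
  move=> h; have al_le : (\sum_(0 <= i <oo) (al i)%:E <= A%:E)%E.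
    apply: lime_le; first by apply: is_cvg_nneseries => i _ _; rewrite lee_fin addr_ge0.
    by apply: nearW => N; rewrite sumEFin lee_fin.
  rewrite -(fineK fin) in lt1 h; rewrite lte_fin in lt1.
  have : ((max_partial_sum n w)%:E <= (2 * eta * A + s / 4 * fine (\sum_(0 <= i <oo) (Xs i w)%:E)%E)%:E)%E.
    apply: (le_trans h); rewrite EFinD EFinM leeD2r// (EFinM (2 * eta)).
    by apply: lee_wpmul2l => //; rewrite lee_fin mulr_ge0// ltW.
  rewrite lee_fin (_ : 2 * eta * A = s / 4); last by rewrite etaE; field; rewrite gt_eqF.
  set f := fine _ in lt1 *; have : s / 4 * f < s / 4 * 1 by rewrite ltr_pM2l// divr_gt0.
  lra.
apply: (@le_trans _ _ (\sum_(0 <= i <oo) ((4 / s * u)%:E * (al i)%:E))%E).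
  apply: lee_nneseries => i _; first by move=> _; exact: (E_ge0 hE).
  rewrite /Xs (sl_homo hE is0); last first.
    by apply: (H_add hE); apply/(H_scale hE)/H_window_cost.
  rewrite -EFinM (_ : 4 / s * u * al i = 4 / s * (`|a (Posz i)| * u + `|a (Negz i)| * u)); last first.
    by rewrite /al; ring.
  rewrite (EFinM (4 / s)); apply: lee_wpmul2l; first by rewrite lee_fin.
  have Hc j : H (fun w => `|a j| * window_cost L (j + 1) w) by exact/(H_scale hE)/H_window_cost.
  have c0 j : (0 <= E (fun w => (`|a j| * window_cost L (j + 1) w)%R))%E.
    by apply: (E_ge0 hE) => // w; rewrite mulr_ge0// window_cost_ge0.
  apply: (@le_trans _ _ (E (fun w => (`|a (Posz i)| * window_cost L (Posz i + 1) w)%R)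
     + E (fun w => (`|a (Negz i)| * window_cost L (Negz i + 1) w)%R))%E).
    by apply: (sl_subadd hE) => //; apply: ge0_adde_def; rewrite inE.
  rewrite EFinD; apply: leeD; rewrite (sl_homo hE) ?EFinM//; try exact: H_window_cost;
    by apply: lee_wpmul2l.
rewrite nneseriesZl; last by move=> i _; rewrite lee_fin addr_ge0.
rewrite (_ : 4 / s * A * u = 4 / s * u * A); last by ring.
rewrite (EFinM (4 / s * u)); apply: lee_wpmul2l; first by rewrite lee_fin mulr_ge0.
apply: lime_le; first by apply: is_cvg_nneseries => i _ _; rewrite lee_fin addr_ge0.
by apply: nearW => N; rewrite sumEFin lee_fin.
Qed.

End Level.

(** The q-th powers of the walks contribute (s lam)^q / s^(q-1) and the excesses
    n s be, both at most s lam^q up to constants; dividing by s removes the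
    scale. *)
Lemma moving_average_tail k : ~~ odd k -> exists2 C : R, 0 <= C &
  forall (s lam be ga : R) (n : nat), 0 < s -> 0 < lam -> (0 < n)%N -> 0 <= be ->
  (forall i, (E (fun w => excess s (Y i w)) <= (s * be)%:E)%E) ->
  (E (fun w => excess s (Y0 w)) <= (s * be)%:E)%E ->
  (forall i, (E (fun w => (Num.min `|Y i w| s ^+ k.+2)%R) <= (s ^+ k.+2 * be)%:E)%E) ->
  (forall i, (E (fun w => (Num.min `|Y i w| s ^+ 2)%R) <= (s ^+ 2 * ga / n%:R)%:E)%E) ->
  n%:R * be <= lam -> n%:R * be <= lam ^+ k.+2 -> ga <= lam ^+ 2 ->
  (capacity H E [set w | s < max_partial_sum n w]%R <= (C * lam ^+ k.+2)%:E)%E.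
Proof.
move=> ek; have [C C0 mom] := walk_moment R ek.
have A0 : 0 < A := lt_le_trans ltr01 A1.
exists (4 * A * ((8 * A) ^+ k.+1 * (2 * C) + 1)).
  by rewrite !mulr_ge0 ?addr_ge0 ?mulr_ge0 ?exprn_ge0 ?mulr_ge0// ltW.
move=> s lam be ga n s0 lam0 n0 be0 ex ex0 pw sq bl blq gl.
have L0 : 0 < s * lam by rewrite mulr_gt0.
have iA : 0 < s / (8 * A) by rewrite divr_gt0// mulr_gt0.
pose u := ((s / (8 * A)) ^+ k.+1)^-1 * (2 * (C * (s * lam) ^+ k.+2)) + n%:R * (s * be).
have u0 : 0 <= u.
  apply: addr_ge0; last by rewrite mulr_ge0// mulr_ge0// ltW.
  apply: mulr_ge0; first by rewrite invr_ge0 exprn_ge0// ltW.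
  by rewrite mulr_ge0// mulr_ge0// exprn_ge0// ltW.
have wE sg m : sg = 1 \/ sg = -1 ->
  (E (fun w => (window_walk Y (s * lam) s sg m n w ^+ k.+2)%R) <= (C * (s * lam) ^+ k.+2)%:E)%E.
  move=> sg1; apply: (mom d T H E Y m (s * lam) s sg n) => // [|j|j|j]; first exact: ltW.
  - by have [] := bclip_moments hE hY hY0 hYid hmean hmeanN s0 lam0 n0 ex0 pw sq bl blq gl m j sg1.
  - by have [] := bclip_moments hE hY hY0 hYid hmean hmeanN s0 lam0 n0 ex0 pw sq bl blq gl m j sg1.
  - by have [] := bclip_moments hE hY hY0 hYid hmean hmeanN s0 lam0 n0 ex0 pw sq bl blq gl m j sg1.
have cost m : (E (window_cost s (s / (8 * A)) k n (s * lam) m) <= u%:E)%E.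
  have b1 := bounded_rvX hE k.+2 (bounded_rv_window_walk n s0 1 m L0).
  have b2 := bounded_rvX hE k.+2 (bounded_rv_window_walk n s0 (-1) m L0).
  have b12 := bounded_rvD hE b1 b2.
  have b3 := bounded_rvZ hE ((s / (8 * A)) ^+ k.+1)^-1 b12.
  apply: (le_trans (E_add hE b3 (H_window_excess s n m))).
  rewrite /u EFinD; apply: leeD; last exact: (window_excess_E hE hY n ex m).
  rewrite (sl_homo hE); [|by rewrite invr_ge0 exprn_ge0// ltW|exact: bounded_rv_H].
  rewrite EFinM; apply: lee_wpmul2l; first by rewrite lee_fin invr_ge0 exprn_ge0// ltW.
  apply: (le_trans (E_add hE b1 (bounded_rv_H b2))).
  by rewrite mulr_natl mulr2n EFinD; apply: leeD; apply: wE; [left|right].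
apply: (le_trans (capacity_tail_le_cost s0 iA erefl L0 u0 cost)); rewrite lee_fin.
have sN : s != 0 by rewrite gt_eqF.
have AN : A != 0 by rewrite gt_eqF.
have -> : 4 / s * A * u = 4 * A * ((8 * A) ^+ k.+1 * (2 * C) * lam ^+ k.+2 + n%:R * be).
  rewrite /u expr_div_n invf_div [(s * lam) ^+ k.+2]exprMn [s ^+ k.+2]exprS.
  by field; rewrite sN expf_neq0.
rewrite (_ : 4 * A * (_ + 1) * _ = 4 * A * ((8 * A) ^+ k.+1 * (2 * C) * lam ^+ k.+2 + lam ^+ k.+2)).
  by rewrite ler_wpM2l ?mulr_ge0 ?(ltW A0)// lerD2l.
by ring.
Qed.

End MovingAverageTail.

(** * Slowly varying functions on bounded ratios *)

Section SlowVariation.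
Variable R : realType.
Local Notation mu := (@lebesgue_measure R).

(** The measure c * mu (B / c) agrees with mu on intervals, hence everywhere. *)
Lemma lebesgue_measure_preimage_mul (c : R) (B : set R) : 0 < c -> measurable B ->
  mu [set x | B (c * x)] = ((c^-1)%:E * mu B)%E.
Proof.
move=> c0 mB; have c0' := ltW c0.
have mulc : measurable_fun [set: measurableTypeR R] ( *%R c : measurableTypeR R -> measurableTypeR R).
  exact: mulrl_measurable.
have Bnu : mu B = pushforward (mscale (NngNum c0') mu) ( *%R c : measurableTypeR R -> measurableTypeR R) B.
  apply/lebesgue_measure_unique => //= _ [[x y] _ <-].
  rewrite /mscale /= /pushforward /=.
  have -> : ( *%R c) @^-1` `]x, y]%classic = `](x / c), (y / c)]%classic.
    by apply/seteqP; split => z /=; rewrite !in_itv/= ltr_pdivrMr// ler_pdivlMr// [z * c]mulrC.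
  rewrite !lebesgue_measure_itv/= !lte_fin ltr_pM2r ?invr_gt0//.
  case: ifP => _; last by rewrite mule0.
  by rewrite -!EFinB -EFinM; congr EFin; field; rewrite gt_eqF.
rewrite [in RHS]Bnu /mscale /pushforward /=.
by rewrite muleA -EFinM mulVf ?gt_eqF// mul1e.
Qed.

Variable l : R -> R.
Hypothesis hl : slowly_varying l.

(** The dilations v in [1, 8] for which l (v x) is not within a factor 2 of
    l x. *)
Definition distorted (x : R) : set R :=
  `[1, 8]%classic `&` [set v | ~~ (l x / 2 <= l (v * x) <= 2 * l x)].

Lemma measurable_distorted x : 0 < x -> measurable (distorted x).
Proof.
move=> x0; have [ml _ _] := hl.
have m1 : measurable_fun `[(1:R), 8]%classic (fun v : R => l (v * x)).
  apply: (measurable_comp (F := `[(0:R), +oo[%classic)) => //.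
    by move=> _ [v /= + <-]; rewrite !in_itv/= andbT => /andP[v1 _]; rewrite mulr_ge0 ?(ltW x0)//; lra.
  apply: (@measurable_funS _ _ _ _ setT) => //.
  exact: mulrr_measurable.
rewrite (_ : distorted x = `[(1:R), 8]%classic `&`
   (fun v : R => l (v * x)) @^-1` (~` `[l x / 2, 2 * l x]%classic)).
  by apply: m1 => //; exact: measurableC.
by apply/seteqP; split => v [v1 /= h]; split => //=; [rewrite in_itv/=; exact/negP|
  move: h; rewrite in_itv/= => /negP].
Qed.

(** Pointwise convergence of l (v x) / l x to 1 on a set of finite measure
    implies convergence in measure: a point in infinitely many of the sets would
    contradict the slow variation. *)
Lemma distorted_small (del : R) : 0 < del ->
  exists2 X : R, 0 < X & forall x, X <= x -> (mu (distorted x) < del%:E)%E.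
Proof.
move=> del0; apply: contrapT => /forall2NP nX.
have /choice[u uP] : forall n : nat, exists x : R, n.+1%:R <= x /\ ~ (mu (distorted x) < del%:E)%E.
  move=> n; have [//|] := nX n.+1%:R.
  by move=> /existsNP[x /not_implyP[nx h]]; exists x.
have u0 n : 0 < u n by have [h _] := uP n; apply: lt_le_trans h; rewrite ltr0n.
pose F n := distorted (u n).
have mF n : measurable (F n) by exact: measurable_distorted.
have sub n : \bigcup_(k >= n) F k `<=` `[(1:R), 8]%classic by move=> v [k _ []].
have mU n : measurable (\bigcup_(k >= n) F k) by apply: bigcup_measurable.
have mu18 : mu `[(1:R), 8]%classic = 7%:E.
  rewrite lebesgue_measure_itv/= lte_fin -EFinB ifT; last by lra.
  by congr EFin; lra.
have fin0 : (mu (\bigcup_(k >= 0) F k) < +oo)%E.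
  apply: (@le_lt_trans _ _ (mu `[(1:R), 8]%classic)); last by rewrite mu18 ltry.
  by apply: le_measure; rewrite ?inE; [exact: mU|exact: measurable_itv|exact: sub].
have := lim_sup_set_cvg mu F mF fin0.
have -> : lim_sup_set F = set0.
  apply/seteqP; split => // v hv.
  have v0 : 0 < v.
    have [k _ [+ _]] := hv 0%N Logic.I.
    by rewrite /= in_itv/= => /andP[v1 _]; exact: lt_le_trans ltr01 v1.
  have [_ lpos /(_ v v0)] := hl.
  move=> /cvgrPdist_lt/(_ (1 / 2)) /= []; first by rewrite divr_gt0.
  move=> M [_ hM].
  pose N := Num.bound `|M|; have [k /= Nk [_ /=]] := hv N Logic.I.
  move/negP; apply.
  have uM : M < u k.
    have [h _] := uP k; apply: lt_le_trans h.
    rewrite (le_lt_trans (ler_norm M))// (lt_le_trans (archi_boundP (normr_ge0 M)))//.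
    by rewrite ler_nat leqW.
  have lu : 0 < l (u k) by apply/lpos/ltW.
  have := hM _ uM; rewrite ltr_norml => /andP[h1 h2].
  have e : l (v * u k) = (l (v * u k) / l (u k)) * l (u k) by rewrite divfK// gt_eqF.
  rewrite e; move: h1 h2; set q := _ / l (u k) => h1 h2; apply/andP; split.
    by rewrite mulrC ler_wpM2r ?(ltW lu)//; lra.
  by rewrite ler_wpM2r ?(ltW lu)//; lra.
rewrite measure0 => lim0.
have : (del%:E <= limn (fun n => mu (\bigcup_(k >= n) F k)))%E.
  apply: lime_ge; first by apply/cvg_ex; exists 0%E; exact: lim0.
  apply: nearW => n; have [_ /negP] := uP n; rewrite -leNgt => /le_trans; apply.
  apply: le_measure; rewrite ?inE; [exact: mF|exact: mU|].
  by move=> v vn; exists n => /=.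
by rewrite (cvg_lim _ lim0)// lee_fin leNgt del0.
Qed.

(** A weak form of the uniform convergence theorem, in the manner of its
    measure-theoretic proof: for large x and y the bad dilations of x and, after
    rescaling by x / y, those of y cannot cover [2, 4], so some v x = (c v) y is a
    good dilation of both. *)
Lemma slowly_varying_comparable : exists2 X : R, 0 < X & forall x y,
  X <= x -> X <= y -> x <= 2 * y -> y <= 2 * x -> l x <= 4 * l y.
Proof.
have h0 : 0 < 1 / 2 :> R by lra.
have [X X0 small] := distorted_small h0; exists X => // x y Xx Xy xy yx.
have x0 : 0 < x := lt_le_trans X0 Xx; have y0 : 0 < y := lt_le_trans X0 Xy.
pose c := x / y; have c0 : 0 < c by rewrite divr_gt0.
have c2 : c <= 2 by rewrite ler_pdivrMr.
have c12 : 1 / 2 <= c by rewrite ler_pdivlMr//; lra.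
have cy v : c * v * y = v * x by rewrite /c; field; rewrite gt_eqF.
(* The interval [2, 4] has measure 2, the bad dilations at most 1/2 for x and,
   after division by c >= 1/2, at most 1 for y; [1, 8] contains both v and c v. *)
have [v [v24 gx gy]] : exists v, [/\ 2 <= v <= 4, ~ distorted x v & ~ distorted y (c * v)].
  apply: contrapT => nv.
  have sub : `[(2:R), 4]%classic `<=` distorted x `|` [set v | distorted y (c * v)].
    move=> v /=; rewrite in_itv/= => v24; apply: contrapT => /not_orP[h1 h2].
    by apply: nv; exists v.
  have mx := measurable_distorted x0; have my := measurable_distorted y0.
  have mcy : measurable [set v | distorted y (c * v)].
    rewrite -[X in measurable X]setTI.
    exact: (mulrl_measurable (D := [set: R]) c measurableT my).
  pose I := `[(2 : R), 4]%classic; pose D := [set v : R | distorted y (c * v)].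
  have : (mu I <= mu (distorted x) + mu D)%E.
    apply: le_trans (measureU2 mu mx mcy); apply: le_measure; rewrite ?inE; [exact: measurable_itv| |exact: sub].
    exact: measurableU.
  rewrite /D lebesgue_measure_preimage_mul// lebesgue_measure_itv/= lte_fin ifT; last by lra.
  apply/negP; rewrite -ltNge.
  have sx := small _ Xx; have sy := small _ Xy.
  apply: (@le_lt_trans _ _ ((1 / 2)%:E + 2%:E * (1 / 2)%:E)%E).
    apply: leeD; first exact: ltW.
    apply: lee_pmul => //; first by rewrite lee_fin invr_ge0 ltW.
      by rewrite lee_fin -[leRHS]invrK lef_pV2 ?posrE//; lra.
    exact: ltW.
  by rewrite -EFinM -EFinD -EFinB lte_fin; lra.
move/andP: v24 => [v2 v4].
have in1 : `[(1:R), 8]%classic v by rewrite /= in_itv/=; apply/andP; split; lra.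
have in2 : `[(1:R), 8]%classic (c * v).
  rewrite /= in_itv/=; apply/andP; split.
    by apply: (@le_trans _ _ (1 / 2 * 2)); [lra | rewrite ler_pM//; lra].
  by apply: (@le_trans _ _ (2 * 4)); [rewrite ler_pM//; lra | lra].
have {}gx : l x / 2 <= l (v * x).
  by apply: contrapT => h; apply: gx; split => //=; apply/negP => /andP[].
have {}gy : l (v * x) <= 2 * l y.
  by rewrite -cy; apply: contrapT => h; apply: gy; split => //=; apply/negP => /andP[].
lra.
Qed.

End SlowVariation.

(** * The kernel series and the choice of levels *)

Lemma eqO_nat_le (R : realType) (u v : nat -> R) : u =O_\oo v ->
  exists2 C : R, 0 < C & exists N : nat, forall n, (N <= n)%N -> `|u n| <= C * `|v n|.
Proof.
by move=> /eqO_exP[C C0 [N _ h]]; exists C => //; exists N => n Nn; exact: h.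
Qed.

Section Kernel.
Variable R : realType.
Variables (l : R -> R) (p r : R) (g f : nat -> R) (F : R -> R).
Hypotheses (hl : slowly_varying l) (hp : 1 <= p) (hr : Num.max 2 p <= r).
Hypotheses (hg : forall n, (0 < n)%N -> 0 < g n) (hf : forall n, (0 < n)%N -> 0 < f n).
Hypotheses (hF : interpolates F f) (C1 : condC1 p f) (C2 : condC2 p f g l) (C3 : condC3 p r f g l).

Let p0 : 0 < p. Proof. exact: lt_le_trans ltr01 hp. Qed.
Let r2 : 2 <= r. Proof. by move: hr; rewrite ge_max => /andP[]. Qed.
Let pr : p <= r. Proof. by move: hr; rewrite ge_max => /andP[]. Qed.
Let r1 : 1 <= r. Proof. by apply: le_trans r2; rewrite ler1n. Qed.
Let r0 : 0 < r. Proof. exact: lt_le_trans ltr01 r1. Qed.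

Lemma l_nat_gt0 (n : nat) : 0 < l n%:R.
Proof. by have [_ h _] := hl; apply: h. Qed.

Lemma f_ltS m : (0 < m)%N -> f m < f m.+1.
Proof.
move=> m0; have [_ Fh _ Ff] := hF.
by rewrite -!Ff//; apply: Fh; rewrite ?in_itv/= ?andbT ?ler0n// ltr_nat.
Qed.

Lemma f_unbounded (z : R) : exists2 N, (0 < N)%N & forall n, (N <= n)%N -> z < f n.
Proof.
have [_ /cvgryPgt h _] := C1; have [N _ hN] := h z.
by exists N.+1 => // n Nn; apply: hN => /=; exact: ltnW.
Qed.

Definition moment_fun (z : R) : R := z `^ p * Num.max 1 (l (inv_on_nonneg F z)).

Lemma inv_on_nonnegP z : 0 <= z -> 0 <= inv_on_nonneg F z /\ F (inv_on_nonneg F z) = z.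
Proof.
move=> z0; have [_ _ [_ Finj Fsurj] _] := hF.
have zim : z \in F @` `[0, +oo[%classic.
  by apply/mem_set/Fsurj; rewrite /= in_itv/= andbT.
split; last exact: pinvK.
have : `[0, +oo[%classic (inv_on_nonneg F z).
  apply: (surjpinv_image_sub (dflt := fun=> 0) Fsurj).
  by exists z => //=; rewrite in_itv/= andbT.
by rewrite /= in_itv/= andbT.
Qed.

(** The inverse is between k and k+1 on the k-th block of f, where values of l
    are comparable. *)
Lemma inv_on_nonneg_block k z : (0 < k)%N -> f k <= z < f k.+1 ->
  k%:R <= inv_on_nonneg F z <= k.+1%:R.
Proof.
move=> k0 /andP[kz zk]; have [_ Fh _ Ff] := hF.
have z0 : 0 <= z by rewrite (le_trans _ kz)// ltW// hf.
have [u0 Fu] := inv_on_nonnegP z0; set u := inv_on_nonneg F z in u0 Fu *.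
apply/andP; split; rewrite leNgt; apply/negP => h.
  have : F u < F k%:R by apply: Fh; rewrite ?in_itv/= ?andbT ?ler0n.
  by rewrite Ff// Fu ltNge kz.
have : F k.+1%:R < F u by apply: Fh; rewrite ?in_itv/= ?andbT ?ler0n.
by rewrite Ff// Fu ltNge (ltW zk).
Qed.

Lemma wsum_ge0 s m : 0 <= wsum f g l s m.
Proof.
rewrite /wsum big_nat; apply: sumr_ge0 => n /andP[n0 _].
have := ltW (hg n0); have := ltW (hf n0); have := ltW (l_nat_gt0 n) => *.
by rewrite divr_ge0// !mulr_ge0// powR_ge0.
Qed.

Definition power_drop m : R := f m `^ (1 - r) - f m.+1 `^ (1 - r).

Lemma power_drop_ge0 m : (0 < m)%N -> 0 <= power_drop m.
Proof.
move=> m0; have fm := hf m0; have fS := hf (ltn0Sn m); have r1' := r1.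
rewrite subr_ge0 -[1 - r]opprB !powRN lef_pV2 ?posrE ?powR_gt0//.
by rewrite ge0_ler_powR ?nnegrE ?subr_ge0 ?(ltW fm) ?(ltW fS) ?(ltW (f_ltS m0)).
Qed.

Lemma ln_ratio_ge0 m : (0 < m)%N -> 0 <= ln (f m.+1 / f m).
Proof. by move=> m0; rewrite ln_ge0// ler_pdivlMr ?hf// mul1r ltW// f_ltS. Qed.

(** The smaller of the integrals of z / x and of (r - 1) (z / x)^r for x between
    f m and f m.+1: the first is better when z is large, the second when z is
    small. *)
Definition block_kernel m (z : R) : R :=
  Num.min (z * ln (f m.+1 / f m)) (z `^ r * power_drop m).

Lemma block_kernel_ge0 m z : (0 < m)%N -> 0 <= z -> 0 <= block_kernel m z.
Proof.
move=> m0 z0; rewrite /block_kernel le_min !mulr_ge0 ?ln_ratio_ge0 ?powR_ge0//.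
exact: power_drop_ge0.
Qed.

Lemma block_kernel_homo m x y : (0 < m)%N -> 0 <= x -> x <= y ->
  block_kernel m x <= block_kernel m y.
Proof.
move=> m0 x0 xy; rewrite /block_kernel le_min; apply/andP; split; rewrite ge_min; apply/orP.
  by left; rewrite ler_wpM2r ?ln_ratio_ge0.
right; rewrite ler_wpM2r ?power_drop_ge0// ge0_ler_powR ?nnegrE ?(ltW r0)//.
exact: le_trans xy.
Qed.

Lemma block_kernel_scale m c z : (0 < m)%N -> 1 <= c -> 0 <= z ->
  block_kernel m (c * z) <= c `^ r * block_kernel m z.
Proof.
move=> m0 c1 z0; have c0 : 0 <= c := le_trans ler01 c1.
rewrite /block_kernel minr_pMr ?powR_ge0// le_min; apply/andP; split; rewrite ge_min; apply/orP.
  left; rewrite mulrA ler_wpM2r ?ln_ratio_ge0// ler_wpM2r//.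
  exact: le1r_powR.
by right; rewrite powRM// mulrA.
Qed.

Lemma wsum0 s : wsum f g l s 0 = 0.
Proof. by rewrite /wsum big_geq. Qed.

Definition kernel_sum (z : R) : \bar R :=
  (\sum_(0 <= m <oo) (wsum f g l 1 m * block_kernel m z)%:E)%E.

Lemma kernel_term_ge0 m z : 0 <= z -> (0 <= (wsum f g l 1 m * block_kernel m z)%:E)%E.
Proof.
case: m => [|m] z0; first by rewrite wsum0 mul0r.
by rewrite lee_fin mulr_ge0 ?wsum_ge0 ?block_kernel_ge0.
Qed.

Lemma kernel_sum_homo x y : 0 <= x -> x <= y -> (kernel_sum x <= kernel_sum y)%E.
Proof.
move=> x0 xy; apply: lee_nneseries => [m _ _|[|m] _]; first exact: kernel_term_ge0.
  by rewrite !wsum0 !mul0r.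
by rewrite lee_fin ler_wpM2l ?wsum_ge0// block_kernel_homo.
Qed.

Lemma kernel_sum_scale c z : 1 <= c -> 0 <= z ->
  (kernel_sum (c * z) <= (c `^ r)%:E * kernel_sum z)%E.
Proof.
move=> c1 z0; have c0 : 0 <= c := le_trans ler01 c1.
rewrite /kernel_sum -nneseriesZl; last by move=> m _; exact: kernel_term_ge0.
apply: lee_nneseries => [m _ _|[|m] _]; first by apply: kernel_term_ge0; rewrite mulr_ge0.
  by rewrite !wsum0 !mul0r mule0.
by rewrite -EFinM lee_fin mulrCA ler_wpM2l ?wsum_ge0// block_kernel_scale.
Qed.

(** For z in the k-th block of f, the logarithmic bound is used for m <= k and
    the power bound for m > k; the sums are those of [condC2] and [condC3]. The factor 4 comes from replacing l (k) and l (k+1) by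
    l at the inverse of z. *)
Lemma kernel_sum_block : exists2 C : R, 0 <= C & exists2 k0 : nat, (0 < k0)%N &
  forall k z, (k0 <= k)%N -> f k <= z < f k.+1 ->
  (kernel_sum z <= (C * moment_fun z)%:E)%E.
Proof.
have r0' := r0; have r1' := r1; have p0' := p0.
have [c2 c20 [N2 h2]] := eqO_nat_le C2.
have [C3fin C3O] := C3; have [c3 c30 [N3 h3]] := eqO_nat_le C3O.
have [X X0 comp] := slowly_varying_comparable hl.
have [NX XN] : exists N : nat, X <= N%:R.
  by exists (Num.bound X); rewrite ltW// archi_boundP// ltW.
exists (4 * (c2 + c3)); first by rewrite mulr_ge0// addr_ge0// ltW.
exists (maxn (maxn N2 N3) NX).+1 => // k z kk /andP[kz zk].
move: kk; rewrite !gtn_max => /andP[/andP[kN2 kN3] kNX].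
have k0 : (0 < k)%N by exact: leq_ltn_trans kN2.
have fk := hf k0; have fS := hf (ltn0Sn k).
have z0 : 0 < z := lt_le_trans fk kz; have z0' := ltW z0.
have block : f k <= z < f k.+1 by rewrite kz.
have := inv_on_nonneg_block k0 block; set u := inv_on_nonneg F z => /andP[ku uk].
have Xk : X <= k%:R by rewrite (le_trans XN)// ler_nat ltnW.
have k1 : 1 <= k%:R :> R by rewrite ler1n.
have ek : k.+1%:R = k%:R + 1 :> R by rewrite natr1.
rewrite ek in uk.
have lk : l k%:R <= 4 * l u by apply: comp => //; lra.
have lk1 : l k.+1%:R <= 4 * l u by rewrite ek; apply: comp; lra.
have lM : l u <= Num.max 1 (l u) by rewrite le_max lexx orbT.
rewrite /moment_fun -/u; set M := Num.max 1 (l u) in lM *.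
have zp0 : 0 <= z `^ p by exact: powR_ge0.
have head : \sum_(0 <= m < k.+1) wsum f g l 1 m * block_kernel m z <= c2 * (4 * M) * z `^ p.
  rewrite big_ltn// wsum0 mul0r add0r.
  apply: (@le_trans _ _ (z * \sum_(1 <= m < k.+1) ln (f m.+1 / f m) * wsum f g l 1 m)).
    rewrite mulr_sumr [leLHS]big_nat [leRHS]big_nat; apply: ler_sum => m /andP[m0 _].
    by rewrite mulrA mulrC ler_wpM2r ?wsum_ge0// /block_kernel ge_min lexx.
  apply: (@le_trans _ _ (z * (c2 * (f k `^ (p - 1) * l k%:R)))).
    apply: ler_wpM2l => //; apply: (le_trans (ler_norm _)).
    apply: (le_trans (h2 k (ltnW kN2))); rewrite ger0_norm//.
    by rewrite mulr_ge0 ?powR_ge0 ?(ltW (l_nat_gt0 _)).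
  rewrite -(mulr_powRB1 z0' p0') mulrCA -mulrA; apply: ler_wpM2l; first exact: ltW.
  rewrite [leRHS]mulrCA; apply: ler_wpM2l => //; rewrite mulrC.
  apply: ler_pM; rewrite ?powR_ge0 ?(ltW (l_nat_gt0 _))//; first by lra.
  by rewrite ge0_ler_powR ?nnegrE ?subr_ge0 ?(ltW fk).
have term0 m : (0 <= termC3 r f g l m)%E.
  rewrite /termC3 lee_fin; case: m => [|m]; first by rewrite wsum0 mulr0.
  by rewrite mulr_ge0 ?wsum_ge0// power_drop_ge0.
set tail := (\sum_(k.+1 <= m <oo) termC3 r f g l m)%E.
have tail0 : (0 <= tail)%E by apply: nneseries_ge0.
have tailfin : tail \is a fin_num.
  rewrite ge0_fin_numE//; apply: le_lt_trans C3fin.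
  by rewrite [leRHS](nneseries_split 1 k)// add1n leeDr// sume_ge0.
have tail_le : fine tail <= c3 * (4 * M) * z `^ (p - r).
  apply: (le_trans (ler_norm _)); apply: (le_trans (h3 k.+1 (leqW (ltnW kN3)))).
  rewrite -mulrA; apply: ler_wpM2l; first exact: ltW.
  rewrite ger0_norm ?mulr_ge0 ?powR_ge0 ?(ltW (l_nat_gt0 _))// mulrC.
  apply: ler_pM; rewrite ?powR_ge0 ?(ltW (l_nat_gt0 _))//; first by lra.
  rewrite -opprB !powRN lef_pV2 ?posrE ?powR_gt0//.
  by rewrite ge0_ler_powR ?nnegrE ?subr_ge0 ?(ltW fS) ?(ltW zk).
rewrite /kernel_sum (nneseries_split 0 k.+1); last by move=> m _; exact: kernel_term_ge0.
rewrite add0n sumEFin.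
apply: (@le_trans _ _ ((c2 * (4 * M) * z `^ p)%:E + (z `^ r)%:E * tail)%E).
  apply: leeD; first by rewrite lee_fin.
  rewrite /tail -nneseriesZl//; apply: lee_nneseries => [m _ _|[|m] _].
  - exact: kernel_term_ge0.
  - by rewrite wsum0 mul0r mule_ge0// lee_fin powR_ge0.
  - rewrite /termC3 -EFinM lee_fin [leRHS]mulrA [leRHS]mulrC.
    by rewrite ler_wpM2l ?wsum_ge0// /block_kernel ge_min lexx orbT.
rewrite -(fineK tailfin) -EFinM -EFinD lee_fin.
have : z `^ r * fine tail <= z `^ r * (c3 * (4 * M) * z `^ (p - r)).
  by rewrite ler_wpM2l// powR_ge0.
rewrite [X in _ <= X -> _](_ : _ = c3 * (4 * M) * z `^ p); first by nra.
rewrite mulrCA -powRD; first by congr (_ * (_ `^ _)); ring.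
by rewrite (gt_eqF z0) implybT.
Qed.

(** [kernel_sum_block] covers all z above some f k0; below it, monotonicity in z
    leaves a constant. *)
Lemma kernel_sum_le : exists2 C : R, 0 <= C & forall z, 0 <= z ->
  (kernel_sum z <= (C * (1 + moment_fun z))%:E)%E.
Proof.
have [C C0 [k0 k00 block]] := kernel_sum_block.
have mf0 z : 0 <= moment_fun z.
  by rewrite mulr_ge0 ?powR_ge0// le_max ler01.
exists (C * (1 + moment_fun (f k0))); first by rewrite mulr_ge0// addr_ge0.
move=> z z0; have [zk|kz] := ltP z (f k0).
  apply: (le_trans (kernel_sum_homo z0 (ltW zk))).
  have bk : f k0 <= f k0 < f k0.+1 by rewrite lexx f_ltS.
  apply: (le_trans (block k0 (f k0) (leqnn _) bk)); rewrite lee_fin -mulrA ler_wpM2l//.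
  have := mf0 (f k0); have := mf0 z; nra.
have [N N0 zN] := f_unbounded z.
have ex : exists n, z < f n by exists N; exact: zN.
pose P n := (k0 <= n)%N && (z < f n).
have exP : exists n, P n.
  by exists (maxn N k0); rewrite /P leq_maxr zN// leq_maxl.
case: (ex_minnP exP) => n /andP[kn zn] nmin.
have k0n : (k0 < n)%N.
  by rewrite ltn_neqAle kn andbT; apply/eqP => e; move: zn; rewrite -e ltNge kz.
case: n k0n kn zn nmin => // n; rewrite ltnS => kn _ zn nmin.
have nz : f n <= z.
  rewrite leNgt; apply/negP => zn'; have /nmin : P n by rewrite /P kn.
  by rewrite ltnn.
have bn : f n <= z < f n.+1 by rewrite nz.
apply: (le_trans (block n z kn bn)); rewrite lee_fin -mulrA ler_wpM2l//.
have := mf0 (f k0); have := mf0 z; nra.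
Qed.

(** The moment function need not be monotone, so its inverse at 2^j is replaced
    by the supremum z j of the points where it is at most 2^j (and of 1, to
    have a positive level). Above z j the function exceeds 2^j; a point of the
    set within a factor 2 of z j controls the kernel, which grows at most by a
    constant factor from there to 2 z j. *)
Lemma exists_levels : exists z : nat -> R, exists2 C : R, 0 <= C & forall j,
  [/\ 1 <= z j, forall x, z j < x -> 2 ^+ j < moment_fun x,
      (2 * z j) `^ p <= C * 2 ^+ j & (kernel_sum (2 * z j) <= (C * 2 ^+ j)%:E)%E].
Proof.
have [C0 C00 Kle] := kernel_sum_le.
have p0' := p0; have r0' := r0; have hp' := hp.
pose S j := [set x : R | 0 <= x /\ (x = 1 \/ moment_fun x <= 2 ^+ j)].
have pow1 j : 1 <= 2 ^+ j :> R by rewrite exprn_ege1// ler1n.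
have S1 j : S j 1 by split; [exact: ler01 | left].
have powS j x : S j x -> x `^ p <= 2 ^+ j.
  move=> [x0 [->|h]]; first by rewrite powR1.
  apply: le_trans h; rewrite ler_peMr ?powR_ge0//.
  by rewrite le_max lexx.
have ubS j : ubound (S j) (2 ^+ j).
  move=> x Sx; have [x0 _] := Sx; have [x1|/ltW x1] := leP x 1; first exact: le_trans (pow1 j).
  by apply: le_trans (powS _ _ Sx); exact: le1r_powR.
have hs j : has_sup (S j) by split; [exists 1 | exists (2 ^+ j)].
pose z j := sup (S j).
have z1 j : 1 <= z j by apply: sup_upper_bound.
have near_sup j : exists2 s, S j s & 2 * z j <= 4 * s.
  have e0 : 0 < z j / 2 by rewrite divr_gt0// (lt_le_trans ltr01).
  have [s Ss h] := sup_adherent e0 (hs j); exists s => //.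
  by rewrite -/(z j) in h; lra.
have mf0 x : 0 <= moment_fun x.
  by rewrite mulr_ge0 ?powR_ge0// le_max ler01.
pose A := 4 `^ p + 4 `^ r * (C0 * (2 + moment_fun 1)).
exists z, A.
  by rewrite addr_ge0 ?powR_ge0// mulr_ge0 ?powR_ge0// mulr_ge0// addr_ge0.
move=> j; have [s Ss sz] := near_sup j; have [s0 s1] := Ss.
have z0 : 0 <= 2 * z j by rewrite mulr_ge0// (le_trans ler01).
have s40 : 0 <= 4 * s by rewrite mulr_ge0.
have pA : 0 <= 4 `^ r * (C0 * (2 + moment_fun 1)).
  by rewrite mulr_ge0 ?powR_ge0// mulr_ge0// addr_ge0.
split => //.
- move=> x zx; rewrite ltNge; apply/negP => h.
  have x0 : 0 <= x by rewrite ltW// (lt_trans _ zx)// (lt_le_trans ltr01).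
  have Sx : S j x by split => //; right.
  by move: zx; rewrite ltNge; move/negP; apply; apply: sup_upper_bound.
- apply: (@le_trans _ _ ((4 * s) `^ p)); first by rewrite ge0_ler_powR ?nnegrE ?(ltW p0').
  rewrite powRM//; apply: ler_pM; rewrite ?powR_ge0 ?powS//.
  by rewrite lerDl.
- apply: (le_trans (kernel_sum_homo z0 sz)).
  have c4 : 1 <= 4 :> R by rewrite ler1n.
  apply: (le_trans (kernel_sum_scale c4 s0)).
  apply: (@le_trans _ _ ((4 `^ r)%:E * (C0 * (2 + moment_fun 1) * 2 ^+ j)%:E)%E).
    apply: lee_wpmul2l; first by rewrite lee_fin powR_ge0.
    apply: (le_trans (Kle _ s0)); rewrite lee_fin -mulrA ler_wpM2l//.
    have := mf0 1; have := pow1 j; move: s1 => [->|]; nra.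
  rewrite -EFinM lee_fin mulrA ler_wpM2r ?(le_trans ler01)//.
  by rewrite lerDr powR_ge0.
Qed.

End Kernel.

(** * The tail of the maximal partial sums *)

Section ScaleFunction.
Variables (R : realType) (r : R).
Hypothesis (r1 : 1 <= r).

(** One profile that dominates, relative to the level s, both the excess and
    the truncated moments of order at least r. *)
Definition scale_fun (s x : R) : R := Num.min (x / s) ((x / s) `^ r).

Lemma scale_fun_ge0 s x : 0 < s -> 0 <= x -> 0 <= scale_fun s x.
Proof. by move=> s0 x0; rewrite /scale_fun le_min powR_ge0 divr_ge0// ltW. Qed.

Lemma excess_le_scale s x : 0 < s -> 0 <= x -> Num.max (x - s) 0 <= s * scale_fun s x.
Proof.
move=> s0 x0; have s0' := ltW s0; have sN : s != 0 by rewrite gt_eqF.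
have [xs|sx] := leP x s.
  rewrite (_ : Num.max _ _ = 0); last by apply/max_idPr; rewrite subr_le0.
  by rewrite mulr_ge0// scale_fun_ge0.
rewrite (_ : Num.max _ _ = x - s); last by apply/max_idPl; rewrite subr_ge0 ltW.
have u1 : 1 <= x / s by rewrite ler_pdivlMr// mul1r ltW.
rewrite /scale_fun (_ : Num.min _ _ = x / s); last by apply/min_idPl/le1r_powR.
by rewrite mulrC divfK// gerBl.
Qed.

Lemma power_le_scale s x q : 0 < s -> 0 <= x -> r <= q%:R ->
  Num.min x s ^+ q <= s ^+ q * scale_fun s x.
Proof.
move=> s0 x0 rq; have s0' := ltW s0; have sN : s != 0 by rewrite gt_eqF.
have u0 : 0 <= x / s by rewrite divr_ge0.
have [xs|sx] := leP x s.
  have xe : x = s * (x / s) by rewrite mulrC divfK.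
  rewrite [X in X ^+ _ <= _]xe exprMn ler_wpM2l ?exprn_ge0//.
  have u1 : x / s <= 1 by rewrite ler_pdivrMr// mul1r.
  rewrite /scale_fun; move: u0 u1; move: (x / s) => u u0 u1.
  move: u0; rewrite le_eqVlt => /orP[/eqP <-|u0].
    have q0 : (0 < q)%N by rewrite -(ltr_nat R); apply: lt_le_trans rq; apply: lt_le_trans r1.
    by rewrite expr0n gtn_eqF//= le_min lexx powR_ge0.
  rewrite -powR_mulrn ?(ltW u0)// le_min; apply/andP; split.
    by rewrite -[leRHS]powRr1 ?(ltW u0)// ger_powR ?u0// (le_trans r1).
  by rewrite ger_powR ?u0.
have u1 : 1 <= x / s by rewrite ler_pdivlMr// mul1r ltW.
rewrite -[leLHS]mulr1 ler_wpM2l ?exprn_ge0// /scale_fun le_min u1 /=.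
exact/(le_trans u1)/le1r_powR.
Qed.

(** Used with e = min (2, p): the truncated second moment is estimated by a
    moment that is finite by hypothesis. *)
Lemma square_le_power (s x e : R) : 0 < s -> 0 <= x -> 0 < e -> e <= 2 ->
  Num.min x s ^+ 2 <= s `^ (2 - e) * x `^ e.
Proof.
move=> s0 x0 e0 e2; have s0' := ltW s0.
have m0 : 0 <= Num.min x s by rewrite le_min x0.
have e2' : 0 <= 2 - e by rewrite subr_ge0.
have -> : Num.min x s ^+ 2 = Num.min x s `^ ((2 - e) + e) by rewrite subrK powR_mulrn.
move: m0; rewrite le_eqVlt => /orP[/eqP <-|m0].
  by rewrite subrK powR0 ?mulr_ge0 ?powR_ge0.
rewrite powRD; last by rewrite (gt_eqF m0) implybT.
apply: ler_pM; rewrite ?powR_ge0// ge0_ler_powR ?nnegrE ?(ltW m0) ?(ltW e0) ?ge_min ?lexx ?orbT//.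
Qed.

End ScaleFunction.

Section LayeredTail.
Context {d : measure_display} {T : measurableType d} {R : realType}.
Context {H : set (T -> R)} {E : (T -> R) -> \bar R}.
Hypotheses (hE : sublinear_space H E) (hEc : countably_subadditive H E).
Variables (Y : int -> T -> R) (Y0 : T -> R) (a : int -> R) (A : R).
Hypotheses (hY : forall i, H (Y i)) (hY0 : H Y0).
Hypotheses (hYnd : neg_dep_seq E Y) (hYid : forall i, ident_distr E (Y i) Y0).
Hypotheses (hmean : E Y0 = 0%E) (hmeanN : E (fun w => - Y0 w) = 0%E).
Hypothesis (hX : forall n, (0 < n)%N -> H (moving_average a Y n)).
Hypotheses (A1 : 1 <= A)
  (aA : forall N, \sum_(0 <= i < N) (`|a (Posz i)| + `|a (Negz i)|) <= A).
Variables (z : nat -> R) (r pi C0 : R).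
Hypotheses (z0 : forall j, 0 < z j) (zoo : forall x, exists j, x <= 2 * z j).
Hypotheses (r2 : 2 <= r) (pi0 : 0 < pi) (pi2 : pi <= 2) (C00 : 0 < C0).
Hypothesis sum_pi : (layer_sum (H := H) (E := E) Y0 z (fun x => x `^ pi)%R <= C0%:E)%E.

Let B s := layer_sum (H := H) (E := E) Y0 z (scale_fun r s).

Lemma layer_sum_le_scale (Phi Psi : R -> R) (c : R) : 0 <= c ->
  (forall x, 0 <= x -> 0 <= Psi x) -> (forall x, 0 <= x -> 0 <= Phi x) ->
  (forall x, 0 <= x -> Phi x <= c * Psi x) ->
  (layer_sum (H := H) (E := E) Y0 z Phi <= c%:E * layer_sum (H := H) (E := E) Y0 z Psi)%E.
Proof.
move=> c0 Psi0 Phi0 le; have w0 := layer_weight_ge0 hE Y0 z.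
have z2 j : 0 <= 2 * z j by rewrite mulr_ge0// ltW.
rewrite /layer_sum -nneseriesZl; last first.
  by move=> n _; rewrite mule_ge0// lee_fin Psi0.
apply: lee_nneseries => [n _ _|n _]; first by rewrite mule_ge0// lee_fin Phi0.
by rewrite muleA -EFinM lee_wpmul2r// lee_fin le.
Qed.

Lemma E_le_scale (Z : T -> R) (Phi Psi : R -> R) (c b : R) : 0 <= c ->
  H Z -> ident_distr E Z Y0 -> H (fun w => Phi `|Z w|) ->
  (forall x, 0 <= x -> 0 <= Psi x) -> (forall x, 0 <= x -> 0 <= Phi x) ->
  (forall x y, 0 <= x -> x <= y -> Phi x <= Phi y) ->
  (forall x, 0 <= x -> Phi x <= c * Psi x) ->
  (layer_sum (H := H) (E := E) Y0 z Psi <= b%:E)%E ->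
  (E (fun w => Phi `|Z w|%R) <= (c * b)%:E)%E.
Proof.
move=> c0 HZ ZY HP Psi0 Phi0 Phih le Pb.
apply: (le_trans (E_le_layer_sum hE hEc hY0 z0 zoo HZ ZY Phi0 Phih HP)).
apply: (le_trans (layer_sum_le_scale c0 Psi0 Phi0 le)).
by rewrite EFinM; apply: lee_wpmul2l.
Qed.

Let r1 : 1 <= r. Proof. by apply: le_trans r2; rewrite ler1n. Qed.

(** Rosenthal's inequality holds with an even exponent q >= r, so lam is taken
    with lam^q = Q, the right-hand side. If n be or ga exceeds 1 the bound is
    trivial, as capacities are at most 1. Otherwise Q is so large that
    lam = Q^(1/q) dominates n be and sqrt ga, both at most 1. *)
Lemma layered_tail : exists2 C : R, 0 <= C & forall (s : R) (n : nat), 0 < s -> (0 < n)%N ->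
  (capacity H E [set w | s < max_partial_sum Y a n w]%R <=
   C%:E * (n%:R%:E * B s + ((n%:R * (C0 * s `^ (- pi))) `^ (r / 2))%:E))%E.
Proof.
(* The exponent of Rosenthal's inequality is k+2, even and at least r. *)
pose k := (Num.bound r).*2; have ek : ~~ odd k by rewrite odd_double.
have r0 : 0 <= r by apply: le_trans r2.
have rk : r <= k.+2%:R.
  rewrite (le_trans (ltW (archi_boundP r0)))// ler_nat.
  by rewrite (leq_trans _ (leqnSn _))// (leq_trans _ (leqnSn _))// /k -addnn leq_addr.
have [C C_ge0 tail] := moving_average_tail hE hEc hY hY0 hYnd hYid hmean hmeanN hX A1 aA ek.
have C1 : 0 <= C + 1 by rewrite addr_ge0.
exists (C + 1) => // s n s0 n0; have s0' := ltW s0.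
have nR : 0 < n%:R :> R by rewrite ltr0n.
have sf0 x : 0 <= x -> 0 <= scale_fun r s x by exact: scale_fun_ge0.
have B0 : (0 <= B s)%E.
  apply: nneseries_ge0 => j _ _; rewrite mule_ge0 ?(layer_weight_ge0 hE)// lee_fin.
  by rewrite sf0// mulr_ge0// ltW.
pose ga := n%:R * (C0 * s `^ (- pi)).
have ga0 : 0 < ga by rewrite !mulr_gt0// powR_gt0.
have gar : 0 < ga `^ (r / 2) by rewrite powR_gt0.
rewrite -/ga.
have V1 (x : \bar R) : (1 <= x)%E ->
    (capacity H E [set w | s < max_partial_sum Y a n w]%R <= (C + 1)%:E * x)%E.
  move=> x1; apply: (le_trans (capacity_le1 hE _)); apply: (le_trans x1).
  by rewrite -[leLHS]mul1e lee_wpmul2r ?(le_trans _ x1)// lee_fin lerDr.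
have [Boo|Bfin] := eqVneq (B s) +oo%E.
  by apply: V1; rewrite Boo gt0_muley ?lte_fin// addye// leey.
have {}Bfin : B s \is a fin_num by rewrite ge0_fin_numE// ltey.
pose be := fine (B s); have EB : B s = be%:E by rewrite fineK.
have be0 : 0 <= be by rewrite -lee_fin -EB.
rewrite EB -(EFinM n%:R) -(EFinD (n%:R * be)).
have nbe : 0 <= n%:R * be by rewrite mulr_ge0.
have [be1|be1] := ltP 1 (n%:R * be).
  by apply: V1; rewrite lee_fin; lra.
have [ga1|ga1] := ltP 1 ga.
  apply: V1; rewrite lee_fin; have : 1 <= ga `^ (r / 2).
    rewrite -[leLHS](powRr0 ga); apply: ler_powR; first exact: ltW.
    by apply: divr_ge0.
  lra.
pose Q := n%:R * be + ga `^ (r / 2); have Q0 : 0 < Q by rewrite /Q ltr_wpDl.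
pose qi : R := k.+2%:R^-1; pose lam := Q `^ qi.
have qi0 : 0 < qi by rewrite invr_gt0.
have lam0 : 0 < lam by exact: powR_gt0.
have lamq : lam ^+ k.+2 = Q.
  by rewrite -powR_mulrn ?(ltW lam0)// -powRrM /qi mulVf// powRr1// ltW.
have small x : 0 <= x -> x <= 1 -> x <= Q -> x <= lam.
  move=> x0 x1 xQ; apply: (@le_trans _ _ (x `^ qi)); last first.
    by rewrite ge0_ler_powR ?nnegrE ?(ltW qi0) ?(ltW Q0).
  move: x0; rewrite le_eqVlt => /orP[/eqP <-|x0]; first exact: powR_ge0.
  by apply: ger1_powR; rewrite ?x0// invf_le1 ?ler1n.
have nbeQ : n%:R * be <= Q by rewrite lerDl ltW.
have gal : ga <= lam ^+ 2.
  have kq : 0 < k.+2%:R / 2 :> R by rewrite divr_gt0.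
  have -> : ga = (ga `^ (k.+2%:R / 2)) `^ (2 / k.+2%:R).
    rewrite -powRrM (_ : _ * _ = 1) ?powRr1 ?(ltW ga0)//.
    by field.
  have -> : lam ^+ 2 = Q `^ (2 / k.+2%:R).
    by rewrite -powR_mulrn ?(ltW lam0)// -powRrM mulrC.
  have e0 : 0 <= 2 / k.+2%:R :> R by rewrite divr_ge0.
  rewrite ge0_ler_powR ?nnegrE ?powR_ge0 ?(ltW Q0)//.
  apply: (@le_trans _ _ (ga `^ (r / 2))); last by rewrite lerDr.
  by rewrite ger_powR ?ga0// ler_wpM2r// invr_ge0.
have Y0Y0 : ident_distr E Y0 Y0 by [].
have exc Z : H Z -> ident_distr E Z Y0 -> (E (fun w => excess s (Z w)) <= (s * be)%:E)%E.
  move=> HZ ZY; apply: (E_le_scale (Phi := fun x => Num.max (x - s) 0) (Psi := scale_fun r s)) => //.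
  - exact: (H_excess hE s HZ).
  - by move=> x _; rewrite le_max lexx orbT.
  - by move=> x y _ xy; rewrite ge_max !le_max lexx lerB ?orbT.
  - by move=> x x0; apply: excess_le_scale.
  - by rewrite -/(B s) EB.
have Hmin Z e : H Z -> H (fun w => Num.min `|Z w| s ^+ e).
  move=> HZ; apply: bounded_rv_H; apply: (bounded_rvX hE).
  rewrite (_ : (fun w => _) = (fun w => `|clip s (1 * Z w)|)); last first.
    by apply/funext => w; rewrite mul1r norm_clip.
  exact/(bounded_rv_norm hE)/(bounded_rv_clip hE s0).
have minh e x y : 0 <= x -> x <= y -> Num.min x s ^+ e <= Num.min y s ^+ e.
  move=> x0 xy; have y0 := le_trans x0 xy.
  by rewrite lerXn2r ?nnegrE ?le_min ?x0 ?y0//= !ge_min xy lexx orbT.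
have min0 e x : 0 <= x -> 0 <= Num.min x s ^+ e.
  by move=> x0; rewrite exprn_ge0// le_min x0.
apply: (@le_trans _ _ (C * lam ^+ k.+2)%:E).
  apply: (tail s lam be ga n) => //.
  - by move=> i; apply: exc.
  - exact: exc.
  - move=> i; apply: (E_le_scale (Phi := fun x => Num.min x s ^+ k.+2) (Psi := scale_fun r s)) => //.
    + exact: exprn_ge0.
    + exact: Hmin.
    + by move=> x; apply: min0.
    + by move=> x y; apply: minh.
    + by move=> x x0; apply: power_le_scale.
    + by rewrite -/(B s) EB.
  - move=> i; rewrite (_ : s ^+ 2 * ga / n%:R = s `^ (2 - pi) * C0); last first.
      rewrite /ga powRB ?(gt_eqF s0) ?implybT// powRN powR_mulrn//.
      by field; rewrite !gt_eqF// powR_gt0.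
    apply: (E_le_scale (Phi := fun x => Num.min x s ^+ 2) (Psi := fun x => x `^ pi)) => //.
    + exact: powR_ge0.
    + exact: Hmin.
    + by move=> x _; exact: powR_ge0.
    + by move=> x; apply: min0.
    + by move=> x y; apply: minh.
    + by move=> x x0; apply: square_le_power.
  - exact: small.
  - by rewrite lamq.
rewrite -EFinM lee_fin lamq ler_wpM2r//; first exact: ltW.
by rewrite lerDl.
Qed.

End LayeredTail.

(** * Integrals over blocks *)

Section BlockIntegrals.
Variable R : realType.
Local Notation mu := (@lebesgue_measure R).
Implicit Types (c al be e : R) (a : nat -> R).

Lemma trivIset_steps a : nondecreasing_seq a ->
  trivIset [set: nat] (fun i => `[a i, a i.+1[%classic).
Proof.
move=> nd; apply/trivIsetP => i j _ _ ij.
wlog lt_ij : i j ij / (i < j)%N.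
  move=> h; move: (ij); rewrite neq_ltn => /orP[|lt_ji]; first exact: h.
  by rewrite setIC; apply: h => //; rewrite eq_sym.
apply/seteqP; split => // x /= [].
rewrite !in_itv/= => /andP[_ xi] /andP[jx _].
by have := lt_le_trans xi (le_trans (nd _ _ lt_ij) jx); rewrite ltxx.
Qed.

Lemma bigcup_steps a : nondecreasing_seq a -> (forall x, exists i, x < a i) ->
  \bigcup_i `[a i, a i.+1[%classic = `[a 0%N, +oo[%classic.
Proof.
move=> nd unb; apply/seteqP; split => x /=.
  move=> [i _ /=]; rewrite !in_itv/= andbT => /andP[ix _].
  by rewrite (le_trans _ ix)// nd.
rewrite in_itv/= andbT => x0; case: (ex_minnP (unb x)) => -[|i] xi imin.
  by move: xi; rewrite ltNge x0.
exists i => //=; rewrite in_itv/= xi andbT leNgt; apply/negP => /imin.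
by rewrite ltnn.
Qed.

(** The fundamental theorem of calculus, as an inequality on half-open
    intervals. *)
Lemma integral_block_le (G g : R -> R) al be : al <= be ->
  (forall x, al <= x <= be -> is_derive x 1 G (g x)) ->
  (forall x, al <= x <= be -> {for x, continuous g}) ->
  (forall x, al <= x <= be -> 0 <= g x) ->
  (\int[mu]_(x in `[al, be[) (g x)%:E <= (G be - G al)%:E)%E.
Proof.
rewrite le_eqVlt => /orP[/eqP <- _ _ _|ab dG cg g0].
  by rewrite set_itvco0 integral_set0 subrr.
have cw : {within `[al, be], continuous g}.
  apply: continuous_in_subspaceT => x; rewrite inE /= in_itv/=.
  exact: cg.
have mg : measurable_fun `[al, be]%classic g by apply: subspace_continuous_measurable_fun.
apply: (@le_trans _ _ (\int[mu]_(x in `[al, be]) (g x)%:E)%E).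
  apply: ge0_subset_integral => //; first exact/measurable_EFinP.
  by apply: subset_itvl; rewrite bnd_simp.
have cG x : al <= x <= be -> {for x, continuous G}.
  move=> /dG [dx _]; exact/differentiable_continuous/derivable1_diffP.
rewrite (continuous_FTC2 ab cw (F := G)) ?EFinB//.
  split.
  - by move=> x; rewrite in_itv/= => /andP[xa xb]; have [] := dG x; rewrite ?(ltW xa) ?(ltW xb).
  - by apply/cvg_at_right_filter/cG; rewrite lexx ltW.
  - by apply/cvg_at_left_filter/cG; rewrite lexx ltW.
move=> x; rewrite in_itv/= => /andP[xa xb]; rewrite derive1E.
by have [] := dG x; rewrite ?(ltW xa) ?(ltW xb).
Qed.

Lemma is_derive_shift_add c (x : R) : is_derive x (1 : R) (fun x : R => c + x) (1 : R).
Proof.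
rewrite -[X in is_derive _ _ _ X]add0r.
exact: (is_deriveD (is_derive_cst c x 1) (is_derive_id x 1)).
Qed.

Lemma integral_inv_le c al be : 0 < c + al -> al <= be ->
  (\int[mu]_(x in `[al, be[) ((c + x)^-1)%:E <= (ln ((c + be) / (c + al)))%:E)%E.
Proof.
move=> ca ab; have cb : 0 < c + be by lra.
rewrite ln_div ?posrE//.
apply: (@integral_block_le (fun x => ln (c + x)) (fun x => (c + x)^-1)) => // x /andP[ax xb].
- have cx : 0 < c + x by lra.
  rewrite -[X in is_derive _ _ _ X]mulr1.
  exact: (is_derive1_comp (is_derive1_ln cx) (is_derive_shift_add c x)).
- have cx : 0 < c + x by lra.
  apply: (@continuousV _ _ (fun x => c + x)); first by rewrite gt_eqF.
  have [dx _] := is_derive_shift_add c x.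
  exact/differentiable_continuous/derivable1_diffP.
- by rewrite invr_ge0; lra.
Qed.

Lemma integral_power_le c al be e : 1 < e -> 0 < c + al -> al <= be ->
  (\int[mu]_(x in `[al, be[) ((c + x) `^ (- e))%:E <=
   ((e - 1)^-1 * ((c + al) `^ (1 - e) - (c + be) `^ (1 - e)))%:E)%E.
Proof.
move=> e1 ca ab.
have e1' : 1 - e != 0 by rewrite lt_eqF// subr_lt0.
have e1'' : e - 1 != 0 by rewrite gt_eqF// subr_gt0.
pose G x : R := (1 - e)^-1 * (c + x) `^ (1 - e).
rewrite [X in (_ <= X%:E)%E](_ : _ = G be - G al); last by rewrite /G; field; rewrite e1' e1''.
have dpow x (q : R) : al <= x <= be -> is_derive x 1 (fun x => (c + x) `^ q) (q * (c + x) `^ (q - 1)).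
  move=> /andP[ax xb]; have cx : 0 < c + x by lra.
  rewrite -[X in is_derive _ _ _ X]mulr1.
  exact: (is_derive1_comp (is_derive1_powR q cx) (is_derive_shift_add c x)).
apply: (@integral_block_le G (fun x => (c + x) `^ (- e))) => // x axb.
- have -> : (c + x) `^ (- e) = (1 - e)^-1 *: ((1 - e) * (c + x) `^ (1 - e - 1)).
    by rewrite /GRing.scale/= mulrA mulVf// mul1r; congr (_ `^ _); ring.
  exact: (is_deriveZ _ (dpow x (1 - e) axb)).
- have [dx _] := dpow x (- e) axb.
  exact/differentiable_continuous/derivable1_diffP.
- exact: powR_ge0.
Qed.

End BlockIntegrals.

(** * Choquet integrals *)

Section ChoquetTail.
Context {d : measure_display} {T : measurableType d} {R : realType}.
Context {H : set (T -> R)} {E : (T -> R) -> \bar R}.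
Hypothesis hE : sublinear_space H E.
Local Notation mu := (@lebesgue_measure R).
Local Notation V := (capacity H E).
Implicit Types (Z : T -> R) (D : set R).

Lemma capacity_fin A : V A \is a fin_num.
Proof.
rewrite ge0_fin_numE ?(capacity_ge0 hE)//.
by rewrite (le_lt_trans (capacity_le1 hE A))// ltry.
Qed.

Lemma capacity_tail_homo Z x y : x <= y -> (V [set w | y < Z w]%R <= V [set w | x < Z w]%R)%E.
Proof. by move=> xy; apply: (capacity_homo) => w /=; exact: le_lt_trans. Qed.

Lemma measurable_capacity_tail Z D : measurable D ->
  measurable_fun D (fun x => V [set w | x < Z w]).
Proof.
move=> mD; rewrite (_ : (fun x => _) = EFin \o (fun x => fine (V [set w | x < Z w]))); last first.
  by apply/funext => x /=; rewrite fineK// capacity_fin.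
apply/measurable_EFinP; apply: nonincreasing_measurable => // x y xy.
by rewrite fine_le ?capacity_fin// capacity_tail_homo.
Qed.

(** On the negative half-line the integrand vanishes except at 0. *)
Lemma choquet_ge0E Z : (forall w, 0 <= Z w) ->
  choquet V Z = (\int[mu]_(x in `[0%R, +oo[) V [set w | x < Z w]%R)%E.
Proof.
move=> Z0; rewrite /choquet [X in (_ + X)%E](_ : _ = 0%E) ?adde0//.
pose c := 1 - fine (V [set w | 0 < Z w]).
have c0 : 0 <= c.
  by rewrite subr_ge0 -lee_fin fineK ?capacity_fin// (capacity_le1 hE).
transitivity (\int[mu]_(x in `]-oo, 0%R]) (- (c%:E * (\1_[set (0 : R)]%classic x)%:E))%E)%E.
  apply: eq_integral => x; rewrite inE /= in_itv/= => x0; rewrite indicE.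
  have [->|xN0] := eqVneq x 0.
    by rewrite mem_set//= mulr1 /c opprB EFinB fineK ?capacity_fin.
  rewrite memNset/= ?mulr0 ?oppr0; last exact/eqP.
  rewrite (_ : [set w | _] = setT) ?(capacityT hE) ?subee//.
  by apply/seteqP; split => // w _ /=; rewrite (lt_le_trans _ (Z0 w))// lt_neqAle xN0.
rewrite integral_ge0N; last by move=> x _; rewrite mule_ge0// lee_fin indicE ler0n.
rewrite ge0_integralZl_EFin//; last by apply/measurable_EFinP; exact: measurable_indic.
rewrite integral_indic// (_ : _ `&` _ = [set 0%R]); last first.
  by apply/seteqP; split => x /= => [[]//|->]; split => //; rewrite in_itv/= lexx.
by rewrite [X in (c%:E * X)%E](_ : _ = 0%E) ?mule0 ?oppe0//; exact: lebesgue_measure_set1.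
Qed.

(** The tail is nonincreasing, so on the interval from 2^(j-1) to 2^j it is at
    least its value at 2^j. *)
Lemma sum_dyadic_tail_lty Z :
  (\int[mu]_(x in `[0%R, +oo[) V [set w | x < Z w]%R < +oo)%E ->
  (\sum_(0 <= j <oo) (2 ^+ j)%:E * V [set w | 2 ^+ j < Z w]%R < +oo)%E.
Proof.
move=> fin; pose a (j : nat) : R := 2 ^+ j / 2.
have aS j : a j.+1 = 2 ^+ j by rewrite /a exprSr mulfK.
have pow0 j : 0 < 2 ^+ j :> R by rewrite exprn_gt0.
have nd : nondecreasing_seq a.
  by apply/nondecreasing_seqP => j; rewrite aS /a; have := pow0 j; lra.
have mtail D : measurable D -> measurable_fun D (fun x => V [set w | x < Z w]).
  exact: measurable_capacity_tail.
have tail0 x : (0 <= V [set w | (x < Z w)%R])%E by exact: (capacity_ge0 hE).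
apply: (@le_lt_trans _ _ (2%:E * \int[mu]_(x in `[0%R, +oo[) V [set w | x < Z w]%R)%E); last first.
  by rewrite lte_mul_pinfty.
apply: (@le_trans _ _ (2%:E * \sum_(0 <= j <oo) \int[mu]_(x in `[a j, a j.+1[) V [set w | x < Z w]%R)%E).
  rewrite -nneseriesZl; last by move=> j _; exact: integral_ge0.
  apply: lee_nneseries => [j _ _|j _]; first by rewrite mule_ge0// lee_fin ltW.
  apply: (@le_trans _ _ (2%:E * \int[mu]_(x in `[a j, a j.+1[) (cst (V [set w | 2 ^+ j < Z w]%R) x))%E).
    rewrite integral_cst// [X in (_ * (_ * X))%E](_ : _ = (2 ^+ j / 2)%:E); last first.
      rewrite -[LHS]/(lebesgue_measure `[a j, a j.+1[%classic) lebesgue_measure_itv/= lte_fin.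
      rewrite ifT; last by rewrite aS /a; have := pow0 j; lra.
      by rewrite -EFinB aS /a; congr EFin; field.
    rewrite muleCA -EFinM [leRHS]muleC.
    by rewrite (_ : 2 * (2 ^+ j / 2) = 2 ^+ j) //; field.
  apply: lee_wpmul2l => //; apply: ge0_le_integral.
  - exact: measurable_itv.
  - by move=> x _; exact: tail0.
  - exact: measurable_cst.
  - by apply: mtail; exact: measurable_itv.
  move=> x /=; rewrite in_itv/= aS => /andP[_ /ltW]; exact: capacity_tail_homo.
apply: lee_wpmul2l => //.
rewrite -ge0_integral_bigcup//; first last.
- exact: trivIset_steps.
- by apply: mtail; apply: bigcup_measurable.
apply: ge0_subset_integral => //; [exact: bigcup_measurable|exact: mtail|].
move=> x [j _ /=]; rewrite !in_itv/= andbT => /andP[+ _]; apply: le_trans.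
by rewrite /a divr_ge0// ltW.
Qed.

End ChoquetTail.

Section ScaleIntegrals.
Variable R : realType.
Local Notation mu := (@lebesgue_measure R).
Implicit Types (c al be r x : R).

Lemma measurable_shift_powR (D : set R) c (e : R) : measurable_fun D (fun y : R => (c + y) `^ e).
Proof.
apply: measurable_funTS; apply: (measurableT_comp (measurable_powR e)).
exact: measurable_funD.
Qed.

Lemma scale_fun_powR r s x : 0 < s -> 0 <= x ->
  scale_fun r s x = Num.min (x * s `^ (-1)) (x `^ r * s `^ (- r)).
Proof.
move=> s0 x0; have s0' := ltW s0; rewrite /scale_fun powRM ?invr_ge0//.
by rewrite -powR_inv1// -powRrM mulN1r.
Qed.

Lemma measurable_scale_fun r c al be x : 0 < c + al -> 0 <= x ->
  measurable_fun `[al, be[%classic (fun y => scale_fun r (c + y) x).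
Proof.
move=> ca x0.
apply: (eq_measurable_fun (fun y : R => Num.min (x * (c + y) `^ (-1)) (x `^ r * (c + y) `^ (- r)))).
  move=> y; rewrite inE/= in_itv/= => /andP[ay _]; rewrite scale_fun_powR//; lra.
apply: measurable_minr; apply: measurable_funM => //; exact: measurable_shift_powR.
Qed.

Lemma integral_scale_fun_le r c al be x : 1 < r -> 0 <= x -> 0 < c + al -> al <= be ->
  (\int[mu]_(y in `[al, be[) (scale_fun r (c + y) x)%:E <=
   (Num.min (x * ln ((c + be) / (c + al)))
     (x `^ r * ((r - 1)^-1 * ((c + al) `^ (1 - r) - (c + be) `^ (1 - r)))))%:E)%E.
Proof.
move=> r1 x0 ca ab.
have m := @measurable_scale_fun r c al be x ca x0.
have pos y : `[al, be[%classic y -> 0 < c + y.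
  by rewrite /= in_itv/= => /andP[ay _]; lra.
have sf0 y : `[al, be[%classic y -> (0 <= (scale_fun r (c + y) x)%:E)%E.
  by move=> /pos cy; rewrite lee_fin scale_fun_ge0.
have bound (G : R -> R) k b : 0 <= k -> measurable_fun `[al, be[%classic G ->
    (forall y, `[al, be[%classic y -> 0 <= G y) ->
    (forall y, `[al, be[%classic y -> scale_fun r (c + y) x <= k * G y) ->
    (\int[mu]_(y in `[al, be[) (G y)%:E <= b%:E)%E ->
    (\int[mu]_(y in `[al, be[) (scale_fun r (c + y) x)%:E <= (k * b)%:E)%E.
  move=> k0 mG G0 le Gb.
  apply: (@le_trans _ _ (\int[mu]_(y in `[al, be[) (k%:E * (G y)%:E))%E).
    apply: ge0_le_integral.
    - exact: measurable_itv.
    - exact: sf0.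
    - exact/measurable_EFinP.
    - by apply/measurable_EFinP/measurable_funM.
    - by move=> y yD; rewrite -EFinM lee_fin le.
  rewrite ge0_integralZl_EFin//; last exact/measurable_EFinP.
  by rewrite EFinM; apply: lee_wpmul2l.
rewrite EFin_min le_min; apply/andP; split.
  apply: (bound (fun y => (c + y)^-1)) => //.
  - apply: (eq_measurable_fun (fun y : R => (c + y) `^ (-1))); last exact: measurable_shift_powR.
    by move=> y; rewrite inE => /pos cy; rewrite powR_inv1// ltW.
  - by move=> y /pos cy; rewrite invr_ge0 ltW.
  - by move=> y _; rewrite /scale_fun ge_min lexx.
  - exact: integral_inv_le.
apply: (bound (fun y => (c + y) `^ (- r))); rewrite ?powR_ge0//.
- exact: measurable_shift_powR.
- by move=> y _; exact: powR_ge0.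
- by move=> y /pos cy; rewrite scale_fun_powR// ge_min lexx orbT.
- exact: integral_power_le.
Qed.

End ScaleIntegrals.

(** * Weighted double sums *)

Lemma summable_two_sided (R : realType) (a : int -> R) :
  summable [set: int] (fun i => (a i)%:E) ->
  exists2 A : R, 1 <= A &
    forall N, \sum_(0 <= i < N) (`|a (Posz i)| + `|a (Negz i)|) <= A.
Proof.
rewrite /summable; set S := (\esum_(i in _) _)%E => Sfin.
have S0 : (0 <= S)%E by apply: esum_ge0 => i _; exact: abse_ge0.
have ES : S = (fine S)%:E by rewrite fineK// ge0_fin_numE.
have half (e : nat -> int) N : injective e -> \sum_(0 <= i < N) `|a (e i)| <= fine S.
  move=> einj; rewrite -lee_fin -ES -sumEFin.
  apply: (@le_trans _ _ (\esum_(i in [set: nat]) `|(a (e i))%:E|)%E).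
    rewrite -nneseries_esumT//; apply: nneseries_lim_ge => i _ _.
    by rewrite lee_fin.
  pose b i := (`|(a i)%:E|)%E.
  rewrite -(@esum_image _ _ _ [set: nat] e b); last by move=> i j _ _; exact: einj.
  rewrite esum_mkcond; apply: le_esum => i _; case: ifP => _; [exact: lexx|exact: abse_ge0].
exists (1 + (fine S + fine S)).
  by rewrite lerDl addr_ge0// -lee_fin -ES.
move=> N; rewrite big_split/=.
have h1 := half Posz N; have h2 := half Negz N.
rewrite (le_trans (lerD (h1 _) (h2 _))) ?lerDr//.
- by move=> i j [].
- by move=> i j [].
Qed.

Section BlockTail.
Context {d : measure_display} {T : measurableType d} {R : realType}.
Context {H : set (T -> R)} {E : (T -> R) -> \bar R}.
Hypothesis hE : sublinear_space H E.
Local Notation mu := (@lebesgue_measure R).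
Local Notation V := (capacity H E).
Variables (M : T -> R) (C C0 r pi t eps c f1 f2 nr : R) (z : nat -> R) (v : nat -> \bar R).
Hypotheses (C_ge0 : 0 <= C) (C00 : 0 < C0) (r1 : 1 < r) (eps0 : 0 < eps).
Hypotheses (f10 : 0 < f1) (f12 : f1 <= f2) (cf1 : c <= eps * f1) (nr0 : 0 <= nr) (t0 : 0 <= t).
Hypothesis (tE : - pi * (r / 2) = t - r).
Hypotheses (z0 : forall j, 0 < z j) (v0 : forall j, (0 <= v j)%E).
Hypothesis tail : forall s, 0 < s -> (V [set w | s < M w]%R <=
  C%:E * (nr%:E * (\sum_(0 <= j <oo) (scale_fun r s (2 * z j)%R)%:E * v j)
          + ((nr * (C0 * s `^ (- pi))) `^ (r / 2))%:E))%E.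

(** The constant 1 makes it possible to use the same factor for the logarithmic
    part of the minimum, where eps cancels. *)
Definition kernel_factor : R := 1 + (r - 1)^-1 * eps `^ (1 - r).
Definition moment_factor : R := C0 `^ (r / 2) * eps `^ t * ((r - 1)^-1 * eps `^ (1 - r)).

(** The substitution x = c + y turns the tail of the positive part into the tail
    bound at x. The moment term is of order x^(t - r): x^t is bounded by its value
    at the right end of the block and x^(- r) is integrated, which produces
    the summand of [condC5]. *)
Lemma integral_tail_block_le :
  (\int[mu]_(y in `[(eps * f1 - c)%R, (eps * f2 - c)%R[)
      V [set w | y < Num.max (M w - c) 0]%R <=
   C%:E * (nr%:E * (\sum_(0 <= j <oo)
       (kernel_factor * Num.min (2 * z j * ln (f2 / f1))
          ((2 * z j) `^ r * (f1 `^ (1 - r) - f2 `^ (1 - r))))%:E * v j)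
     + (nr `^ (r / 2) * (moment_factor * (f2 `^ t * (f1 `^ (1 - r) - f2 `^ (1 - r)))))%:E))%E.
Proof.
have r1' := r1; have f10' := f10; have f12' := f12; have eps0' := eps0.
have t0' := t0; have cf1' := cf1.
have f20 : 0 < f2 := lt_le_trans f10' f12'.
have C00' := ltW C00.
set al := eps * f1 - c; set be := eps * f2 - c.
have al0 : 0 <= al by rewrite subr_ge0.
have ab : al <= be by rewrite lerB// ler_pM2l.
have cal : c + al = eps * f1 by rewrite /al addrC subrK.
have cbe : c + be = eps * f2 by rewrite /be addrC subrK.
have cal0 : 0 < c + al by rewrite cal mulr_gt0.
have z2 j : 0 <= 2 * z j by rewrite mulr_ge0// ltW.
set D := `[al, be[%classic.
have mD : measurable D by exact: measurable_itv.
have Dpos y : D y -> 0 <= y /\ 0 < c + y /\ c + y <= eps * f2.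
  rewrite /D /= in_itv/= => /andP[ay yb]; split; first exact: le_trans ay.
  by split; [lra | rewrite -cbe lerD2l ltW].
pose k1 := nr `^ (r / 2) * (C0 `^ (r / 2) * (eps * f2) `^ t).
have k10 : 0 <= k1 by rewrite !mulr_ge0 ?powR_ge0.
pose S y := (\sum_(0 <= j <oo) (scale_fun r (c + y) (2 * z j)%R)%:E * v j)%E.
have mterm j : measurable_fun D (fun y => (scale_fun r (c + y) (2 * z j)%R)%:E * v j)%E.
  under eq_fun do rewrite muleC.
  by apply: measurable_funeM; apply/measurable_EFinP; exact: measurable_scale_fun.
have term0 j y : D y -> (0 <= (scale_fun r (c + y) (2 * z j)%R)%:E * v j)%E.
  by move=> /Dpos[_ [cy _]]; rewrite mule_ge0// lee_fin scale_fun_ge0.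
have S0 y : D y -> (0 <= S y)%E by move=> Dy; apply: nneseries_ge0 => j _ _; exact: term0.
have mS : measurable_fun D S.
  by apply: (@ge0_emeasurable_sum _ _ _ D _ xpredT) => // j y Dy _; exact: term0.
have mP : measurable_fun D (fun y => ((c + y) `^ (- r))%:E).
  by apply/measurable_EFinP; exact: measurable_shift_powR.
apply: (@le_trans _ _ (\int[mu]_(y in D) (C%:E * (nr%:E * S y + k1%:E * ((c + y) `^ (- r))%:E)))%E).
  apply: ge0_le_integral => //.
  - by move=> y _; exact: (capacity_ge0 hE).
  - exact: (measurable_capacity_tail hE).
  - by apply: measurable_funeM; apply: emeasurable_funD; apply: measurable_funeM.
  move=> y Dy; have [y0 [cy cyf]] := Dpos y Dy.
  apply: (@le_trans _ _ (V [set w | c + y < M w]%R)).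
    apply: capacity_homo => w /=; rewrite lt_max => /orP[|]; last by lra.
    by rewrite ltrBrDl.
  apply: (le_trans (tail cy)); apply: lee_wpmul2l => //; rewrite leeD2l//.
  rewrite -EFinM lee_fin powRM ?mulr_ge0 ?powR_ge0// powRM ?powR_ge0// -powRrM tE.
  rewrite powRD ?(gt_eqF cy) ?implybT// /k1 -!mulrA !ler_wpM2l ?powR_ge0//.
  rewrite ler_wpM2r ?powR_ge0// ge0_ler_powR ?nnegrE ?(ltW cy)//.
  by rewrite mulr_ge0 ?ltW.
rewrite ge0_integralZl_EFin//; first last.
- by apply: emeasurable_funD; apply: measurable_funeM.
- move=> y Dy; rewrite adde_ge0 ?mule_ge0// ?S0 ?lee_fin ?powR_ge0//.
apply: lee_wpmul2l => //.
rewrite ge0_integralD//; first last.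
- exact: measurable_funeM.
- by move=> y _; rewrite mule_ge0 ?lee_fin ?powR_ge0.
- exact: measurable_funeM.
- by move=> y Dy; rewrite mule_ge0 ?S0.
have drop0 : 0 <= f1 `^ (1 - r) - f2 `^ (1 - r).
  rewrite subr_ge0 -[1 - r]opprB !powRN lef_pV2 ?posrE ?powR_gt0//.
  by rewrite ge0_ler_powR ?nnegrE ?subr_ge0 ?(ltW r1')// ltW.
have re0 : 0 <= (r - 1)^-1 * eps `^ (1 - r).
  by rewrite mulr_ge0 ?powR_ge0// invr_ge0 subr_ge0 ltW.
have epsE : (r - 1)^-1 * ((c + al) `^ (1 - r) - (c + be) `^ (1 - r)) =
    (r - 1)^-1 * eps `^ (1 - r) * (f1 `^ (1 - r) - f2 `^ (1 - r)).
  by rewrite cal cbe !powRM ?(ltW eps0) ?(ltW f10) ?(ltW f20)//; ring.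
apply: leeD.
  rewrite ge0_integralZl_EFin//.
  apply: lee_wpmul2l => //; rewrite /S integral_nneseries//.
  apply: lee_nneseries => [j _ _|j _]; first by apply: integral_ge0 => y; exact: term0.
  rewrite ge0_integralZr//; first last.
  - by move=> y /Dpos[_ [cy _]]; rewrite lee_fin scale_fun_ge0.
  - by apply/measurable_EFinP; exact: measurable_scale_fun.
  apply: lee_wpmul2r => //.
  apply: (le_trans (integral_scale_fun_le r1 (z2 j) cal0 ab)); rewrite lee_fin epsE.
  have -> : (c + be) / (c + al) = f2 / f1.
    by rewrite cal cbe; field; rewrite !gt_eqF.
  have l0 : 0 <= 2 * z j * ln (f2 / f1).
    by rewrite mulr_ge0// ln_ge0// ler_pdivlMr// mul1r.
  have p0 : 0 <= (2 * z j) `^ r * (f1 `^ (1 - r) - f2 `^ (1 - r)) by rewrite mulr_ge0 ?powR_ge0.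
  rewrite /kernel_factor; set k0 := (r - 1)^-1 * _ in re0 *.
  rewrite minr_pMr ?addr_ge0// le_min; apply/andP; split; rewrite ge_min; apply/orP.
    by left; rewrite ler_peMl// lerDl.
  right; rewrite mulrA [_ * k0]mulrC -mulrA ler_wpM2r// lerDr//.
rewrite ge0_integralZl_EFin//; last by move=> y _; rewrite lee_fin powR_ge0.
apply: (@le_trans _ _ (k1%:E * ((r - 1)^-1 * ((c + al) `^ (1 - r) - (c + be) `^ (1 - r)))%:E)%E).
  by apply: lee_wpmul2l; [rewrite lee_fin | exact: integral_power_le].
rewrite -EFinM lee_fin epsE /k1 /moment_factor powRM ?(ltW eps0) ?(ltW f20)//.
rewrite le_eqVlt; apply/orP; left; apply/eqP; ring.
Qed.

End BlockTail.

Section WeightedSums.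
Variable R : realType.

(** The weights are shifted by one index against the tails, which costs a
    factor 2. *)
Lemma dyadic_weights_lty (v U : nat -> \bar R) : (forall j, 0 <= v j)%E -> (forall j, 0 <= U j)%E ->
  (v 0%N < +oo)%E -> (forall j, v j.+1 <= U j)%E ->
  (\sum_(0 <= j <oo) (2 ^+ j)%:E * U j < +oo)%E ->
  (\sum_(0 <= j <oo) (2 ^+ j)%:E * v j < +oo)%E.
Proof.
move=> v0 U0 v00 vU fin.
have pow0 j : (0 <= (2 ^+ j)%:E :> \bar R)%E by rewrite lee_fin exprn_ge0.
apply: (@le_lt_trans _ _ (v 0%N + 2%:E * \sum_(0 <= j <oo) (2 ^+ j)%:E * U j)%E); last first.
  by rewrite lte_add_pinfty// lte_mul_pinfty.
apply: lime_le; first by apply: is_cvg_nneseries => j _ _; rewrite mule_ge0.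
apply: nearW => -[|N]; first by rewrite big_nil adde_ge0// mule_ge0// nneseries_ge0// => j _ _; rewrite mule_ge0.
rewrite big_ltn// expr0 mul1e leeD2l// big_add1/=.
apply: (@le_trans _ _ (2%:E * \sum_(0 <= j < N) (2 ^+ j)%:E * U j)%E); last first.
  by apply: lee_wpmul2l => //; apply: nneseries_lim_ge => j _ _; rewrite mule_ge0.
rewrite ge0_sume_distrr; last by move=> j _; rewrite mule_ge0.
by apply: lee_sum => j _; rewrite muleA -EFinM -exprS lee_wpmul2l.
Qed.

(** The support condition m >= n makes each column a finite sum. *)
Lemma triangular_series (I : nat -> nat -> \bar R) :
  (forall n m, (0 < n)%N -> 0 <= I n m)%E -> (forall n m, (m < n)%N -> I n m = 0%E) ->
  (\sum_(1 <= n <oo) \sum_(0 <= m <oo) I n m =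
   \sum_(0 <= m <oo) \sum_(1 <= n < m.+1) I n m)%E.
Proof.
move=> I0 Iz; pose J n m := if (0 < n)%N then I n m else 0%E.
have J0 n m : (0 <= J n m)%E by rewrite /J; case: ifP => // /I0.
transitivity (\sum_(n <oo | xpredT n && (1 <= n)%N) \sum_(m <oo) J n m)%E.
  rewrite eseries_cond; apply: eq_eseriesr => n /= n0.
  by apply: eq_eseriesr => m _; rewrite /J n0.
rewrite nneseries_interchange//; apply: eq_eseriesr => m _.
rewrite -eseries_cond (nneseries_split 1 m)// addrC eseries0 ?add0e.
  by rewrite add1n; apply: eq_big_nat => n /andP[n0 _]; rewrite /J n0.
by move=> n mn _; rewrite /J; case: ifP => // _; exact: Iz.
Qed.

End WeightedSums.

Section Assembly.
Context {d : measure_display} {T : measurableType d} {R : realType}.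
Context {H : set (T -> R)} {E : (T -> R) -> \bar R}.
Hypothesis hE : sublinear_space H E.
Local Notation mu := (@lebesgue_measure R).
Local Notation V := (capacity H E).

Lemma choquet_excess_series (M : T -> R) (b : R) (c : nat -> R) :
  nondecreasing_seq c -> c 0%N = b -> (forall x, exists i, x < c i) ->
  choquet V (fun w => Num.max (M w - b) 0) =
  (\sum_(0 <= m <oo) \int[mu]_(y in `[(c m - b)%R, (c m.+1 - b)%R[)
     V [set w | y < Num.max (M w - b) 0]%R)%E.
Proof.
move=> cnd c0 cunb; pose e m := c m - b.
have end_ : nondecreasing_seq e by move=> m n mn; rewrite lerD2r cnd.
have eunb x : exists i, x < e i by have [i h] := cunb (x + b); exists i; rewrite ltrBrDr.
rewrite (choquet_ge0E hE); last by move=> w; rewrite le_max lexx orbT.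
have e0 : e 0%N = 0 by rewrite /e c0 subrr.
have cover : `[(0 : R), +oo[%classic = \bigcup_i `[e i, e i.+1[%classic.
  by rewrite (bigcup_steps end_ eunb) e0.
rewrite cover ge0_integral_bigcup//.
- by apply: (measurable_capacity_tail hE); exact: bigcup_measurable.
- by move=> y _; exact: (capacity_ge0 hE).
- exact: trivIset_steps.
Qed.

End Assembly.

Unset Implicit Arguments.
Set Strict Implicit.

Theorem theorem3p1 (d : measure_display) (T : measurableType d) (R : realType)
  (H : set (T -> R)) (E : (T -> R) -> \bar R)
  (hE : sublinear_space H E) (hEc : countably_subadditive H E)
  (l : R -> R) (hl : slowly_varying l)
  (a : int -> R) (ha : summable [set: int] (fun i => (a i)%:E))
  (p r : R) (hp : 1 <= p) (hr : Num.max 2 p <= r)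
  (g f : nat -> R)
  (hg : forall n, (0 < n)%N -> 0 < g n)
  (hf : forall n, (0 < n)%N -> 0 < f n)
  (F : R -> R) (hF : interpolates F f)
  (C1 : condC1 p f) (C2 : condC2 p f g l) (C3 : condC3 p r f g l)
  (C4 : condC4 p f g l) (C5 : condC5 p r f g l) (C6 : condC6 p r f g l)
  (Y : int -> T -> R) (Y0 : T -> R)
  (hY : forall i, H (Y i)) (hY0 : H Y0)
  (hYnd : neg_dep_seq E Y)
  (hYid : forall i, ident_distr E (Y i) Y0)
  (hmean : E Y0 = 0%E) (hmeanN : E (fun w => - Y0 w) = 0%E)
  (hmoment : (choquet (capacity H E)
     (fun w => `|Y0 w| `^ p * Num.max 1 (l (inv_on_nonneg F `|Y0 w|)))%R < +oo)%E)
  (hX : forall n, (0 < n)%N -> H (moving_average a Y n))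
  (eps : R) (heps : 0 < eps) :
  (\sum_(1 <= n <oo)
     (g n * l n%:R / f n)%:E *
     choquet (capacity H E) (fun w =>
       Num.max (\big[Num.max/0]_(1 <= k < n.+1)
                  `|\sum_(1 <= j < k.+1) moving_average a Y j w| - eps * f n) 0)%R
   < +oo)%E.
Proof.
have p0 : 0 < p := lt_le_trans ltr01 hp.
have [r2 pr] : 2 <= r /\ p <= r by move: hr; rewrite ge_max => /andP[].
have r1 : 1 < r by apply: lt_le_trans r2; rewrite ltr1n.
have r0 : 0 <= r by rewrite ltW// (lt_trans ltr01).
have [A A1 aA] := summable_two_sided ha.
have [z [CK CK0 zP]] := exists_levels hl hp hr hg hf hF C1 C2 C3.
have z1 j : 1 <= z j by have [] := zP j.
have z0 j : 0 < z j by exact: lt_le_trans ltr01 (z1 j).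
have zgt j x : z j < x -> 2 ^+ j < moment_fun l p F x by have [_ h _ _] := zP j; exact: h.
(* The moment function is finite at x, so 2^j cannot stay below it. *)
have zoo x : exists j, x <= 2 * z j.
  pose j := Num.bound (moment_fun l p F x); exists j.
  have mf0 : 0 <= moment_fun l p F x by rewrite mulr_ge0 ?powR_ge0// le_max ler01.
  have [xz|/zgt h] := leP x (z j).
    by rewrite (le_trans xz)// ler_peMl ?ler1n// ltW.
  suff : 2 ^+ j < 2 ^+ j :> R by rewrite ltxx.
  apply: (lt_trans h); apply: (lt_trans (archi_boundP mf0)).
  by rewrite -natrX ltr_nat ltn_expl.
pose v := layer_weight (H := H) (E := E) Y0 z.
have v0 j : (0 <= v j)%E by exact: (layer_weight_ge0 hE).
have vfin j : v j \is a fin_num by case: j => [|j] //; exact: (capacity_fin hE).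
pose vr j := fine (v j); have vE j : v j = (vr j)%:E by rewrite fineK.
have vr0 j : 0 <= vr j by rewrite -lee_fin -vE.
have Wfin : (\sum_(0 <= j <oo) (2 ^+ j)%:E * v j < +oo)%E.
  pose Z w := moment_fun l p F `|Y0 w|.
  have Z0 w : 0 <= Z w by rewrite mulr_ge0 ?powR_ge0// le_max ler01.
  have := hmoment; rewrite -[X in choquet _ X]/Z (choquet_ge0E hE Z0) => /(sum_dyadic_tail_lty hE).
  apply: dyadic_weights_lty => //; [by move=> j; exact: (capacity_ge0 hE)|by rewrite /v ltry|].
  by move=> j; apply: capacity_homo => w /= /zgt.
set W := (\sum_(0 <= j <oo) (2 ^+ j)%:E * v j)%E in Wfin.
have W0 : (0 <= W)%E by apply: nneseries_ge0 => j _ _; rewrite mule_ge0// lee_fin exprn_ge0.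
have WE : W = (fine W)%:E by rewrite fineK// ge0_fin_numE.
have fW0 : 0 <= fine W by rewrite -lee_fin -WE.
have weighted_le (u : nat -> R) k : 0 <= k -> (forall j, 0 <= u j) ->
    (forall j, u j <= k * 2 ^+ j) ->
    (\sum_(0 <= j <oo) (u j)%:E * v j <= (k * fine W)%:E)%E.
  move=> k0 u0 uk; rewrite EFinM -WE /W -nneseriesZl; last first.
    by move=> j _; rewrite mule_ge0// lee_fin exprn_ge0.
  apply: lee_nneseries => [j _ _|j _]; first by rewrite mule_ge0// lee_fin.
  by rewrite muleA -EFinM lee_wpmul2r// lee_fin.
pose pi := Num.min 2 p.
have pi0 : 0 < pi by rewrite lt_min p0 ltr0n.
have pi2 : pi <= 2 by rewrite ge_min lexx.
have pip : pi <= p by rewrite ge_min lexx orbT.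
(* The summand 1 makes C0 positive. *)
pose C0 := CK * fine W + 1.
have C00 : 0 < C0 by rewrite ltr_wpDl ?mulr_ge0.
have sum_pi : (layer_sum (H := H) (E := E) Y0 z (fun x => x `^ pi)%R <= C0%:E)%E.
  apply: (@le_trans _ _ (CK * fine W)%:E); last by rewrite lee_fin lerDl.
  apply: weighted_le => // [j|j]; first exact: powR_ge0.
  have [_ _ h _] := zP j; apply: le_trans h; apply: ler_powR => //.
  by rewrite (le_trans (z1 j))// ler_peMl ?ler1n// ltW.
have [C C_ge0 tail] := layered_tail hE hEc hY hY0 hYnd hYid hmean hmeanN hX A1 aA z0 zoo r2 pi0 pi2 C00 sum_pi.
pose t := Num.max 0 (2 - p) * r / 2.
have t0 : 0 <= t by rewrite /t mulr_ge0 ?mulr_ge0// le_max lexx.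
(* The exponent of the second-moment term, written with the t of
   [condC5]. *)
have tE : - pi * (r / 2) = t - r.
  rewrite /pi /t; have [p2|p2] := leP 2 p.
    rewrite (_ : Num.max 0 _ = 0); last by apply/max_idPl; rewrite subr_le0.
    by field.
  rewrite (_ : Num.max 0 _ = 2 - p); last by apply/max_idPr; rewrite subr_ge0 ltW.
  by field.
have f_gt0 m : 0 < f m.+1 by exact: hf.
have fS m : (0 < m)%N -> f m < f m.+1 by exact: (f_ltS hF).
have lpos n : 0 < l n%:R by exact: l_nat_gt0.
pose c n := g n * l n%:R / f n.
have c0 n : (0 < n)%N -> 0 <= c n.
  by move=> n0; rewrite divr_ge0 ?mulr_ge0 ?ltW ?hg ?hf.
pose M n w := max_partial_sum Y a n w.
pose drop m := f m `^ (1 - r) - f m.+1 `^ (1 - r).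
have drop0 m : (0 < m)%N -> 0 <= drop m by exact: (power_drop_ge0 hr hf hF).
pose ker m j := kernel_factor r eps * block_kernel r f m (2 * z j).
have kf0 : 0 <= kernel_factor r eps.
  by rewrite addr_ge0// mulr_ge0 ?powR_ge0// invr_ge0 subr_ge0 ltW.
have z2 j : 0 <= 2 * z j by rewrite mulr_ge0// ltW.
have ker0 m j : (0 < m)%N -> 0 <= ker m j.
  by move=> m0; rewrite mulr_ge0// (block_kernel_ge0 hr hf hF).
pose KQ m := (\sum_(0 <= j <oo) (ker m j)%:E * v j)%E.
have KQ0 m : (0 < m)%N -> (0 <= KQ m)%E.
  by move=> m0; apply: nneseries_ge0 => j _ _; rewrite mule_ge0// lee_fin ker0.
pose D m := moment_factor C0 r t eps * (f m.+1 `^ t * drop m).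
have mf0 : 0 <= moment_factor C0 r t eps.
  by rewrite !mulr_ge0 ?powR_ge0// invr_ge0 subr_ge0 ltW.
have D0 m : (0 < m)%N -> 0 <= D m by move=> m0; rewrite mulr_ge0// mulr_ge0 ?powR_ge0// drop0.
(* The weighted bound for the integral over the block from eps * f m to
   eps * f m.+1 in the n-th Choquet integral. *)
pose I n m := if (n <= m)%N then
  ((c n)%:E * (C%:E * (n%:R%:E * KQ m + (n%:R `^ (r / 2) * D m)%:E)))%E else 0%E.
have I0 n m : (0 < n)%N -> (0 <= I n m)%E.
  move=> n0; rewrite /I; case: leqP => // nm; have m0 := leq_trans n0 nm.
  rewrite mule_ge0 ?lee_fin ?c0// mule_ge0 ?lee_fin// adde_ge0//.
    by rewrite mule_ge0 ?lee_fin// KQ0.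
  by rewrite lee_fin mulr_ge0 ?powR_ge0// D0.
have Iz n m : (m < n)%N -> I n m = 0%E by rewrite /I ltnNge => /negbTE ->.
(* The cuts start at eps * f n: for m < n they are all equal to it, which makes
   the corresponding blocks empty. *)
have term_le n : (0 < n)%N -> ((c n)%:E * choquet (capacity H E)
     (fun w => Num.max (M n w - eps * f n) 0)%R <= \sum_(0 <= m <oo) I n m)%E.
  move=> n0; pose e m := eps * f (maxn m n).
  have end_ : nondecreasing_seq e.
    move=> x y xy; rewrite /e ler_pM2l//; have [h _ _] := C1; apply: h.
      by rewrite leq_max n0 orbT.
    by rewrite geq_max leq_maxr leq_max xy.
  have eunb x : exists i, x < e i.
    have [N N0 h] := f_unbounded C1 (x / eps); exists N.
    by rewrite /e mulrC -ltr_pdivrMr// h// leq_maxl.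
  rewrite (choquet_excess_series hE (M n) end_ _ eunb); last by rewrite /e max0n.
  rewrite -nneseriesZl; last first.
    by move=> m _; apply: integral_ge0 => y _; exact: (capacity_ge0 hE).
  apply: lee_nneseries => [m _ _|m _].
    by rewrite mule_ge0 ?lee_fin ?c0//; apply: integral_ge0 => y _; exact: (capacity_ge0 hE).
  rewrite /I /e; case: leqP => nm; last first.
    by rewrite (maxn_idPr nm) set_itvco0 integral_set0 mule0//.
  rewrite (maxn_idPl (leqW nm)); have m0 := leq_trans n0 nm.
  apply: lee_wpmul2l; first by rewrite lee_fin c0.
  have fnm : eps * f n <= eps * f m by rewrite ler_pM2l//; have [h _ _] := C1; exact: h.
  exact: (integral_tail_block_le (M := M n) hE C_ge0 C00 r1 heps (hf m m0) (ltW (fS m m0)) fnm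
    (ler0n R n) t0 tE z0 v0 (fun s s0 => tail s n s0 n0)).
(* Exchanging the sums over n and m, each block receives the sums wsum. *)
apply: (@le_lt_trans _ _ (\sum_(1 <= n <oo) \sum_(0 <= m <oo) I n m)%E).
  rewrite [leLHS]eseries_cond [leRHS]eseries_cond; apply: lee_nneseries => [n _ /= n0|n /= n0].
    rewrite mule_ge0 ?lee_fin ?c0// (choquet_ge0E hE); last by move=> w; rewrite le_max lexx orbT.
    by apply: integral_ge0 => y _; exact: (capacity_ge0 hE).
  exact: term_le.
rewrite (triangular_series I0 Iz).
pose w1 := wsum f g l 1; pose w2 := wsum f g l (r / 2).
have w10 m : 0 <= w1 m by exact: (wsum_ge0 hl hg hf).
have w20 m : 0 <= w2 m by exact: (wsum_ge0 hl hg hf).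
have column m : (\sum_(1 <= n < m.+1) I n m <=
    C%:E * ((w1 m)%:E * KQ m + (w2 m * D m)%:E))%E.
  case: m => [|m].
    by rewrite big_geq// /w1 /w2 !wsum0 mul0e mul0r adde0 mule0.
  have K0 := KQ0 m.+1 isT; have D0' := D0 m.+1 isT.
  pose x s i := i.+1%:R `^ s * g i.+1 * l i.+1%:R / f i.+1.
  have x0 s i : 0 <= x s i.
    by rewrite divr_ge0 ?mulr_ge0 ?powR_ge0 ?ltW ?hg ?hf.
  have wE s : wsum f g l s m.+1 = \sum_(0 <= i < m.+1) x s i by rewrite /wsum big_add1.
  have IE i : (i < m.+1)%N -> I i.+1 m.+1 =
      (C%:E * ((x 1 i)%:E * KQ m.+1 + (x (r / 2) i * D m.+1)%:E))%E.
    move=> im; rewrite /I ltnS -ltnS im.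
    have ci := c0 i.+1 isT; rewrite muleCA; congr (_ * _)%E.
    have K1 : (0 <= i.+1%:R%:E * KQ m.+1)%E by apply: mule_ge0.
    have D1 : (0 <= (i.+1%:R `^ (r / 2) * D m.+1)%:E)%E.
      by rewrite lee_fin; apply: mulr_ge0 => //; exact: powR_ge0.
    rewrite (ge0_muleDr _ K1 D1) muleA -(EFinM (c i.+1) i.+1%:R) -(EFinM (c i.+1)); congr (_%:E * _ + _%:E)%E; rewrite /x /c ?powRr1//; ring.
  have -> : (\sum_(1 <= n < m.+2) I n m.+1 = \sum_(0 <= i < m.+1)
      C%:E * ((x 1 i)%:E * KQ m.+1 + (x (r / 2) i * D m.+1)%:E))%E.
    rewrite big_add1 /=; apply: eq_big_nat => i /andP[_ im]; exact: IE.
  have px s i : (0 <= (x s i)%:E)%E by rewrite lee_fin.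
  rewrite -ge0_sume_distrr; last first.
    by move=> i _; rewrite adde_ge0 ?mule_ge0// lee_fin mulr_ge0.
  rewrite big_split/= -ge0_sume_distrl// !sumEFin /w1 /w2 !wE mulr_suml.
  exact: lexx.
have colpos m : (0 <= (w1 m)%:E * KQ m)%E /\ (0 <= (w2 m * D m)%:E)%E.
  case: m => [|m]; first by rewrite /w1 /w2 !wsum0 mul0e mul0r.
  split; first by apply: mule_ge0; [rewrite lee_fin|exact: KQ0].
  by rewrite lee_fin; apply: mulr_ge0 => //; exact: D0.
apply: (@le_lt_trans _ _ (\sum_(0 <= m <oo) C%:E * ((w1 m)%:E * KQ m + (w2 m * D m)%:E))%E).
  apply: lee_nneseries => [m _ _|m _]; last exact: column.
  by rewrite big_add1; apply: sume_ge0 => i _; exact: I0.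
rewrite nneseriesZl; last by move=> m _; have [h1 h2] := colpos m; exact: adde_ge0.
apply: lte_mul_pinfty => //.
rewrite nneseriesD; [|by move=> m _ _; have [] := colpos m|by move=> m _ _; have [] := colpos m].
apply: lte_add_pinfty.
  pose kf := kernel_factor r eps.
  pose bk m j := w1 m * block_kernel r f m (2 * z j).
  have bk0 m j : (0 <= (bk m j)%:E)%E by exact: (kernel_term_ge0 hl hr hg hf hF m (z2 j)).
  apply: (@le_lt_trans _ _ (\sum_(0 <= m <oo) \sum_(0 <= j <oo) (kf * vr j)%:E * (bk m j)%:E)%E).
    apply: lee_nneseries => [m _ _|m _]; first by have [] := colpos m.
    case: m => [|m].
      rewrite /w1 wsum0 mul0e; apply: nneseries_ge0 => j _ _.
      by rewrite mule_ge0// lee_fin mulr_ge0.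
    rewrite /KQ -nneseriesZl; last by move=> j _; rewrite mule_ge0// lee_fin ker0.
    rewrite le_eqVlt; apply/orP; left; apply/eqP; apply: eq_eseriesr => j _.
    by rewrite vE -!EFinM; congr EFin; rewrite /ker /bk /kf; ring.
  (* For fixed j the sum over m is the kernel series at 2 z_j. *)
  rewrite nneseries_interchange; last by move=> m j; rewrite mule_ge0// lee_fin mulr_ge0.
  apply: (@le_lt_trans _ _ (kf * CK * fine W)%:E); last exact: ltry.
  apply: le_trans (weighted_le (fun j => kf * CK * 2 ^+ j) (kf * CK) _ _ _).
  - apply: lee_nneseries => [j _ _|j _].
      by apply: nneseries_ge0 => m _ _; rewrite mule_ge0// lee_fin mulr_ge0.
    rewrite nneseriesZl//; have [_ _ _ h] := zP j.
    apply: (@le_trans _ _ ((kf * vr j)%:E * (CK * 2 ^+ j)%:E)%E).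
      by apply: lee_wpmul2l; rewrite // lee_fin mulr_ge0.
    by rewrite vE -!EFinM lee_fin le_eqVlt; apply/orP; left; apply/eqP; ring.
  - exact: mulr_ge0.
  - by move=> j; rewrite !mulr_ge0 ?exprn_ge0.
  - by move=> j; exact: lexx.
have dw0 m : (0 <= (drop m * f m.+1 `^ t * w2 m)%:E)%E.
  case: m => [|m]; first by rewrite /w2 wsum0 mulr0.
  by rewrite lee_fin !mulr_ge0 ?powR_ge0 ?drop0.
rewrite (eq_eseriesr (g := fun m => ((moment_factor C0 r t eps)%:E * (drop m * f m.+1 `^ t * w2 m)%:E)%E)); last first.
  by move=> m _; rewrite -EFinM; congr EFin; rewrite /D; ring.
rewrite nneseriesZl//; apply: lte_mul_pinfty => //.
rewrite (nneseries_split 0 1)// big_nat1 add0n.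
apply: lte_add_pinfty; first exact: ltry.
exact: C5.
Qed.
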